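(* Let $k$ be a field of characteristic zero and $\alpha\in\mathbb{R}_{>0}^n$. Let $P(Z)\in k[[x_1,\dots,x_n]][Z]$ be a monic polynomial whose discriminant is equal to $\delta u$, where $\delta\in k[x_1,\dots,x_n]$ is $(\alpha)$-homogeneous and $u\in k[[x_1,\dots,x_n]]$ is a unit. If $P(Z)=P_1(Z)\cdots P_s(Z)$ where each $P_i(Z)$ is an irreducible monic polynomial of $k[[x_1,\dots,x_n]][Z]$, then each $P_i(Z)$ is irreducible in $\widehat V_{\alpha}[Z]$.
   Context: Here $n\ge 2$. The monomial valuation $\nu_\alpha$ on $k[[x_1,\dots,x_n]]$ is $\nu_\alpha\big(\sum_\beta c_\beta x^\beta\big)=\min\{\sum_j\alpha_j\beta_j : c_\beta\neq 0\}$, extended to the fraction field $K_n$ of $k[[x_1,\dots,x_n]]$ by $\nu_\alpha(f/g)=\nu_\alpha(f)-\nu_\alpha(g)$. Its valuation ring is $V_{\nu_\alpha}=\{h\in K_n : \nu_\alpha(h)\ge 0\}$, and $\widehat V_\alpha$ denotes the completion of $V_{\nu_\alpha}$ for the topology having the ideals $\{v\in V_{\nu_\alpha}:\nu_\alpha(v)\ge\lambda\}$, with $\lambda$ in the value group $\mathbb{Z}\alpha_1+\cdots+\mathbb{Z}\alpha_n$, as a system of neighbourhoods of $0$. A polynomial in $k[x_1,\dots,x_n]$ is $(\alpha)$-homogeneous of degree $i$ if each of its nonzero monomials $c\,x^\beta$ satisfies $\sum_j\alpha_j\beta_j=i$ (weighted homogeneous, $x_j$ having weight $\alpha_j$).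
   Formalization: The formal theorem additionally assumes δ ≠ 0; for δ = 0 the claim fails, e.g. P = P₁² with P₁ = Z² − (x₁² + x₂³) and α = (1,1), since x₁² + x₂³ becomes a square in the completion. *)

(* Defs.v *)
From HB Require Import structures.
From mathcomp Require Import all_boot all_order all_algebra.
From mathcomp Require Import archimedean interval_inference.
From mathcomp Require Import mpoly.
From mathcomp Require Import boolp classical_sets functions reals.
From mathcomp Require Import constructive_ereal ereal.

Set Implicit Arguments.
Unset Strict Implicit.
Unset Printing Implicit Defensive.

Import Order.TTheory GRing.Theory Num.Theory.
Local Open Scope ring_scope.

Record mseries (n : nat) (k : nzRingType) :=
  MSeries { mscoef : 'X_{1..n} -> k }.

HB.instance Definition _ n k := [isNew for @mscoef n k].
HB.instance Definition _ n (k : nzRingType) := [Choice of mseries n k by <:].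

Section Series.
Context {n : nat} {k : nzRingType}.
Implicit Types f g h : mseries n k.

Lemma mseriesP f g : (forall m, mscoef f m = mscoef g m) <-> f = g.
Proof. by split=> [h|-> //]; apply: val_inj; apply/funext => m; exact: h. Qed.

Definition mpoly_series (p : {mpoly k[n]}) : mseries n k :=
  MSeries (fun m => p@_m).

Definition mszero : mseries n k := MSeries (fun _ => 0).
Definition msone : mseries n k := MSeries (fun m => (m == 0%MM)%:R).
Definition msopp f : mseries n k := MSeries (fun m => - mscoef f m).
Definition msadd f g : mseries n k :=
  MSeries (fun m => mscoef f m + mscoef g m).
(* the finite sum over all pairs of monomials with product [m] *)
Definition msmul f g : mseries n k :=
  MSeries (fun m =>
    \sum_(q : 'X_{1..n < (mdeg m).+1, (mdeg m).+1} | m == (q.1 + q.2)%MM)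
      mscoef f q.1 * mscoef g q.2).

Lemma msaddA : associative msadd.
Proof. by move=> f g h; apply/mseriesP => m /=; rewrite addrA. Qed.
Lemma msaddC : commutative msadd.
Proof. by move=> f g; apply/mseriesP => m /=; rewrite addrC. Qed.
Lemma msadd0 : left_id mszero msadd.
Proof. by move=> f; apply/mseriesP => m /=; rewrite add0r. Qed.
Lemma msaddN : left_inverse mszero msopp msadd.
Proof. by move=> f; apply/mseriesP => m /=; rewrite addNr. Qed.

HB.instance Definition _ := GRing.isZmodule.Build (mseries n k)
  msaddA msaddC msadd0 msaddN.

(* the ring axioms are inherited from polynomials by truncation *)
Definition mstrunc (d : nat) f : {mpoly k[n]} :=
  \sum_(m : 'X_{1..n < d}) mscoef f m *: 'X_[m].

Lemma mstruncE d f m : (mdeg m < d)%N -> (mstrunc d f)@_m = mscoef f m.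
Proof. exact: mcoeff_mpoly. Qed.

Lemma mcoeffM_eq (p p' q q' : {mpoly k[n]}) m :
  (forall m', (mdeg m' <= mdeg m)%N -> p@_m' = p'@_m') ->
  (forall m', (mdeg m' <= mdeg m)%N -> q@_m' = q'@_m') ->
  (p * q)@_m = (p' * q')@_m.
Proof.
move=> hp hq; rewrite !mcoeffM; apply: eq_bigr => -[a b] /= _.
by rewrite hp ?hq // -ltnS bmdeg.
Qed.

Lemma msmulE d f g m : (mdeg m < d)%N ->
  mscoef (msmul f g) m = (mstrunc d f * mstrunc d g)@_m.
Proof.
move=> md; rewrite mcoeffM /=; apply: eq_bigr => -[a b] /= _.
by rewrite !mstruncE //; apply: leq_trans md; rewrite bmdeg.
Qed.

Lemma mstruncM d f g m : (mdeg m < d)%N ->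
  (mstrunc d (msmul f g))@_m = (mstrunc d f * mstrunc d g)@_m.
Proof. by move=> md; rewrite mstruncE // (msmulE f g md). Qed.

Lemma msmulA : associative msmul.
Proof.
move=> f g h; apply/mseriesP => m; have md := ltnSn (mdeg m).
rewrite !(msmulE _ _ md).
rewrite (@mcoeffM_eq _ (mstrunc (mdeg m).+1 f) _
          (mstrunc (mdeg m).+1 g * mstrunc (mdeg m).+1 h)) //; last first.
  by move=> m' le; rewrite mstruncM.
rewrite mulrA; apply: mcoeffM_eq => // m' le.
by rewrite mstruncM.
Qed.

Lemma mstrunc1 d m : (mdeg m < d)%N -> (mstrunc d msone)@_m = 1@_m.
Proof. by move=> md; rewrite mstruncE // mcoeff1. Qed.

Lemma msmul1 : left_id msone msmul.
Proof.
move=> f; apply/mseriesP => m; have md := ltnSn (mdeg m).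
rewrite (msmulE _ _ md) -(mstruncE f md) -[RHS](congr1 (mcoeff m) (mul1r _)).
by apply: mcoeffM_eq => // m' le; rewrite mstrunc1.
Qed.

Lemma mulms1 : right_id msone msmul.
Proof.
move=> f; apply/mseriesP => m; have md := ltnSn (mdeg m).
rewrite (msmulE _ _ md) -(mstruncE f md) -[RHS](congr1 (mcoeff m) (mulr1 _)).
by apply: mcoeffM_eq => // m' le; rewrite mstrunc1.
Qed.

Lemma msmulDl : left_distributive msmul msadd.
Proof.
move=> f g h; apply/mseriesP => m /=; rewrite -big_split /=.
by apply: eq_bigr => q _; rewrite mulrDl.
Qed.

Lemma msmulDr : right_distributive msmul msadd.
Proof.
move=> f g h; apply/mseriesP => m /=; rewrite -big_split /=.
by apply: eq_bigr => q _; rewrite mulrDr.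
Qed.

Lemma msone_neq0 : msone != 0.
Proof.
apply/eqP => /(congr1 (fun f => mscoef f 0%MM)) /= /eqP.
by rewrite eqxx oner_eq0.
Qed.

HB.instance Definition _ := GRing.Zmodule_isNzRing.Build (mseries n k)
  msmulA msmul1 mulms1 msmulDl msmulDr msone_neq0.

Lemma mscoefM f g m :
  mscoef (f * g) m =
    \sum_(q : 'X_{1..n < (mdeg m).+1, (mdeg m).+1} | m == (q.1 + q.2)%MM)
      mscoef f q.1 * mscoef g q.2.
Proof. by []. Qed.

End Series.

Section ComSeries.
Context {n : nat} {k : comNzRingType}.

Lemma msmulC : commutative (@msmul n k).
Proof.
move=> f g; apply/mseriesP => m; have md := ltnSn (mdeg m).
by rewrite !(msmulE _ _ md) mulrC.
Qed.

HB.instance Definition _ :=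
  GRing.PzRing_hasCommutativeMul.Build (mseries n k) msmulC.

Definition msunit : {pred mseries n k} := fun f => `[< exists g, g * f = 1 >].
Definition msinv (f : mseries n k) : mseries n k :=
  if pselect (exists g, g * f = 1) is left e then projT1 (cid e) else f.

Lemma msmulV : {in msunit, left_inverse 1 msinv *%R}.
Proof.
by move=> f /asboolP e; rewrite /msinv; case: pselect => // e'; case: cid.
Qed.
Lemma msunitP (f g : mseries n k) : g * f = 1 -> f \in msunit.
Proof. by move=> e; apply/asboolP; exists g. Qed.
Lemma msinv_out : {in [predC msunit], msinv =1 id}.
Proof.
by move=> f /negP nu; rewrite /msinv; case: pselect => // e; case: nu; exact/asboolP.
Qed.

HB.instance Definition _ := GRing.ComNzRing_hasMulInverse.Build (mseries n k)
  msmulV msunitP msinv_out.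

End ComSeries.

Section Weight.
Context {n : nat} {F : archiRealFieldType}.
Variable w : 'I_n -> {posnum F}.

Definition mnmweight (m : 'X_{1..n}) : F := \sum_(j < n) (w j)%:num * (m j)%:R.

Definition weighted_homog (k : nzRingType) (i : F) (p : {mpoly k[n]}) :=
  forall m, m \in msupp p -> mnmweight m = i.

Lemma mnmweightD m1 m2 : mnmweight (m1 + m2)%MM = mnmweight m1 + mnmweight m2.
Proof.
rewrite /mnmweight -big_split /=; apply: eq_bigr => i _.
by rewrite mnmDE natrD mulrDr.
Qed.

Lemma mnmweight0 : mnmweight 0%MM = 0.
Proof. by rewrite /mnmweight big1 // => i _; rewrite mnm0E mulr0. Qed.

Lemma mnmweight_ge0 m : 0 <= mnmweight m.
Proof. by apply: sumr_ge0 => i _; apply: mulr_ge0. Qed.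

Lemma mnmweight_bounded (c : F) :
  exists d, forall m, mnmweight m <= c -> (mdeg m < d)%N.
Proof.
have le1 m j : mnmweight m <= c -> (m j <= Num.bound (c / (w j)%:num))%N.
  move=> mc; rewrite -(ler_nat F) ltW //.
  apply: le_lt_trans (archi_boundP _); last first.
    by rewrite divr_ge0 // (le_trans (mnmweight_ge0 m)).
  rewrite ler_pdivlMr // mulrC; apply: le_trans mc.
  rewrite /mnmweight (bigD1 j) //= lerDl; apply: sumr_ge0 => i _.
  by apply: mulr_ge0.
exists (\sum_(j < n) Num.bound (c / (w j)%:num)).+1 => m mc.
by rewrite ltnS mdegE leq_sum // => j _; exact: le1.
Qed.

(* a monomial of minimal weight; ties are broken by the order of mpoly *)
Lemma mseries_min (k : nzRingType) (f : mseries n k) : f != 0 ->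
  exists m, [/\ mscoef f m != 0,
    forall m', mscoef f m' != 0 -> mnmweight m <= mnmweight m' &
    forall m', mscoef f m' != 0 -> mnmweight m' = mnmweight m -> (m <= m')%O].
Proof.
move=> f0; have [m0 fm0] : exists m, mscoef f m != 0.
  apply: contrapT => nex; move/eqP: f0; apply; apply/mseriesP => m /=.
  by apply/eqP; apply: contrapT => /negP fm; apply: nex; exists m.
have [d dP] := mnmweight_bounded (mnmweight m0).
pose supp := [pred m : 'X_{1..n < d} | mscoef f m != 0].
pose b0 : 'X_{1..n < d} := Sub m0 (dP _ (lexx _)).
have sb0 : supp b0 by [].
case: (@arg_minP _ _ _ b0 supp (fun m => mnmweight m) sb0) => b1 sb1 min1.
have min1' m : mscoef f m != 0 -> mnmweight b1 <= mnmweight m.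
  move=> fm; have [le|lt] := leP (mnmweight m) (mnmweight m0).
    exact: (min1 (Sub m (dP _ le))).
  by apply: le_trans (ltW lt); exact: min1 sb0.
pose supp2 := [pred m : 'X_{1..n < d} |
  (mscoef f m != 0) && (mnmweight m == mnmweight b1)].
have sb1' : supp2 b1 by rewrite /= eqxx andbT.
case: (@arg_minP _ _ _ b1 supp2 (fun m => bmnm m) sb1') => b /andP[fb /eqP wb] min2.
exists b; split=> // m; rewrite wb; first exact: min1'.
move=> fm wm; have le : mnmweight m <= mnmweight m0.
  by rewrite wm; exact: min1 sb0.
by apply: (min2 (Sub m (dP _ le))); rewrite /= fm wm eqxx.
Qed.

Lemma mscoefM_min (k : nzRingType) (f g : mseries n k) a b :
  (forall m, mscoef f m != 0 -> mnmweight a <= mnmweight m) ->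
  (forall m, mscoef f m != 0 -> mnmweight m = mnmweight a -> (a <= m)%O) ->
  (forall m, mscoef g m != 0 -> mnmweight b <= mnmweight m) ->
  (forall m, mscoef g m != 0 -> mnmweight m = mnmweight b -> (b <= m)%O) ->
  mscoef (f * g) (a + b)%MM = mscoef f a * mscoef g b.
Proof.
move=> fa fa' gb gb'; rewrite mscoefM.
have la : (mdeg a < (mdeg (a + b)%MM).+1)%N by rewrite mdegD ltnS leq_addr.
have lb : (mdeg b < (mdeg (a + b)%MM).+1)%N by rewrite mdegD ltnS leq_addl.
rewrite (bigD1 (BMultinom la, BMultinom lb)) //= big1 ?addr0 // => -[p q] /=.
case/andP=> /eqP ab ne; apply/eqP; apply: contrapT => /negP nz.
have fp : mscoef f p != 0 by apply: contraNneq nz => ->; rewrite mul0r.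
have gq : mscoef g q != 0 by apply: contraNneq nz => ->; rewrite mulr0.
have /eqP := congr1 mnmweight ab; rewrite !mnmweightD => /eqP wab.
have wp : mnmweight p = mnmweight a.
  by apply: le_anti; rewrite fa // andbT -(lerD2r (mnmweight q)) -wab lerD2l gb.
have wq : mnmweight q = mnmweight b by apply: (addrI (mnmweight a)); rewrite wab wp.
have lap := fa' _ fp wp; have lbq := gb' _ gq wq.
have pa : (p : 'X_{1..n}) = a.
  apply/eqP; rewrite eq_sym; apply: contraT => nap.
  have : (a < p)%O by rewrite lt_neqAle nap lap.
  by move=> /ltmc_le_add /(_ lbq); rewrite -ab ltxx.
have qb : (q : 'X_{1..n}) = b by move: ab; rewrite pa => /addmI.
by case/eqP: ne; congr pair; apply: val_inj.
Qed.

End Weight.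

Section DomainSeries.
Context {n : nat} {k : idomainType}.

Lemma mseries_idomain : GRing.integral_domain_axiom (mseries n k).
Proof.
move=> f g fg0; apply: contraT; rewrite negb_or => /andP[f0 g0].
pose w : 'I_n -> {posnum rat} := fun=> PosNum ltr01.
have [a [fa a1 a2]] := mseries_min w f0.
have [b [gb b1 b2]] := mseries_min w g0.
have := mscoefM_min a1 a2 b1 b2; rewrite fg0 /= => /esym/eqP.
by rewrite mulf_eq0 (negPf fa) (negPf gb).
Qed.

HB.instance Definition _ :=
  GRing.ComUnitRing_isIntegral.Build (mseries n k) mseries_idomain.

End DomainSeries.

Lemma fraction_repr (A : idomainType) (h : {fraction A}) :
  h = FracField.tofrac (\n_(repr h)) / FracField.tofrac (\d_(repr h)).
Proof.
have d0 := denom_ratioP (repr h).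
have td0 : FracField.tofrac (\d_(repr h)) != 0 by rewrite tofrac_eq0.
apply: (mulIf td0); rewrite divfK //.
rewrite -{1}[h]reprK; unlock FracField.tofrac.
rewrite -[LHS]FracField.pi_mul; apply/eqmodP; rewrite /= FracField.equivfE.
rewrite /FracField.mulf !numden_Ratio ?mulf_neq0 ?oner_neq0 //.
by rewrite !mulr1 mulrC.
Qed.

Lemma fraction_cross (A : idomainType) (f g : A) : g != 0 ->
  let h := FracField.tofrac f / FracField.tofrac g in
  f * \d_(repr h) = \n_(repr h) * g.
Proof.
move=> g0 h; apply/eqP; rewrite -tofrac_eq !tofracM.
rewrite -eqr_div ?tofrac_eq0 ?denom_ratioP //.
by apply/eqP; exact: fraction_repr.
Qed.

Section Valuation.
Context {R : realType} {n : nat} {k : fieldType}.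
Variable alpha : 'I_n -> {posnum R}.

Local Open Scope ereal_scope.
Local Open Scope classical_set_scope.

(* A minimum (see [series_val_min]), which is [+oo] for the zero series. *)
Definition series_val (f : mseries n k) : \bar R :=
  ereal_inf [set (mnmweight alpha m)%:E | m in [set m | mscoef f m != 0%R]].

Lemma series_val0 : series_val 0%R = +oo.
Proof.
rewrite /series_val [X in ereal_inf X](_ : _ = set0) ?ereal_inf0 //.
by apply/seteqP; split=> // x [m] /=; rewrite eqxx.
Qed.

Lemma series_val_min (f : mseries n k) (m : 'X_{1..n}) :
    mscoef f m != 0%R ->
    (forall m', mscoef f m' != 0%R ->
      (mnmweight alpha m <= mnmweight alpha m')%R) ->
  series_val f = (mnmweight alpha m)%:E.
Proof.
move=> fm mmin; apply/eqP; rewrite eq_le; apply/andP; split.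
  by apply: ereal_inf_lbound; exists m.
by apply: le_ereal_inf_tmp => _ [m' fm' <-]; rewrite lee_fin; exact: mmin.
Qed.

Lemma series_val_attained (f : mseries n k) : f != 0%R ->
  exists2 m, mscoef f m != 0%R & series_val f = (mnmweight alpha m)%:E.
Proof.
move=> /(mseries_min alpha)[m [fm mmin _]].
by exists m => //; exact: series_val_min.
Qed.

Lemma series_val_ge0 f : 0 <= series_val f.
Proof.
by apply: le_ereal_inf_tmp => _ [m' fm' <-]; rewrite lee_fin mnmweight_ge0.
Qed.

Lemma series_valNy f : (series_val f == -oo) = false.
Proof. by have := series_val_ge0 f; case: series_val. Qed.

Lemma series_val_pinfty f : (series_val f == +oo) = (f == 0%R).
Proof.
have [->|f0] := eqVneq f 0%R; first by rewrite series_val0.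
by have [m _ ->] := series_val_attained f0.
Qed.

Lemma series_val_fin f : f != 0%R -> series_val f \is a fin_num.
Proof. by move=> /series_val_attained[m _ ->]. Qed.

Lemma series_val1 : series_val 1%R = 0.
Proof.
rewrite (@series_val_min _ 0%MM) ?mnmweight0 //=.
  by rewrite eqxx oner_neq0.
by move=> m' _; exact: mnmweight_ge0.
Qed.

Lemma series_valM f g : series_val (f * g)%R = series_val f + series_val g.
Proof.
have [->|f0] := eqVneq f 0%R.
  by rewrite mul0r series_val0 addye ?series_valNy.
have [->|g0] := eqVneq g 0%R.
  by rewrite mulr0 series_val0 addey ?series_valNy.
have [a [fa a1 a2]] := mseries_min alpha f0.
have [b [gb b1 b2]] := mseries_min alpha g0.
rewrite (series_val_min fa a1) (series_val_min gb b1) -EFinD -mnmweightD.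
apply: series_val_min; first by rewrite (mscoefM_min a1 a2 b1 b2) mulf_neq0.
move=> m; rewrite mscoefM => nz.
have [[p q] /= /andP[/eqP mpq pq]] : exists q :
    'X_{1..n < (mdeg m).+1, (mdeg m).+1}, (m == (q.1 + q.2)%MM) &&
      (mscoef f q.1 * mscoef g q.2 != 0)%R.
  apply: contrapT => nex; move/eqP: nz; apply; apply: big1 => q mq.
  by apply/eqP; apply: contrapT => /negP pq; apply: nex; exists q; rewrite mq.
rewrite [in leRHS]mpq !mnmweightD lerD //.
  by apply: a1; apply: contraNneq pq => ->; rewrite mul0r.
by apply: b1; apply: contraNneq pq => ->; rewrite mulr0.
Qed.

Lemma series_valN f : series_val (- f)%R = series_val f.
Proof.
rewrite /series_val; congr ereal_inf; congr image.
by apply/seteqP; split=> m /=; rewrite oppr_eq0.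
Qed.

Lemma series_valD f g (c : \bar R) :
  c <= series_val f -> c <= series_val g -> c <= series_val (f + g)%R.
Proof.
move=> cf cg; apply: le_ereal_inf_tmp => _ [m /= fgm <-].
have [fm|fm] := eqVneq (mscoef f m) 0%R.
  apply: (le_trans cg); apply: ereal_inf_lbound; exists m => //=.
  by apply: contraNneq fgm => gm; rewrite fm gm addr0.
by apply: (le_trans cf); apply: ereal_inf_lbound; exists m.
Qed.

Definition frac_val (h : {fraction (mseries n k)}) : \bar R :=
  series_val (\n_(repr h)) - series_val (\d_(repr h)).

Lemma frac_val_frac (f g : mseries n k) : g != 0%R ->
  frac_val (FracField.tofrac f / FracField.tofrac g)%R =
  series_val f - series_val g.
Proof.
move=> g0; have := fraction_cross f g0; rewrite /frac_val /=.
move: (denom_ratioP (repr (FracField.tofrac f / FracField.tofrac g)%R)).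
move: (\n_(repr _)) (\d_(repr _)) => a b b0.
move=> /(congr1 series_val); rewrite !series_valM.
move: (series_val_fin b0) (series_val_fin g0) (series_valNy f) (series_valNy a).
case: (series_val b) (series_val g) (series_val f) (series_val a) =>
  [b'||] // [g'||] // [f'||] // [a'||] // _ _ _ _ [e].
rewrite -!EFinB; congr EFin; apply/eqP.
by rewrite subr_eq addrAC eq_sym subr_eq e.
Qed.

Lemma frac_val_tofrac (f : mseries n k) :
  frac_val (FracField.tofrac f) = series_val f.
Proof.
have := frac_val_frac f (oner_neq0 _).
by rewrite tofrac1 divr1 series_val1 sube0.
Qed.

Lemma frac_val0 : frac_val 0%R = +oo.
Proof. by rewrite -tofrac0 frac_val_tofrac series_val0. Qed.

Lemma frac_val1 : frac_val 1%R = 0.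
Proof. by rewrite -tofrac1 frac_val_tofrac series_val1. Qed.

Lemma frac_valN h : frac_val (- h)%R = frac_val h.
Proof.
by rewrite {1}[h]fraction_repr -mulNr -tofracN frac_val_frac ?denom_ratioP //
  series_valN.
Qed.

Lemma frac_valM h1 h2 : frac_val (h1 * h2)%R = frac_val h1 + frac_val h2.
Proof.
rewrite {1}[h1]fraction_repr {1}[h2]fraction_repr mulf_div -!tofracM.
rewrite frac_val_frac ?mulf_neq0 ?denom_ratioP // !series_valM /frac_val.
move: (denom_ratioP (repr h1)) (denom_ratioP (repr h2)).
move=> /series_val_fin + /series_val_fin.
move: (series_val_ge0 (\n_(repr h1))) (series_val_ge0 (\n_(repr h2))).
case: (series_val \d_(repr h1)) (series_val \d_(repr h2))
  (series_val \n_(repr h1)) (series_val \n_(repr h2)) =>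
  [b'||] // [g'||] // [f'||] // [a'||] //= _ _ _ _.
by rewrite opprD addrACA.
Qed.

Lemma frac_valD h1 h2 (c : R) : c%:E <= frac_val h1 -> c%:E <= frac_val h2 ->
  c%:E <= frac_val (h1 + h2)%R.
Proof.
rewrite {2}[h1]fraction_repr {2}[h2]fraction_repr /frac_val.
move: (denom_ratioP (repr h1)) (denom_ratioP (repr h2)).
move: (\n_(repr h1)) (\n_(repr h2)) (\d_(repr h1)) (\d_(repr h2)).
move=> a1 a2 b1 b2 b10 b20.
rewrite addf_div ?tofrac_eq0 // -!tofracM -tofracD.
rewrite -/(frac_val _) frac_val_frac ?mulf_neq0 //.
have fb1 := series_val_fin b10; have fb2 := series_val_fin b20.
rewrite !leeBrDr ?series_valM ?fin_numD ?fb1 ?fb2 // => le1 le2.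
apply: series_valD; rewrite series_valM.
  by rewrite addeA leeD.
by rewrite (addeC (series_val b1)) addeA leeD.
Qed.

Definition valuation_ring_pred : {pred {fraction (mseries n k)}} :=
  fun h => 0 <= frac_val h.

Lemma valuation_ring_subring : subring_closed valuation_ring_pred.
Proof.
split=> [|g h|g h]; rewrite !unfold_in.
- by rewrite frac_val1.
- by move=> g0 h0; apply: frac_valD; rewrite ?frac_valN.
- by move=> g0 h0; rewrite frac_valM adde_ge0.
Qed.

HB.instance Definition _ := GRing.isSubringClosed.Build
  {fraction (mseries n k)} valuation_ring_pred valuation_ring_subring.

End Valuation.

Section ValuationRing.
Context {R : realType} {n : nat} (k : fieldType).
Variable alpha : 'I_n -> {posnum R}.

Record valuation_ring := ValuationRing {
  valuation_ring_val :> {fraction (mseries n k)};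
  _ : valuation_ring_val \in valuation_ring_pred alpha
}.

HB.instance Definition _ := [isSub for valuation_ring_val].
HB.instance Definition _ := [Choice of valuation_ring by <:].
HB.instance Definition _ := [SubChoice_isSubComNzRing of valuation_ring by <:].

Fact series_to_valuation_ring_subproof (f : mseries n k) :
  FracField.tofrac f \in valuation_ring_pred alpha.
Proof. by rewrite unfold_in frac_val_tofrac series_val_ge0. Qed.

Definition series_to_valuation_ring (f : mseries n k) : valuation_ring :=
  ValuationRing (series_to_valuation_ring_subproof f).

Fact series_to_valuation_ring_zmod : zmod_morphism series_to_valuation_ring.
Proof. by move=> f g; apply: val_inj; rewrite /= rmorphB. Qed.

Fact series_to_valuation_ring_monoid :
  monoid_morphism series_to_valuation_ring.
Proof. by split=> [|f g]; apply: val_inj; rewrite /= ?rmorph1 ?rmorphM. Qed.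

HB.instance Definition _ := GRing.isZmodMorphism.Build _ _
  series_to_valuation_ring series_to_valuation_ring_zmod.
HB.instance Definition _ := GRing.isMonoidMorphism.Build _ _
  series_to_valuation_ring series_to_valuation_ring_monoid.

Definition value_group : set R :=
  [set l | exists z : 'I_n -> int, l = \sum_(j < n) (alpha j)%:num *~ z j].

Definition val_nbhs (l : R) : set valuation_ring :=
  [set v | (l%:E <= frac_val alpha v)%E].

Lemma val_nbhsD l u v : val_nbhs l u -> val_nbhs l v -> val_nbhs l (u + v).
Proof. by rewrite /val_nbhs /=; exact: frac_valD. Qed.

Lemma val_nbhsN l u : val_nbhs l u -> val_nbhs l (- u).
Proof. by rewrite /val_nbhs /= frac_valN. Qed.

Lemma val_nbhsM l u v : val_nbhs l v -> val_nbhs l (u * v).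
Proof.
rewrite /val_nbhs /= frac_valM => lv.
by rewrite -[l%:E]add0e leeD //; case: u.
Qed.

Lemma val_nbhs0 l : val_nbhs l 0.
Proof. by rewrite /val_nbhs /= frac_val0 leey. Qed.

End ValuationRing.

(* Neighbourhoods of 0 indexed by the positive integer multiples of any
   [alpha j] form a countable basis, so the completion may be obtained as the
   ring of Cauchy sequences modulo the ideal of null sequences.  With no
   variable the value group is trivial and the completion is the zero ring,
   hence the [n.+1]. *)
Section Completion.
Context {R : realType} {n : nat} (k : fieldType).
Variable alpha : 'I_n.+1 -> {posnum R}.
Local Notation V := (valuation_ring k alpha).

Definition cauchy_pred : {pred nat -> V} := fun u =>
  `[< forall l, value_group alpha l -> exists N, forall i j : nat,
        (N <= i)%N -> (N <= j)%N -> val_nbhs l (u i - u j) >].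

Lemma cauchy_subring : subring_closed cauchy_pred.
Proof.
split=> [|u v /asboolP cu /asboolP cv|u v /asboolP cu /asboolP cv];
  apply/asboolP => l Gl.
- by exists 0%N => i j _ _; rewrite subrr; exact: val_nbhs0.
- have [N cuN] := cu l Gl; have [M cvM] := cv l Gl.
  exists (maxn N M) => i j; rewrite !geq_max => /andP[iN iM] /andP[jN jM].
  have -> : (u - v) i - (u - v) j = (u i - u j) - (v i - v j).
    by rewrite !opprB addrACA [RHS]addrACA; congr (_ + _); rewrite addrC.
  by apply: val_nbhsD; [exact: cuN|apply: val_nbhsN; exact: cvM].
- have [N cuN] := cu l Gl; have [M cvM] := cv l Gl.
  exists (maxn N M) => i j; rewrite !geq_max => /andP[iN iM] /andP[jN jM].
  have -> : (u * v) i - (u * v) j = v i * (u i - u j) + u j * (v i - v j).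
    by rewrite !mulrBr [v i * u j]mulrC addrA subrK [v i * _]mulrC.
  by apply: val_nbhsD; apply: val_nbhsM; [exact: cuN|exact: cvM].
Qed.

HB.instance Definition _ := GRing.isSubringClosed.Build
  (nat -> V) cauchy_pred cauchy_subring.

Record cauchy_seq := CauchySeq {
  cauchy_seq_val :> nat -> V;
  _ : cauchy_seq_val \in cauchy_pred
}.
HB.instance Definition _ := [isSub for cauchy_seq_val].
HB.instance Definition _ := [Choice of cauchy_seq by <:].
HB.instance Definition _ := [SubChoice_isSubComNzRing of cauchy_seq by <:].

Definition null_pred : {pred cauchy_seq} := fun u =>
  `[< forall l, value_group alpha l -> exists N, forall i : nat,
        (N <= i)%N -> val_nbhs l (u i) >].

Lemma null_ideal : idealr_closed null_pred.
Proof.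
split=> [||a u v /asboolP nu /asboolP nv].
- by apply/asboolP => l _; exists 0%N => i _; exact: val_nbhs0.
- apply/negP => /asboolP /(_ (alpha ord0)%:num) [|N /(_ N (leqnn _))].
    exists (fun j => (j == ord0)%:Z); rewrite (bigD1 ord0) //= mulr1z.
    by rewrite big1 ?addr0 // => j /negPf ->.
  by rewrite /val_nbhs /= frac_val1 lee_fin leNgt gt0.
- apply/asboolP => l Gl; have [N nuN] := nu l Gl; have [M nvM] := nv l Gl.
  exists (maxn N M) => i; rewrite geq_max => /andP[iN iM].
  by apply: val_nbhsD; [apply: val_nbhsM; exact: nuN|exact: nvM].
Qed.

HB.instance Definition _ := isIdealr.Build cauchy_seq null_pred null_ideal.

Definition completion : Type := {ideal_quot null_pred}.
HB.instance Definition _ := GRing.ComNzRing.on completion.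

Fact const_cauchy (v : V) : (fun _ : nat => v) \in cauchy_pred.
Proof.
by apply/asboolP => l _; exists 0%N => i j _ _; rewrite subrr; exact: val_nbhs0.
Qed.

Definition const_cauchy_seq (v : V) : cauchy_seq := CauchySeq (const_cauchy v).

Definition series_to_completion (f : mseries n.+1 k) : completion :=
  \pi_({ideal_quot null_pred})%qT
    (const_cauchy_seq (series_to_valuation_ring alpha f)).

Fact series_to_completion_zmod : zmod_morphism series_to_completion.
Proof.
move=> f g; rewrite /series_to_completion -rmorphB; congr (\pi%qT _).
by apply: val_inj; apply/funext => i; rewrite /= rmorphB.
Qed.

Fact series_to_completion_monoid : monoid_morphism series_to_completion.
Proof.
split=> [|f g]; rewrite /series_to_completion.
  rewrite -[RHS](rmorph1 (\pi_({ideal_quot null_pred})%qT)); congr (\pi%qT _).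
  by apply: val_inj; apply/funext => i; rewrite /= rmorph1.
rewrite -[RHS]rmorphM; congr (\pi%qT _).
by apply: val_inj; apply/funext => i; rewrite /= rmorphM.
Qed.

HB.instance Definition _ := GRing.isZmodMorphism.Build _ _
  series_to_completion series_to_completion_zmod.
HB.instance Definition _ := GRing.isMonoidMorphism.Build _ _
  series_to_completion series_to_completion_monoid.

End Completion.

(* Irreducible element of a commutative ring: [irreducible_poly] of polydiv is
   only meaningful over a field, and [GRing.unit] on polynomials needs an
   integral domain. *)
Definition invertible (A : comNzRingType) (a : A) := exists b, b * a = 1.

Definition irreducible_elt (A : comNzRingType) (a : A) : Prop :=
  ~ invertible a /\
  forall b c, a = b * c -> invertible b \/ invertible c.

(* For monic [p] of degree [d] whose derivative has degree [d - 1]: [resultant]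
   sizes the Sylvester matrix by the actual degree of [p^`()], so this is the
   usual discriminant in characteristic 0 (e.g. b ^ 2 - 4 c for
   'X^2 + b 'X + c). *)
Definition discriminant (A : comNzRingType) (p : {poly A}) : A :=
  let d := (size p).-1 in (-1) ^+ 'C(d, 2) * resultant p p^`().

(* Main.v *)
From HB Require Import structures.
Require Import Defs.
From mathcomp Require Import all_boot all_order all_algebra archimedean.
From mathcomp Require Import ring lra zify.
From mathcomp Require Import interval_inference mpoly boolp.
From mathcomp Require Import classical_sets functions reals constructive_ereal ereal.

Set Implicit Arguments.
Unset Strict Implicit.
Unset Printing Implicit Defensive.

Import Order.TTheory GRing.Theory Num.Theory.
Local Open Scope ring_scope.

(** Let [A] be the power series ring, [C] the completed valuation ring and [D]
    the discriminant of [P], so that [D = delta * u].  A factorization of an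
    irreducible factor of [P] over [C] gives monic [Q] and [T] over [C] with
    [Q * T = P], and everything comes down to showing that the coefficients of
    [Q] are power series ([factor_coefs_in_series]).

    The idea is that [P] is unramified off a cone, so its factors inherit the
    scaling symmetry of that cone.  The symmetry is used infinitesimally.  An
    integer weight [psi] on the variables that respects all rational relations
    between the [alpha j] gives an Euler derivation, which multiplies a monomial
    by its [psi]-weight.  It multiplies a weighted homogeneous series by a
    constant, hence maps [D] into [D * A]: it is logarithmic along the
    discriminant.  It extends to [C] and to its fraction field.

    Let [B] be the [A]-algebra generated by the coefficients of [Q] and [T].  It
    is finite over [A].  A Bezout relation [D = U * P + W * P'] shows that an
    Euler derivation maps [B] into [D^-1 * B] ([factor_deriv_coefs]).  Iterating
    naively would produce unbounded powers of [D] in the denominators.  In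
    characteristic zero this does not happen, because ramification is tame.  To
    see it without local structure theory, measure an element [x] by its
    asymptotic order along [D]: [x] has order at least [r] when [x ^+ n] lies in
    [D^(r n - N) * B] for all [n] and some fixed [N] ([ord_ge]).  If a logarithmic
    derivation lowers the order by at most [c], then differentiating the
    minimal equation of [x] repeatedly shows that it lowers the order by at most
    [c * (1 - 1 / (2 s - 1))], where [s] bounds the degrees over [A]
    ([loses_contract]).  Hence it lowers the order by less than any positive
    amount ([loses_pos]).  Consequently, if [y] is obtained from an element of
    [B] by any combination of Euler derivations, then [D * y] is a root of a
    monic polynomial over [A] of degree [s] ([log_int_integral]).

    Now take a coefficient [c] of [Q].  Up to terms of large valuation, it is a
    finite sum of homogeneous fractions [c_lam] of distinct degrees
    ([hfrac_decomposition]).  Two distinct degrees are separated by some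
    compatible weight [psi] ([separating_weight]), so combinations of Euler
    derivations kill all the components but one, and [delta * c_lam] is the
    leading term of an integral element.  Taking the weighted component of the
    integral equation, [delta * c_lam] is itself integral over [A], hence a
    series, since [A] is normal ([component_in_series]).  Summing up,
    [delta * c] is a limit of series, hence a series; so [c] is a fraction of
    series, and, being integral over [A], it belongs to [A]
    ([log_int_series]). *)

(** * Splitting rings and coefficients of monic polynomials *)

Section SplittingRing.
Import Pdiv.CommonRing Pdiv.RingMonic.

(** Adjoining roots one after the other, each as the class of [X] modulo a monic
    polynomial.  A ring suffices for the integrality arguments below: no
    irreducible factor has to be chosen. *)
Lemma splitting_ring d (R : comNzRingType) (p : {poly R}) :
  p \is monic -> size p = d.+1 ->
  exists (S : comNzRingType) (f : {rmorphism R -> S}) (rs : seq S),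
    injective f /\ map_poly f p = \prod_(z <- rs) ('X - z%:P).
Proof.
elim: d R p => [|d IH] R p mp sp.
  exists R, idfun, [::]; split=> //.
  rewrite big_nil map_poly_id //; move: (mp); have/eqP/size_poly1P[c _ ->] := sp.
  by rewrite monicE lead_coefC => /eqP->.
have mkp : mk_monic p = p by rewrite /mk_monic sp mp.
pose x : {poly %/ p} := in_qpoly p 'X.
have CE c : in_qpoly p c%:P = qpolyC p c.
  apply: val_inj; rewrite /= rmodp_small ?mkp //.
  by rewrite sp; apply: leq_ltn_trans (size_polyC_leq1 _) _.
have px : root (map_poly (qpolyC p) p) x.
  rewrite /root -(eq_map_poly CE) map_poly_comp_id0 ?raddf0 //.
  rewrite horner_map -/(comp_poly 'X p) comp_polyXr; apply/eqP/val_inj => /=.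
  by rewrite mkp rmodpp.
have [q qE] := factor_theorem _ _ px.
have mq : q \is monic.
  rewrite -(monicMr _ (monicXsubC x)) -qE.
  exact: (monic_map (qpolyC p) mp).
have sq : size q = d.+1.
  have := congr1 (fun r : {poly _} => size r) qE.
  rewrite size_Mmonic ?monicXsubC ?monic_neq0 // size_XsubC addn2 /=.
  by rewrite size_map_poly_id0 ?(monicP mp) ?rmorph1 ?oner_neq0 // sp => -[].
have [S [f [rs [fI qs]]]] := IH _ _ mq sq.
exists S, (f \o qpolyC p : {rmorphism R -> S}), (f x :: rs); split.
  move=> a b /= /fI /(congr1 val) /= /polyC_inj. exact.
rewrite map_poly_comp qE rmorphM /= qs big_cons mulrC; congr (_ * _).
by rewrite rmorphB /= map_polyX map_polyC.
Qed.

End SplittingRing.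

(** [I i] should be read as a condition of weight [i]: a coefficient of
    codegree [i] is a sum of products of [i] roots, so it inherits any graded
    condition that the roots satisfy in weight one. *)
Lemma coef_prod_XsubC_closed (S : comNzRingType) (I : nat -> S -> Prop)
    (rs : seq S) : I 0%N 1 -> (forall i, I i 0) ->
  (forall i x y, I i x -> I i y -> I i (x - y)) ->
  (forall i x y, I 1%N x -> I i y -> I i.+1 (x * y)) ->
  (forall z, z \in rs -> I 1%N z) ->
  forall i, (i <= size rs)%N ->
    I i (\prod_(z <- rs) ('X - z%:P))`_(size rs - i).
Proof.
move=> I1 I0 IB IM; elim: rs => [|z rs IH] Irs i.
  by rewrite leqn0 => /eqP->; rewrite big_nil subn0 coefC.
rewrite big_cons /= mulrBl coefB coefXM coefCM => le.
have {}IH := IH (fun y yr => Irs y (mem_behead (s := z :: rs) yr)).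
have Iz := Irs z (mem_head _ _).
have sz : size (\prod_(z <- rs) ('X - z%:P)) = (size rs).+1.
  exact: size_prod_XsubC.
apply: IB.
  case: eqP => [//|/eqP]; rewrite -lt0n subn_gt0 ltnS => le'.
  by rewrite subSn //=; exact: IH.
case: i le => [_|i le]; last by rewrite subSS; apply: IM => //; exact: IH.
by rewrite subn0 nth_default ?mulr0 ?sz.
Qed.

Local Notation tofrac := (@FracField.tofrac _).

(** * Fraction fields and normal domains *)

Lemma fraction_lift (A : idomainType) (L : fieldType) (j : {rmorphism A -> L}) :
  injective j ->
  exists g : {rmorphism {fraction A} -> L}, forall a, g (tofrac a) = j a.
Proof.
move=> jI; have j0 (a : A) : a != 0 -> j a != 0.
  by move=> a0; rewrite -(rmorph0 j); apply: contra a0 => /eqP/jI->.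
pose g (x : {fraction A}) := j (\n_(repr x)) / j (\d_(repr x)).
have gE a b : b != 0 -> g (tofrac a / tofrac b) = j a / j b.
  move=> b0; apply/eqP; rewrite /g eqr_div ?j0 ?denom_ratioP // -!rmorphM.
  by rewrite -(fraction_cross a b0).
have gz : zmod_morphism g.
  move=> x y; rewrite {1}[x]fraction_repr {1}[y]fraction_repr.
  rewrite -mulNr addf_div ?tofrac_eq0 ?denom_ratioP // -!tofracN -!tofracM -tofracD.
  rewrite gE ?mulf_neq0 ?denom_ratioP // rmorphD !rmorphM rmorphN.
  by rewrite -addf_div ?j0 ?denom_ratioP // mulNr.
have gm : monoid_morphism g.
  split=> [|x y]; first by rewrite -[1]divr1 -tofrac1 gE ?oner_neq0 // rmorph1 divr1.
  rewrite {1}[x]fraction_repr {1}[y]fraction_repr mulf_div -!tofracM.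
  by rewrite gE ?mulf_neq0 ?denom_ratioP // !rmorphM mulf_div.
pose G : {rmorphism {fraction A} -> L} := HB.pack g
  (GRing.isZmodMorphism.Build _ _ g gz) (GRing.isMonoidMorphism.Build _ _ g gm).
by exists G => a; rewrite /= -[tofrac a]divr1 -tofrac1 gE ?oner_neq0 // rmorph1 divr1.
Qed.

(** For a noetherian domain this is normality; a common denominator of all the
    powers of [x] is what asymptotic estimates provide. *)
Definition completely_normal (A : idomainType) :=
  forall (x : {fraction A}) (d : A), d != 0 ->
  (forall n, exists a, tofrac d * x ^+ n = tofrac a) -> exists a, x = tofrac a.

Definition normal_domain (A : idomainType) :=
  forall x : {fraction A}, integralOver tofrac x -> exists a, x = tofrac a.

(** If [x = a / b] is integral of degree [s], then [b ^+ s] is a common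
    denominator of all the powers of [x]. *)
Lemma completely_normal_normal (A : idomainType) :
  completely_normal A -> normal_domain A.
Proof.
move=> cn x [p mp /eqP px].
have [a [b [b0 xE]]] : exists a b, b != 0 /\ x = tofrac a / tofrac b.
  by exists (\n_(repr x)), (\d_(repr x)); rewrite denom_ratioP -fraction_repr.
pose s := (size p).-1.
have xs : x ^+ s = - \sum_(i < s) tofrac p`_i * x ^+ i.
  apply/eqP; rewrite -addr_eq0 addrC; apply/eqP; rewrite -[RHS]px.
  rewrite (@horner_coef_wide _ s.+1); last first.
    by rewrite (leq_trans (size_poly _ _)) // /s; case: (size p).
  rewrite big_ord_recr /=; congr (_ + _).
    by apply: eq_bigr => i _; rewrite coef_map_id0 ?rmorph0.
  by rewrite coef_map_id0 ?rmorph0 // -/(lead_coef p) (monicP mp) rmorph1 mul1r.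
apply: (cn x (b ^+ s)) => [|n]; first by rewrite expf_neq0.
elim/ltn_ind: n => n IH; have [ns|sn] := ltnP n s.
  exists (b ^+ (s - n) * a ^+ n); rewrite -(subnK (ltnW ns)) addnK.
  rewrite exprD !rmorphM !rmorphXn -mulrA -exprMn xE mulrC.
  by rewrite [tofrac b * _]mulrC divfK ?tofrac_eq0 // mulrC.
rewrite -(subnK sn) exprD xs mulrN mulrN.
have [a1 ->] : exists a0, tofrac (b ^+ s) *
    (x ^+ (n - s) * \sum_(i < s) tofrac p`_i * x ^+ i) = tofrac a0.
  rewrite !mulr_sumr; elim/big_ind: _ => [|u v [a1 ->] [a2 ->]|i _].
  - by exists 0; rewrite tofrac0.
  - by exists (a1 + a2); rewrite tofracD.
  have [|a1 a1E] := IH (n - s + i)%N; first by have := ltn_ord i; lia.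
  exists (p`_i * a1); rewrite tofracM -a1E exprD; ring.
by exists (- a1); rewrite tofracN.
Qed.

Lemma integral_expr (A S : comNzRingType) (f : {rmorphism A -> S}) q (x : S) :
  (0 < q)%N -> integralOver f (x ^+ q) -> integralOver f x.
Proof.
move=> q0 xq; apply: (@integral_root_monic _ _ _ _ ('X^q - (x ^+ q)%:P)).
- rewrite monicE lead_coefDl ?lead_coefXn // size_polyXn size_polyN.
  exact: leq_ltn_trans (size_polyC_leq1 _) _.
- by rewrite /root !hornerE subrr.
- apply/integral_poly => i; rewrite coefB coefXn coefC.
  apply: integral_sub; first exact: integral_nat.
  by case: eqP => // _; exact: integral0.
Qed.

Lemma integral_inj (A B S : comNzRingType) (f : {rmorphism A -> B})
    (g : {rmorphism B -> S}) (x : B) :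
  injective g -> integralOver (g \o f) (g x) -> integralOver f x.
Proof.
move=> gI [p mp]; rewrite map_poly_comp /root horner_map => /eqP px.
by exists p => //; apply/eqP/gI; rewrite px rmorph0.
Qed.

Lemma integral_sum (A S : comNzRingType) (f : {rmorphism A -> S}) I (r : seq I) F :
  (forall i, integralOver f (F i)) -> integralOver f (\sum_(i <- r) F i).
Proof.
by move=> h; elim/big_ind: _ => // [|x y]; [exact: integral0|exact: integral_add].
Qed.

Lemma integral_exp (A S : comNzRingType) (f : {rmorphism A -> S}) x n :
  integralOver f x -> integralOver f (x ^+ n).
Proof.
move=> fx; elim: n => [|n IH]; first exact: integral1.
by rewrite exprS; exact: integral_mul.
Qed.

(** Let [h = D * x ^+ q] be integral.  The minimal polynomial of [x] divides
    [f(D * X ^+ q)], where [f] is an integral equation of [h], so the conjugates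
    of [x] satisfy the same integrality as [x].  Hence so do their symmetric
    functions, the coefficients of the minimal polynomial, with weights equal
    to the codegrees.  The minimal polynomial is multiplied by a power of [X] to
    have a degree [s] that does not depend on [x]. *)
Lemma conj_poly_bound (A : idomainType) (L : fieldType)
    (g : {rmorphism {fraction A} -> L}) (s : nat) (x : L) :
  normal_domain A ->
  (exists p : {poly {fraction A}},
     [/\ p \is monic, size p = s.+1 & root (map_poly g p) x]) ->
  exists m : {poly {fraction A}},
     [/\ m \is monic, size m = s.+1, root (map_poly g m) x &
      forall (q : nat) (D : {fraction A}), (0 < q)%N ->
        integralOver (g \o tofrac) (g D * x ^+ q) ->
        forall i, (i <= s)%N -> exists a, D ^+ i * m`_(s - i) ^+ q = tofrac a].
Proof.
move=> An [p [mp sp px]].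
pose Q n := `[< exists p : {poly {fraction A}},
     [/\ p \is monic, size p = n & root (map_poly g p) x] >].
have exQ : exists n, Q n by exists s.+1; apply/asboolP; exists p.
case: (ex_minnP exQ) => n /asboolP[m0 [mm0 sm0 m0x]] minm0.
have dvd (G : {poly {fraction A}}) : root (map_poly g G) x -> m0 %| G.
  move=> Gx; apply/modp_eq0P; apply/eqP; apply: contraT => r0.
  have m00 : m0 != 0 by rewrite monic_neq0.
  have := ltn_modpN0 G m00; rewrite ltnNge sm0 => /negP[].
  apply: minm0; apply/asboolP; exists ((lead_coef (G %% m0))^-1 *: (G %% m0)).
  have l0 : lead_coef (G %% m0) != 0 by rewrite lead_coef_eq0.
  split; first by rewrite monicE lead_coefZ mulVf.
    by rewrite size_scale ?invr_eq0.
  rewrite /root map_polyZ hornerZ mulf_eq0; apply/orP; right.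
  move: Gx; rewrite /root {1}(divp_eq G m0) rmorphD rmorphM /= hornerD hornerM.
  by move: m0x; rewrite /root => /eqP->; rewrite mulr0 add0r.
have n0 : (0 < n)%N by rewrite -sm0 size_poly_gt0 monic_neq0.
pose e := n.-1; have nE : n = e.+1 by rewrite /e prednK.
have es : (e <= s)%N by rewrite -ltnS -nE; apply: minm0; apply/asboolP; exists p.
exists (m0 * 'X^(s - e)); split.
- by rewrite monicMl // monicXn.
- by rewrite size_mulXn ?monic_neq0 // sm0 nE addnS subnK.
- by rewrite rootE rmorphM hornerM (eqP m0x) mul0r.
move=> q D q0 [f mf fx] i le_is; rewrite coefMXn.
case: ltnP => [_|le]; first by exists 0; rewrite expr0n gtn_eqF // mulr0 tofrac0.
have le_ie : (i <= e)%N by lia.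
have -> : (s - i - (s - e) = e - i)%N by lia.
pose G := map_poly tofrac f \Po (D *: 'X^q).
have GE (S : comNzRingType) (h : {rmorphism {fraction A} -> S}) (z : S) :
    (map_poly h G).[z] = (map_poly (h \o tofrac) f).[h D * z ^+ q].
  by rewrite map_comp_poly horner_comp map_polyZ map_polyXn hornerZ hornerXn map_poly_comp.
have /dvdpP[u uE] : m0 %| G by apply: dvd; rewrite /root GE.
have [S [k [rs [kI m0k]]]] := splitting_ring mm0 (etrans sm0 nE).
have srs : size rs = e.
  have := size_prod_XsubC rs id; rewrite /= -m0k size_map_poly_id0 ?sm0 ?nE.
    by case.
  by rewrite (monicP mm0) rmorph1 oner_neq0.
apply: An; apply: (integral_inj kI).
rewrite rmorphM !rmorphXn -coef_map m0k -srs.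
pose I i y := integralOver (k \o tofrac) (k D ^+ i * y ^+ q).
apply: (@coef_prod_XsubC_closed _ I); rewrite ?srs //.
- by rewrite /I expr0 expr1n mul1r; exact: integral1.
- by move=> l; rewrite /I expr0n gtn_eqF // mulr0; exact: integral0.
- move=> l y z Iy Iz; rewrite /I exprBn mulr_sumr.
  apply: integral_sum => c; have cq : (c <= q)%N by rewrite -ltnS.
  rewrite -mulr_natr mulrA; apply: integral_mul; last exact: integral_nat.
  apply: (integral_expr q0).
  have -> : (k D ^+ l * ((-1) ^+ c * y ^+ (q - c) * z ^+ c)) ^+ q =
    ((-1) ^+ c) ^+ q * ((k D ^+ l * y ^+ q) ^+ (q - c) * (k D ^+ l * z ^+ q) ^+ c).
    rewrite !exprMn [(y ^+ (q - c)) ^+ q]exprAC [(z ^+ c) ^+ q]exprAC.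
    have -> : k D ^+ l ^+ q = (k D ^+ l) ^+ (q - c) * (k D ^+ l) ^+ c.
      by rewrite -exprD subnK.
    by move: (_ ^+ (q - c)) => ?; ring.
  apply: integral_mul; last by apply: integral_mul; exact: integral_exp.
  by do 2!apply: integral_exp; apply: integral_opp; exact: integral1.
- move=> l y z Iy Iz; rewrite /I exprS exprMn mulrACA; apply: integral_mul => //.
- move=> z zrs; rewrite /I expr1; exists f => //.
  rewrite /root -GE uE rmorphM /= hornerM m0k.
  rewrite (perm_big _ (perm_to_rem zrs)) big_cons hornerM.
  by rewrite hornerXsubC subrr mul0r mulr0.
Qed.

(** * Subrings and derivations *)

Record is_subring (L : nzRingType) (S : L -> Prop) : Prop := IsSubring {
  subring1 : S 1;
  subringB : forall x y, S x -> S y -> S (x - y);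
  subringM : forall x y, S x -> S y -> S (x * y) }.

Section Subring.
Variables (L : nzRingType) (S : L -> Prop) (Sr : is_subring S).

Lemma subring0 : S 0.
Proof. by rewrite -(subrr 1); apply: (subringB Sr); exact: subring1 Sr. Qed.
Lemma subringN x : S x -> S (- x).
Proof. by move=> Sx; rewrite -sub0r; apply: (subringB Sr) => //; exact: subring0. Qed.
Lemma subringD x y : S x -> S y -> S (x + y).
Proof. by move=> Sx Sy; rewrite -[y]opprK; apply: (subringB Sr) => //; exact: subringN. Qed.
Lemma subringX x n : S x -> S (x ^+ n).
Proof.
move=> Sx; elim: n => [|n IH]; first exact: subring1 Sr.
by rewrite exprS; exact: (subringM Sr).
Qed.
Lemma subring_sum I (r : seq I) (P : pred I) F :
  (forall i, P i -> S (F i)) -> S (\sum_(i <- r | P i) F i).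
Proof. by move=> h; elim/big_ind: _ => //; [exact: subring0|exact: subringD]. Qed.
Lemma subringMn x n : S x -> S (x *+ n).
Proof.
move=> Sx; elim: n => [|n IH]; first exact: subring0.
by rewrite mulrS; exact: subringD.
Qed.
Lemma subring_nat n : S n%:R.
Proof. by apply: subringMn; exact: subring1 Sr. Qed.
Lemma subring_int (z : int) : S z%:~R.
Proof.
by case: z => n; [exact: subring_nat|rewrite NegzE mulrNz; apply/subringN/subring_nat].
Qed.
End Subring.

Record is_derivation (L : nzRingType) (chi : L -> L) : Prop := IsDerivation {
  drvD : forall x y, chi (x + y) = chi x + chi y;
  drvM : forall x y, chi (x * y) = chi x * y + x * chi y }.

Section Derivation.
Variables (L : comNzRingType) (chi : L -> L) (dchi : is_derivation chi).

Lemma drv0 : chi 0 = 0.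
Proof. by apply: (addrI (chi 0)); rewrite -(drvD dchi) !addr0. Qed.
Lemma drvN x : chi (- x) = - chi x.
Proof. by apply: (addrI (chi x)); rewrite -(drvD dchi) !subrr drv0. Qed.
Lemma drvB x y : chi (x - y) = chi x - chi y.
Proof. by rewrite (drvD dchi) drvN. Qed.
Lemma drv1 : chi 1 = 0.
Proof.
by apply: (addrI (chi 1)); rewrite addr0 -{3}[1]mulr1 (drvM dchi) mulr1 mul1r.
Qed.
Lemma drv_sum I (r : seq I) (P : pred I) F :
  chi (\sum_(i <- r | P i) F i) = \sum_(i <- r | P i) chi (F i).
Proof. exact: (big_morph chi (drvD dchi) drv0). Qed.
Lemma drvMn x n : chi (x *+ n) = chi x *+ n.
Proof. by elim: n => [|n IH]; rewrite ?drv0 // !mulrS (drvD dchi) IH. Qed.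
Lemma drvX x n : chi (x ^+ n) = n%:R * x ^+ n.-1 * chi x.
Proof.
elim: n => [|n IH]; first by rewrite drv1 !mul0r.
rewrite exprS (drvM dchi) IH; case: n {IH} => [|n] /=; first by rewrite expr0; ring.
by rewrite [x ^+ n.+1]exprS [n.+2%:R]mulrS; ring.
Qed.

Lemma drv_horner (q : {poly L}) x :
  chi q.[x] = (map_poly chi q).[x] + q^`().[x] * chi x.
Proof.
rewrite (horner_coef q) drv_sum.
have -> : map_poly chi q = \poly_(i < size q) chi q`_i by [].
rewrite horner_poly.
rewrite (@horner_coef_wide _ (size q) q^`()); last first.
  have [->|q0] := eqVneq q 0; first by rewrite deriv0 size_poly0.
  exact: ltnW (lt_size_deriv q0).
rewrite mulr_suml.
have -> : \sum_(i < size q) (q^`())`_i * x ^+ i * chi x =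
   \sum_(i < size q) q`_i * (i%:R * x ^+ i.-1 * chi x).
  case sq: (size q) => [|n]; first by rewrite !big_ord0.
  rewrite big_ord_recr [RHS]big_ord_recl /= mul0r mul0r mulr0 add0r.
  rewrite coef_deriv nth_default ?sq // mul0rn !mul0r addr0.
  by apply: eq_bigr => i _; rewrite coef_deriv /bump /= add1n -mulr_natl; ring.
rewrite -big_split /=; apply: eq_bigr => i _.
by rewrite (drvM dchi) drvX.
Qed.

(** The iterated commutator of [chi ^ l] with the multiplication by [a]. *)
Fixpoint iter_comm (a : L) m l f : L :=
  if m is m'.+1 then iter_comm a m' l (a * f) - a * iter_comm a m' l f
  else iter l chi f.

(** The commutator with the multiplication by [a] is a derivation on operators,
    and the commutator of [chi] is the multiplication by [chi a]. *)
Lemma iter_commS a m l f :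
  iter_comm a m l.+1 f = chi (iter_comm a m l f) + m%:R * chi a * iter_comm a m.-1 l f.
Proof.
elim: m f => [|m IH] f /=; first by rewrite !mul0r addr0.
rewrite !IH drvB (drvM dchi a); case: m {IH} => [|m] /=; first by ring.
by rewrite !mulrS; ring.
Qed.

Lemma iter_comm_lt a m l f : (l < m)%N -> iter_comm a m l f = 0.
Proof.
elim: l m f => [|l IH] m f lm.
  case: m lm => // m _; elim: m f => [|m IH] f /=; first by rewrite subrr.
  by rewrite -!/(iter_comm _ m.+1 _ _) !IH mulr0 subr0.
by rewrite iter_commS !IH ?drv0 ?mulr0 ?addr0 //; lia.
Qed.

(** This formula expresses [chi a ^+ m] by the elements
    [a ^+ (m - i) * chi ^ m (a ^+ i)]: estimates on high powers of [a] pass to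
    high powers of its derivative. *)
Lemma iter_comm_diag a m f : iter_comm a m m f = m`!%:R * chi a ^+ m * f.
Proof.
elim: m => [|m IH]; first by rewrite mulr1 mul1r.
rewrite iter_commS iter_comm_lt // drv0 add0r IH factS natrM exprS /=; ring.
Qed.

End Derivation.

(** * Asymptotic order along an element *)

Section Order.
Variables (L : fieldType) (D : L) (D0 : D != 0).

(** The loss [N] does not depend on the exponent [n], so that a power of an
    element determines its order ([ord_ge_root]).  If [S] is a noetherian domain
    and [x] is in [S[1/D]], order at least [p / q] means that [x ^+ q * D ^- p]
    is integral over [S]. *)
Definition ord_ge (S : L -> Prop) (r : rat) (x : L) :=
  exists N : nat, forall (n : nat) (p : int),
    p%:~R <= r * n%:R - N%:R -> S (x ^+ n * D ^ (- p)).

Section OneRing.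
Variables (S : L -> Prop) (Sr : is_subring S) (SD : S D).
Hypothesis Sinv : forall n, S (n.+1%:R)^-1.
Hypothesis Lchar : forall n, n.+1%:R != 0 :> L.
Local Notation F := (ord_ge S).

Lemma subring_le x (p p' : int) : p' <= p -> S (x * D ^ (- p)) -> S (x * D ^ (- p')).
Proof.
move=> le Sx; have -> : - p' = - p + (p - p') by ring.
rewrite expfzDr // mulrA; apply: (subringM Sr) => //.
have [n ->] : exists n : nat, p - p' = n by exists `|p - p'|%N; lia.
exact: (subringX Sr).
Qed.

(** The common source of the estimates for sums and products: the binomial
    formula only involves mixed monomials. *)
Lemma ord_ge_mix r s x y : F r x -> F s y -> exists N : nat, forall m n (p : int),
  p%:~R <= r * m%:R + s * n%:R - N%:R -> S (x ^+ m * y ^+ n * D ^ (- p)).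
Proof.
move=> [N1 h1] [N2 h2]; exists (N1 + N2 + 1)%N => m n p le.
pose p1 := Num.floor (r * m%:R - N1%:R).
have /andP[p1l p1u] := floor_itv (r * m%:R - N1%:R).
have -> : - p = - p1 + (- (p - p1)) by ring.
rewrite expfzDr // mulrACA; apply: (subringM Sr); first by apply: h1.
apply: h2; move: p1u le; rewrite -/p1 intrD !natrD intrB; lra.
Qed.

Lemma ord_geM r s x y : F r x -> F s y -> F (r + s) (x * y).
Proof.
move=> fx fy; have [N h] := ord_ge_mix fx fy; exists N => n p le.
by rewrite exprMn; apply: h; rewrite -mulrDl.
Qed.

Lemma ord_geD r x y : F r x -> F r y -> F r (x + y).
Proof.
move=> fx fy; have [N h] := ord_ge_mix fx fy; exists N => n p le.
rewrite exprDn mulr_suml; apply: (subring_sum Sr) => i _.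
rewrite mulrnAl; apply: (subringMn Sr); apply: h.
by rewrite -mulrDr -natrD subnK // -ltnS.
Qed.

Lemma ord_ge_le r s x : s <= r -> F r x -> F s x.
Proof.
move=> sr [N h]; exists N => n p le; apply: h; apply: le_trans le _.
by rewrite lerD2r ler_wpM2r.
Qed.

Lemma ord_ge_subring x : S x -> F 0 x.
Proof.
move=> Sx; exists 0%N => n p; rewrite mul0r subr0 => p0.
apply: (@subring_le _ 0); first by rewrite -(ler_int rat).
by rewrite oppr0 expr0z mulr1; exact: (subringX Sr).
Qed.

Lemma ord_ge0 r : F r 0.
Proof.
exists `|Num.floor r|%N => n p le; rewrite expr0n; case: n le => [|n] le; last first.
  by rewrite mul0r; exact: subring0.
apply: (@subring_le _ 0); last by rewrite oppr0 expr0z mulr1; exact: subring1 Sr.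
rewrite -(ler_int rat); move: le; rewrite mulr0 sub0r => /le_trans; apply.
by rewrite mulr0z oppr_le0.
Qed.

Lemma ord_geN r x : F r x -> F r (- x).
Proof.
move=> fx; rewrite -mulN1r -[r]add0r; apply: ord_geM => //.
by apply: ord_ge_subring; apply: (subringN Sr); exact: subring1 Sr.
Qed.

Lemma ord_geB r x y : F r x -> F r y -> F r (x - y).
Proof. by move=> fx fy; apply: ord_geD => //; exact: ord_geN. Qed.

Lemma ord_geZ r a x : S a -> F r x -> F r (a * x).
Proof. by move=> Sa fx; rewrite -[r]add0r; apply: ord_geM => //; exact: ord_ge_subring. Qed.

Lemma ord_ge_sum r I (s : seq I) (P : pred I) G :
  (forall i, P i -> F r (G i)) -> F r (\sum_(i <- s | P i) G i).
Proof. by move=> h; elim/big_ind: _ => //; [exact: ord_ge0|exact: ord_geD]. Qed.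

Lemma ord_ge_X r x n : F r x -> F (n%:R * r) (x ^+ n).
Proof.
move=> fx; elim: n => [|n IH].
  by rewrite mul0r expr0; apply: ord_ge_subring; exact: subring1 Sr.
by rewrite exprS mulrS mulrDl mul1r; exact: ord_geM.
Qed.

Lemma ord_ge_D : F 1 D.
Proof.
exists 0%N => n p; rewrite mul1r subr0 => pn; apply: (@subring_le _ n).
  by rewrite -(ler_int rat).
by rewrite -[D ^+ n]/(D ^ n) -expfzDr // subrr; exact: subring1 Sr.
Qed.

Lemma ord_ge_root r x e : (0 < e)%N -> (exists M : nat, S (x * D ^+ M)) ->
  F (e%:R * r) (x ^+ e) -> F r x.
Proof.
move=> e0 [M Sx] [N h].
pose Q := Num.truncn (e%:R * `|r|).
exists (N + e * M + Q.+1).+1 => n p le.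
have ne := divn_eq n e; set q := (n %/ e)%N in ne; set l := (n %% e)%N in ne.
have le_l : (l < e)%N by rewrite ltn_mod.
pose p1 := Num.floor (e%:R * r * q%:R - N%:R).
have /andP[p1l p1u] := floor_itv (e%:R * r * q%:R - N%:R).
have S1 : S (x ^+ l * D ^+ (l * M)%N).
  by rewrite mulnC exprM -exprMn; exact: (subringX Sr).
have lM : (l * M <= e * M)%N by rewrite leq_mul2r ltnW ?orbT.
have -> : x ^+ n * D ^ (- p) =
    ((x ^+ e) ^+ q * D ^ (- p1)) * (x ^+ l * D ^ (- (p - p1))).
  have -> : - p = - p1 + (- (p - p1)) by ring.
  by rewrite expfzDr // mulrACA -exprM -exprD mulnC -ne.
apply: (subringM Sr); first exact: h.
apply: (@subring_le _ (- (l * M)%:Z)); last by rewrite opprK.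
rewrite -(ler_int rat) intrB mulrNz.
have ql : l%:R * r <= Q.+1%:R.
  apply: (@le_trans _ _ (e%:R * `|r|)); last by rewrite ltW // truncnS_gt.
  apply: (le_trans (ler_norm _)); rewrite normrM normr_nat ler_wpM2r // ler_nat ltnW //.
have lMr : (l * M)%:R <= (e * M)%:R :> rat by rewrite ler_nat.
move: p1u le ql lMr; rewrite -/p1 ne intrD !natrD !natrM -addn1 !natrD; move: (p1%:~R) (p%:~R) => a b.
rewrite -[((l * M)%N : int)%:~R]/((l * M)%:R) natrM; lra.
Qed.

Lemma ord_ge_horner r w x n (q : {poly L}) : F r x -> (size q <= n.+1)%N ->
  (forall i, (i <= n)%N -> F (i%:R * r + w) q`_(n - i)) -> F (n%:R * r + w) q.[x].
Proof.
move=> fx sq fq; rewrite (horner_coef_wide _ sq); apply: ord_ge_sum => i _.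
have le : (i <= n)%N by rewrite -ltnS.
have -> : n%:R * r + w = ((n - i)%:R * r + w) + i%:R * r.
  by rewrite natrB //; ring.
apply: ord_geM; last exact: ord_ge_X.
by have := fq (n - i)%N (leq_subr _ _); rewrite subKn.
Qed.

Lemma ord_ge_div_nat r x n : F r (n.+1%:R * x) -> F r x.
Proof.
move=> fx; rewrite -[x](mulKf (Lchar n)); exact: ord_geZ.
Qed.

Section Deriv.
Variables (chi : L -> L) (dchi : is_derivation chi) (a0 : L) (c : nat).
Hypothesis Sa0 : S a0.
Hypothesis chiD : chi D = D * a0.
Hypothesis chiS : forall x, S x -> S (chi x * D ^+ c).

Lemma drv_exprz (p : int) : chi (D ^ p) = p%:~R * a0 * D ^ p.
Proof.
have nat n : chi (D ^+ n) = n%:R * a0 * D ^+ n.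
  rewrite drvX // chiD; case: n => [|n]; first by rewrite !mul0r.
  by rewrite exprS /=; ring.
case: p => n; first exact: nat.
rewrite NegzE; set m := n.+1; rewrite mulrNz.
have Dm : D ^+ m != 0 by rewrite expf_neq0.
have := nat m; have : chi (D ^+ m * D ^ (- m%:Z)) = 0.
  by rewrite -[D ^+ m]/(D ^ m) -expfzDr // subrr expr0z drv1.
rewrite (drvM dchi) => /eqP; rewrite addrC addr_eq0 => /eqP e em.
apply: (mulfI Dm); rewrite e em; ring.
Qed.

Lemma subring_deriv (p : int) y : S (y * D ^ (- p)) ->
  S (chi y * D ^ (- (p - c%:Z))).
Proof.
set s := y * _ => Ss; have yE : y = D ^ p * s.
  by rewrite /s mulrCA -expfzDr // subrr mulr1.
have -> : chi y * D ^ (- (p - c%:Z)) = chi s * D ^+ c + p%:~R * a0 * s * D ^+ c.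
  have -> : - (p - c%:Z) = - p + c by ring.
  rewrite yE (drvM dchi) drv_exprz expfzDr // -exprnP.
  have DD : D ^ p * D ^ (- p) = 1 by rewrite -expfzDr // subrr.
  transitivity ((D ^ p * D ^ (- p)) * (chi s * D ^+ c + p%:~R * a0 * s * D ^+ c)).
    ring.
  by rewrite DD mul1r.
apply: (subringD Sr); first exact: chiS.
apply: (subringM Sr); last exact: (subringX Sr).
do 2?apply: (subringM Sr) => //; exact: (subring_int Sr).
Qed.

Lemma subring_deriv_iter l (p : int) y : S (y * D ^ (- p)) ->
  S (iter l chi y * D ^ (- (p - (l * c)%:Z))).
Proof.
elim: l => [|l IH] Sy; first by rewrite mul0n subr0.
have := subring_deriv (IH Sy).
by rewrite mulSn -addrA -opprD -PoszD addnC.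
Qed.

(** Powers of [chi x] are controlled through [iter_comm_diag], where each
    application of [chi] costs the fixed amount [c]. *)
Lemma ord_ge_deriv r x : F r x -> F (r - c%:R) (chi x).
Proof.
move=> fx; have [N1 h1] := fx.
have key : exists N : nat, forall m l i j (p : int),
    p%:~R <= r * (m + i + j)%:R - N%:R - (l * c)%:R ->
    S (x ^+ j * iter_comm chi x m l (x ^+ i) * D ^ (- p)).
  exists (N1 + N1 + 1)%N; elim=> [|m IH] l i j p le.
    pose p1 := Num.floor (r * j%:R - N1%:R).
    have /andP[p1l p1u] := floor_itv (r * j%:R - N1%:R).
    have -> : - p = - p1 + (- (p - p1 + (l * c)%:Z - (l * c)%:Z)) by ring.
    rewrite expfzDr // mulrACA; apply: (subringM Sr); first exact: h1.
    apply: subring_deriv_iter; apply: h1.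
    move: p1u le; rewrite -/p1 !intrD !natrD intrN -[((l * c)%N : int)%:~R]/((l * c)%:R).
    lra.
  rewrite /= mulrBr mulrBl; apply: (subringB Sr).
    rewrite -exprS; apply: IH; move: le; rewrite addSn addnS; lra.
  rewrite mulrA -exprSr; apply: IH; move: le; rewrite addSn addnS; lra.
have [N h] := key; exists N => n p le.
have : S (n`!%:R * (chi x ^+ n * D ^ (- p))).
  have := h n n 0 0%N p; rewrite iter_comm_diag // expr0 mul1r mulr1 mulrA; apply.
  by move: le; rewrite !addn0 natrM mulrBl; lra.
have [f fE] : exists f, n`! = f.+1 by exists (n`!).-1; rewrite prednK ?fact_gt0.
rewrite fE => Sx; rewrite -[_ * D ^ _](mulKf (Lchar f)).
exact: (subringM Sr).
Qed.

End Deriv.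
End OneRing.

Lemma ord_ge_sub (S S' : L -> Prop) r x : (forall y, S y -> S' y) ->
  ord_ge S r x -> ord_ge S' r x.
Proof. by move=> SS [N h]; exists N => n p le; apply: SS; exact: h. Qed.

End Order.

(** * Logarithmic derivations do not lower the order *)

Section Contraction.
Variables (L : fieldType) (D : L) (D0 : D != 0).
Hypothesis Lchar : forall n, n.+1%:R != 0 :> L.
Variables (A B : L -> Prop) (Ar : is_subring A) (Br : is_subring B).
Hypotheses (AB : forall x, A x -> B x) (AD : A D).
Hypothesis Ainv : forall n, A (n.+1%:R)^-1.
Variable s : nat.
Hypothesis conj : forall r x, ord_ge D B r x -> exists m : {poly L},
  [/\ m \is monic, size m = s.+1, root m x &
      forall i, (i <= s)%N -> ord_ge D A (i%:R * r) m`_(s - i)].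

Local Notation FA := (ord_ge D A).
Local Notation FB := (ord_ge D B).
Let BD : B D := AB AD.
Let Binv n : B (n.+1%:R)^-1 := AB (Ainv n).

Section OneDerivation.
Variables (chi : L -> L) (dchi : is_derivation chi) (a0 : L).
Hypotheses (Aa0 : A a0) (chiD : chi D = D * a0).
Hypothesis chiA : forall x, A x -> A (chi x).
Hypothesis chiB : forall x, B x -> B (chi x * D).

Definition loses (C : rat) := forall r x, FB r x -> FB (r - C) (chi x).

(** The Bezout bound on [B] gives a first finite loss. *)
Lemma loses1 : loses 1.
Proof.
by move=> r x fx; apply: (ord_ge_deriv D0 Br BD Binv Lchar dchi (AB Aa0) chiD (c := 1)) => //.
Qed.

(** On the base ring there is no loss, since [chi] preserves both [A] and [D A]. *)
Lemma base_ord_ge_deriv r x : FA r x -> FA r (chi x).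
Proof.
move=> fx; rewrite -[r]subr0.
apply: (ord_ge_deriv D0 Ar AD Ainv Lchar dchi Aa0 chiD (c := 0)) => //.
by move=> y Ay; rewrite expr0 mulr1; exact: chiA.
Qed.

Lemma degree_gt0 : (0 < s)%N.
Proof.
have [m [mm sm mx _]] := conj (ord_ge_subring D0 Br BD (subring1 Br)).
rewrite lt0n; apply/eqP => s0; move: mx; have/eqP/size_poly1P[c c0 mE] : size m = 1%N.
  by rewrite sm s0.
by rewrite mE rootC (negPf c0).
Qed.

(** Put [y = chi x] and let [m] be an equation of [x].  Applying [chi] to
    [m(x) = 0] shows that [m'(x) * y] has order one [C] better than expected.
    Differentiating [m^(l)(x) * y ^+ (2 l - 1)] and multiplying by [y] transports
    this gain of [C] from [l] to [l + 1], until [m^(s)] is the constant [s!].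
    Then [y ^+ (2 s - 1)] carries the gain [C], so [y] itself gains
    [C / (2 s - 1)]. *)
Lemma loses_contract C : 0 <= C -> loses C -> loses (C - C / (2 * s.-1 + 1)%:R).
Proof.
move=> C0 HC r x fx; set y := chi x; have fy : FB (r - C) y := HC _ _ fx.
have [m [mm sm mx cm]] := conj fx.
have s0 := degree_gt0.
have cmB i : (i <= s)%N -> FB (i%:R * r) m`_(s - i).
  by move=> le; apply: ord_ge_sub (cm _ le).
have sz l : (l <= s)%N -> (size m^`(l) <= (s - l).+1)%N.
  move=> le; apply/leq_sizeP => i li; rewrite coef_derivn nth_default ?mul0rn //.
  by rewrite sm; lia.
have mulnF n w z : FB w z -> FB w (z *+ n).
  by move=> fz; rewrite -mulr_natl; apply: ord_geZ => //; exact: subring_nat.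
have fm l : (l <= s)%N -> FB ((s - l)%:R * r) m^`(l).[x].
  move=> le; rewrite -[_ * r]addr0; apply: ord_ge_horner => //; first exact: sz.
  move=> i li; rewrite addr0 coef_derivn; apply: mulnF.
  have -> : (l + (s - l - i) = s - i)%N by lia.
  by apply: cmB; lia.
have fchim l : (l <= s)%N -> FB ((s - l)%:R * r) (map_poly chi m^`(l)).[x].
  move=> le; rewrite -[_ * r]addr0; apply: ord_ge_horner => //.
    exact: leq_trans (size_poly _ _) (sz _ le).
  move=> i li; rewrite addr0 coef_map_id0 ?drv0 // coef_derivn drvMn //; apply: mulnF.
  have -> : (l + (s - l - i) = s - i)%N by lia.
  by apply: (ord_ge_sub AB); apply: base_ord_ge_deriv; apply: cm; lia.
(* the index is shifted: [w l] is the order of the term with [m^`(l.+1)] *)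
pose w l := (s - l.+1)%:R * r + (2 * l + 1)%:R * (r - C) + C.
have claim l : (l < s)%N -> FB (w l) (m^`(l.+1).[x] * y ^+ (2 * l + 1)).
  elim: l => [|l IH] ls.
    rewrite muln0 add0n expr1.
    have := drv_horner dchi m x; rewrite (rootP mx) drv0 // => /eqP.
    rewrite addrC eq_sym addr_eq0 => /eqP; rewrite -/y derivn1 => ->.
    apply: ord_geN => //.
    have -> : w 0%N = (s - 0)%:R * r.
      by rewrite /w subn0 natrB //; ring.
    exact: (fchim 0%N).
  have {}IH := IH (ltnW ls); set q := m^`(l.+1) in IH.
  have e : m^`(l.+2).[x] * y ^+ (2 * l.+1 + 1) =
    y * chi (q.[x] * y ^+ (2 * l + 1))
      - ((map_poly chi q).[x] * y ^+ (2 * l + 2)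
         + (2 * l + 1)%:R * (q.[x] * y ^+ (2 * l + 1) * chi y)).
    rewrite (drvM dchi) drv_horner // derivnS -/q -/y (drvX dchi).
    have -> : (2 * l.+1 + 1 = (2 * l).+3)%N by lia.
    have -> : (2 * l + 2 = (2 * l).+2)%N by lia.
    have -> : (2 * l + 1 = (2 * l).+1)%N by lia.
    by rewrite -pred_Sn !exprS -derivn1; ring.
  have wl : w l.+1 = w l + r - 2 * C.
    rewrite /w; have -> : (s - l.+1)%:R = (s - l.+2)%:R + 1 :> rat.
      by rewrite -[1]/(1%:R) -natrD; congr (_%:R); lia.
    have -> : (2 * l.+1 + 1)%:R = (2 * l + 1)%:R + 2 :> rat.
      by rewrite -natrD; congr (_%:R); lia.
    ring.
  rewrite e; apply: ord_geB => //; last apply: ord_geD => //.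
  - have -> : w l.+1 = (r - C) + (w l - C) by rewrite wl; ring.
    by apply: ord_geM => //; exact: HC.
  - have -> : w l.+1 = (s - l.+1)%:R * r + (2 * l + 2)%:R * (r - C).
      by rewrite wl /w [(2 * l + 2)%:R]natrD [(2 * l + 1)%:R]natrD; ring.
    by apply: ord_geM => //; [apply: fchim; lia|exact: ord_ge_X].
  - rewrite mulr_natl; apply: mulnF.
    have -> : w l.+1 = w l + (r - C - C) by rewrite wl; ring.
    by apply: ord_geM => //; exact: HC.
have := claim s.-1; rewrite prednK // => /(_ (leqnn _)).
have -> : m^`(s) = (s`!)%:R%:P.
  apply/polyP => i; rewrite coef_derivn coefC; case: i => [|i].
    have := mm; rewrite monicE /lead_coef sm /= addn0 => /eqP->.
    by rewrite ffactnn.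
  by rewrite nth_default ?mul0rn // sm; lia.
rewrite hornerC; have [f fE] : exists f, s`! = f.+1.
  by exists (s`!).-1; rewrite prednK ?fact_gt0.
rewrite fE => /(ord_ge_div_nat D0 Br BD Binv Lchar) fye.
set e := (2 * s.-1 + 1)%N in fye *.
have e0 : (0 < e)%N by rewrite /e addn1.
apply: (ord_ge_root D0 Br BD e0).
  have [N h] := fy; exists `|Num.floor (r - C - N%:R)|%N.
  have := h 1%N (Num.floor (r - C - N%:R)); rewrite mulr1 floor_le => /(_ isT).
  rewrite expr1 => /(subring_le D0 Br BD) S1; rewrite exprnP -[X in _ ^ X]opprK.
  by apply: S1; lia.
have -> : e%:R * (r - (C - C / e%:R)) = w s.-1; last by [].
rewrite /w prednK // subnn mul0r add0r -/e.
by field; rewrite pnatr_eq0 -lt0n.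
Qed.

Lemma loses_le C C' : C <= C' -> loses C -> loses C'.
Proof. by move=> le h r x fx; apply: ord_ge_le (h _ _ fx); lra. Qed.

(** Iterating the contraction from the loss 1 gives a loss of at most
    [t / (n + t)] after [n] steps, with [t = 2 s - 1]. *)
Lemma loses_pos (eps : rat) : 0 < eps -> loses eps.
Proof.
move=> e0; set t := (2 * s.-1 + 1)%:R : rat.
have t0 : 0 < t by rewrite ltr0n addn1.
have t1 : 1 <= t by rewrite /t natrD lerDr.
have it n : exists2 C, 0 <= C /\ C * (n%:R + t) <= t & loses C.
  elim: n => [|n [C [C0 Cn] HC]].
    by exists 1; [split=> //; rewrite add0r mul1r|exact: loses1].
  exists (C - C / t); last exact: loses_contract.
  split.
    by rewrite subr_ge0 ler_pdivrMr // ler_peMr.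
  apply: le_trans Cn; rewrite -natr1.
  have -> : C - C / t = C * ((t - 1) / t) by rewrite mulrBl mul1r divff ?gt_eqF // mulrBr mulr1.
  rewrite -mulrA; apply: ler_wpM2l => //; rewrite mulrAC ler_pdivrMr //.
  have n0 : 0 <= n%:R :> rat by [].
  nra.
have [C [C0 Cn] HC] := it (Num.truncn (t / eps)).+1.
apply: loses_le HC; have := truncnS_gt (t / eps); rewrite ltr_pdivrMr // => tn.
move: Cn tn; set n := (_.+1%:R) => Cn tn.
have n0 : 0 < n :> rat by rewrite ltr0n.
rewrite leNgt; apply/negP => lt.
have : eps * n < C * n by rewrite ltr_pM2r.
have : 0 <= C * t by rewrite mulr_ge0 // ltW.
move: Cn tn; rewrite mulrDr; lra.
Qed.

End OneDerivation.
End Contraction.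

(** * Finite algebras acting on a vector *)

Section Acts.
Variables (A : idomainType) (L : fieldType) (j : {rmorphism A -> L}).

(** The vector [g] generates a module stable under [b].  Keeping [g] fixed
    bounds the degrees of all the elements of a finite algebra at once. *)
Definition acts (I : finType) (g : I -> L) (b : L) :=
  exists M : I -> I -> A, forall i, b * g i = \sum_k j (M i k) * g k.

Lemma acts_base (I : finType) (g : I -> L) a : acts g (j a).
Proof.
exists (fun i k => if k == i then a else 0) => i.
rewrite (bigD1 i) //= eqxx big1 ?addr0 // => k /negPf->.
by rewrite rmorph0 mul0r.
Qed.

Lemma acts_subring (I : finType) (g : I -> L) : is_subring (acts g).
Proof.
split; first by rewrite -(rmorph1 j); exact: acts_base.
  move=> x y [M Mx] [N Ny]; exists (fun i k => M i k - N i k) => i.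
  rewrite mulrBl Mx Ny -sumrB; apply: eq_bigr => k _.
  by rewrite rmorphB mulrBl.
move=> x y [M Mx] [N Ny]; exists (fun i k => \sum_l N i l * M l k) => i.
rewrite -mulrA Ny mulr_sumr.
under eq_bigr => l _ do rewrite mulrCA Mx mulr_sumr.
rewrite exchange_big; apply: eq_bigr => k _ /=.
by rewrite rmorph_sum mulr_suml; apply: eq_bigr => l _; rewrite rmorphM mulrA.
Qed.

(** By Cayley and Hamilton: [b] is an eigenvalue of the matrix through which it
    acts. *)
Lemma acts_integral (I : finType) (g : I -> L) i0 b : g i0 != 0 -> acts g b ->
  exists p : {poly A}, [/\ p \is monic, size p = #|I|.+1 & root (map_poly j p) b].
Proof.
move=> g0 [M Mb]; pose n := #|I|.
pose MM : 'M[A]_n := \matrix_(i, k) M (enum_val k) (enum_val i).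
exists (char_poly MM); rewrite char_poly_monic size_char_poly; split=> //.
rewrite map_char_poly -eigenvalue_root_char; apply/eigenvalueP.
exists (\row_i g (enum_val i)).
  apply/rowP => k; rewrite !mxE Mb (reindex (@enum_val I predT)) /=.
    by apply: eq_bigr => i _; rewrite !mxE mulrC.
  exact: onW_bij (enum_val_bij _).
apply: contraNneq g0 => /rowP/(_ (enum_rank i0)); rewrite !mxE enum_rankK.
by move=> ->.
Qed.

(** If [d] is the degree of [c], the products of the entries of [g] by
    [1, c, ..., c ^ (d - 1)] span a module stable under [c] and under all that
    acts on [g]. *)
Lemma acts_adjoin (I : finType) (g : I -> L) i0 (c : L) : g i0 != 0 ->
  integralOver j c ->
  exists (I' : finType) (g' : I' -> L) i0', [/\ g' i0' != 0, acts g' c &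
    forall b, acts g b -> acts g' b].
Proof.
move=> g0 [p mp pc].
have [d sp] : exists d, size p = d.+2.
  case sp: (size p) => [|[|d]]; last by exists d.
    by move: (monic_neq0 mp); rewrite -size_poly_eq0 sp.
  have/eqP/size_poly1P[a a0 pE] := sp; move: mp pc.
  by rewrite pE monicE lead_coefC => /eqP->; rewrite map_polyC /= rmorph1 rootC oner_eq0.
exists (I * 'I_d.+1)%type, (fun q : I * 'I_d.+1 => g q.1 * c ^+ q.2), (i0, ord0); split.
- by rewrite /= expr0 mulr1.
- exists (fun q t : I * 'I_d.+1 => if t.1 == q.1 then
     (if (q.2 < d)%N then (t.2 == q.2.+1 :> nat)%:R else - p`_t.2) else 0).
  move=> [i e] /=; rewrite -(pair_bigA _ (fun (k : I) (f : 'I_d.+1) => j (if k == i then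
     (if (e < d)%N then (f == e.+1 :> nat)%:R else - p`_f) else 0) * (g k * c ^+ f))).
  rewrite (bigD1 i) //= eqxx [X in _ + X]big1 ?addr0; last first.
    by move=> k /negPf->; rewrite big1 // => f _; rewrite rmorph0 mul0r.
  case: ltnP => ed.
    pose e' : 'I_d.+1 := Ordinal (ed : e.+1 < d.+1)%N.
    rewrite (bigD1 e') //= eqxx big1 ?addr0 ?rmorph1 ?mul1r.
      by rewrite mulrCA -exprS.
    by move=> f /negPf; rewrite -val_eqE /= => ->; rewrite rmorph0 mul0r.
  have -> : (e : nat) = d by have := ltn_ord e; lia.
  rewrite mulrCA -exprS.
  have : \sum_(f < d.+1) j p`_f * c ^+ f + c ^+ d.+1 = 0.
    move/rootP: pc; rewrite (@horner_coef_wide _ d.+2); last first.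
      by rewrite (leq_trans (size_poly _ _)) ?sp.
    rewrite big_ord_recr /= !coef_map /=.
    have /monicP := mp; rewrite /lead_coef sp /= => ->.
    rewrite rmorph1 mul1r => e0; rewrite -[RHS]e0; congr (_ + _).
    by apply: eq_bigr => f _; rewrite coef_map.
  rewrite addrC => /eqP; rewrite addr_eq0 => /eqP->.
  rewrite mulrN mulr_sumr -sumrN; apply: eq_bigr => f _.
  by rewrite rmorphN; ring.
- move=> b [M Mb]; exists (fun q t : I * 'I_d.+1 => if t.2 == q.2 then M q.1 t.1 else 0).
  move=> [i e] /=; rewrite -(pair_bigA _ (fun (k : I) (f : 'I_d.+1) =>
     j (if f == e then M i k else 0) * (g k * c ^+ f))) /=.
  rewrite mulrA Mb mulr_suml; apply: eq_bigr => k _.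
  rewrite (bigD1 e) //= eqxx big1 ?addr0 ?mulrA // => f /negPf->.
  by rewrite rmorph0 mul0r.
Qed.

Lemma acts_finite (cs : seq L) : (forall c, c \in cs -> integralOver j c) ->
  exists (I : finType) (g : I -> L) i0, g i0 != 0 /\
    forall c, c \in cs -> acts g c.
Proof.
elim: cs => [_|c cs IH ics].
  by exists unit, (fun _ => 1), tt; rewrite oner_neq0.
have [c' c's|I [g [i0 [g0 gcs]]]] := IH.
  by apply: ics; rewrite in_cons c's orbT.
have [I' [g' [i0' [g0' gc gg']]]] := acts_adjoin g0 (ics _ (mem_head _ _)).
exists I', g', i0'; split=> // c'; rewrite in_cons => /orP[/eqP->//|/gcs].
exact: gg'.
Qed.

Inductive ring_gen (cs : seq L) : L -> Prop :=
| RingGenBase a : ring_gen cs (j a)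
| RingGenIn c : c \in cs -> ring_gen cs c
| RingGenB x y : ring_gen cs x -> ring_gen cs y -> ring_gen cs (x - y)
| RingGenM x y : ring_gen cs x -> ring_gen cs y -> ring_gen cs (x * y).

Lemma ring_gen_subring cs : is_subring (ring_gen cs).
Proof.
split; [|exact: RingGenB|exact: RingGenM].
by rewrite -(rmorph1 j); exact: RingGenBase.
Qed.

Lemma ring_gen_acts cs (I : finType) (g : I -> L) :
  (forall c, c \in cs -> acts g c) -> forall b, ring_gen cs b -> acts g b.
Proof.
move=> gcs b; elim=> [a|c /gcs//|x y _ + _|x y _ + _]; first exact: acts_base.
  exact: subringB (acts_subring g) _ _.
exact: subringM (acts_subring g) _ _.
Qed.

Lemma ring_gen_deriv (chi : L -> L) (D : L) cs : is_derivation chi -> 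
  (forall a, exists a', chi (j a) = j a') -> ring_gen cs D ->
  (forall c, c \in cs -> ring_gen cs (chi c * D)) ->
  forall b, ring_gen cs b -> ring_gen cs (chi b * D).
Proof.
move=> dchi chij BD chics b; have Br := ring_gen_subring cs.
elim=> [a|c /chics//|x y _ Bx _ By|x y x0 Bx y0 By].
- have [a' ->] := chij a; apply: RingGenM => //; exact: RingGenBase.
- by rewrite drvB // mulrBl; exact: RingGenB.
- rewrite (drvM dchi) mulrDl mulrAC -mulrA; apply: (subringD Br).
    by rewrite mulrA; exact: RingGenM.
  by rewrite -mulrA; exact: RingGenM.
Qed.

End Acts.

(** * Integrality of iterated logarithmic derivatives *)

Section LogIntegral.
Variables (A : idomainType) (L : fieldType) (j : {rmorphism A -> L}).
Hypotheses (jI : injective j) (Acn : completely_normal A).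
Hypothesis Lchar : forall n, n.+1%:R != 0 :> L.
Hypothesis Ainv : forall n, exists a : A, a * n.+1%:R = 1.
Variables (d : A) (d0 : d != 0) (cs : seq L).
Hypothesis ics : forall c, c \in cs -> integralOver j c.

Let D := j d.
Let jA (x : L) := exists a, x = j a.
Let B := ring_gen j cs.

(** Stability of [D A] is logarithmicity along [D]; the last condition will come
    from a Bezout relation. *)
Definition log_deriv (chi : L -> L) :=
  [/\ is_derivation chi, forall a, exists a', chi (j a) = j a',
      exists a, chi D = D * j a &
      forall c, c \in cs -> B (chi c * D)].

Let D0 : D != 0.
Proof. by rewrite /D -(rmorph0 j) (inj_eq jI). Qed.
Let jAr : is_subring jA.
Proof.
split; first by exists 1; rewrite rmorph1.
  by move=> _ _ [a ->] [b ->]; exists (a - b); rewrite rmorphB.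
by move=> _ _ [a ->] [b ->]; exists (a * b); rewrite rmorphM.
Qed.
Let Br : is_subring B := ring_gen_subring j cs.
Let jAB x : jA x -> B x.
Proof. by move=> [a ->]; exact: RingGenBase. Qed.
Let jAD : jA D. Proof. by exists d. Qed.
Let jAinv n : jA (n.+1%:R)^-1.
Proof.
have [a aE] := Ainv n; exists a; apply: (mulIf (Lchar n)).
by rewrite mulVf // -(rmorph_nat j) -rmorphM aE rmorph1.
Qed.

(** If [x] has order [r], then [x ^+ n * D ^ (- p)] is integral for all [p] up to
    [r n - N]; applying [conj_poly_bound] to each [n] with a fixed equation of
    [x] bounds the orders of the coefficients of that equation in [A]. *)
Lemma ord_ge_conj : exists s : nat, forall r x, ord_ge D B r x ->
  exists m : {poly L}, [/\ m \is monic, size m = s.+1, root m x &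
      forall i, (i <= s)%N -> ord_ge D jA (i%:R * r) m`_(s - i)].
Proof.
have [I [g [i0 [g0 gcs]]]] := acts_finite ics.
have Bg := ring_gen_acts gcs.
have [h hE] := fraction_lift jI.
exists #|I| => r x fx; have [N hN] := fx.
have hjE : h \o tofrac =1 j by move=> a; rewrite /= hE.
have [M Mx] : exists M : nat, B (x * D ^+ M).
  exists `|Num.floor (r - N%:R)|%N.
  have := hN 1%N (Num.floor (r - N%:R)); rewrite mulr1 floor_le => /(_ isT).
  rewrite expr1 => /(subring_le D0 Br (jAB jAD)) S1; rewrite exprnP -[X in _ ^ X]opprK.
  by apply: S1; lia.
have [p [mp sp px]] := acts_integral g0 (Bg _ Mx).
set s := #|I| in sp *.
pose t := tofrac (d ^+ M) : {fraction A}.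
have t0 : t != 0 by rewrite tofrac_eq0 expf_neq0.
have ht : h t = D ^+ M by rewrite hE rmorphXn.
have [] := @conj_poly_bound A L h s x (completely_normal_normal Acn).
  pose P := \poly_(i < s.+1) (tofrac p`_i * t ^- (s - i)).
  have ps : p`_s = 1 by have /monicP := mp; rewrite /lead_coef sp.
  have Ps : P`_s = 1 by rewrite coef_poly ltnSn ps subnn expr0 invr1 mulr1 tofrac1.
  have sP : size P = s.+1.
    by rewrite size_poly_eq // subnn expr0 invr1 mulr1 tofrac_eq0 ps oner_neq0.
  exists P; split=> //; first by rewrite monicE /lead_coef sP Ps.
  apply/rootP; have := rootP px; rewrite !(@horner_coef_wide _ s.+1).
  - move=> e0; apply: (mulIf (expf_neq0 s (expf_neq0 M D0))).
    rewrite mul0r -[RHS]e0 mulr_suml; apply: eq_bigr => i _.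
    have le : (i <= s)%N by rewrite -ltnS.
    rewrite [(map_poly h P)`_i]coef_map [(map_poly j p)`_i]coef_map /=.
    rewrite coef_poly ltn_ord rmorphM fmorphV.
    rewrite rmorphXn ht hE exprMn.
    have -> : D ^+ M ^+ s = D ^+ M ^+ (s - i) * D ^+ M ^+ i by rewrite -exprD subnK.
    have : D ^+ M ^+ (s - i) != 0 by rewrite !expf_neq0.
    move: (D ^+ M ^+ (s - i)) (D ^+ M ^+ i) (j p`_i) => z w y z0.
    by field.
  - by apply: leq_trans (size_poly _ _) _; rewrite sP.
  - by apply: leq_trans (size_poly _ _) _; rewrite sp.
move=> m [mm sm mx hm]; exists (map_poly h m).
have sm' : size (map_poly h m) = s.+1.
  by rewrite size_map_poly_id0 ?sm // (monicP mm) rmorph1 oner_neq0.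
split=> //; first exact: monic_map.
move=> i le; exists (i * N.+1)%N => n q.
rewrite coef_map /=; case: n => [|n] leq.
  rewrite expr0; apply: (@subring_le _ _ D0 _ jAr jAD 1 0).
    by rewrite -(ler_int rat); move: leq; rewrite mulr0 sub0r => /le_trans; apply; rewrite oppr_le0.
  by rewrite oppr0 expr0z mulr1; exact: subring1 jAr.
pose q1 := Num.floor (r * n.+1%:R - N%:R).
have /andP[q1l q1u] := floor_itv (r * n.+1%:R - N%:R).
have Bq : B (x ^+ n.+1 * D ^ (- q1)) by exact: hN.
have hd : h (tofrac d) = D by rewrite hE.
have hdz (z : int) : h (tofrac d ^ z) = D ^ z.
  by case: z => z; rewrite ?NegzE -?exprnN -?exprnP ?fmorphV rmorphXn hd.
have [] := hm n.+1 (tofrac d ^ (- q1)) isT _ i le.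
  have [f [mf _ fx0]] := acts_integral g0 (Bg _ Bq).
  exists f => //; rewrite (eq_map_poly hjE) hdz mulrC; exact: fx0.
move=> a aE; apply: (@subring_le _ _ D0 _ jAr jAD _ (i%:Z * q1)).
  rewrite -(ler_int rat) intrM; apply: le_trans leq _.
  rewrite natrM -[N.+1%:R]natr1 -mulrA -mulrBr; apply: ler_wpM2l => //.
  by move: q1u; rewrite -/q1 intrD; lra.
exists a; rewrite -hE -aE rmorphM rmorphXn hdz rmorphXn mulrC; congr (_ * _).
by rewrite exprnP exprz_exp mulNr mulrC.
Qed.

(** A logarithmic derivation lowers the order by less than any positive amount,
    so the elements of order at least [- eps] for all positive [eps] form a module
    stable under all such derivations. *)
Definition log_int (x : L) := forall eps : rat, 0 < eps -> ord_ge D B (- eps) x.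

Lemma log_int_base x : B x -> log_int x.
Proof.
move=> Bx eps e0; apply: (ord_ge_le _ (ord_ge_subring D0 Br (jAB jAD) Bx)).
by rewrite oppr_le0 ltW.
Qed.

Lemma log_intB x y : log_int x -> log_int y -> log_int (x - y).
Proof.
by move=> lx ly eps e0; apply: (ord_geB D0 Br (jAB jAD)); [exact: lx|exact: ly].
Qed.

Lemma log_intZ a x : log_int x -> log_int (j a * x).
Proof.
by move=> lx eps e0; apply: (ord_geZ D0 Br (jAB jAD)); [exact: RingGenBase|exact: lx].
Qed.

Lemma log_int_deriv chi x : log_deriv chi -> log_int x -> log_int (chi x).
Proof.
move=> [dchi chij [a aE] chic] lx eps e0.
have [s conj] := ord_ge_conj.
have chiB := ring_gen_deriv dchi chij (jAB jAD) chic.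
have chiA y : jA y -> jA (chi y) by move=> [b ->]; exact: chij.
have e2 : 0 < eps / 2 by lra.
have /(_ _ _ (lx _ e2)) := loses_pos D0 Lchar jAr Br jAB jAD jAinv conj dchi
   (ex_intro _ a erefl : jA (j a)) aE chiA chiB e2.
by have -> : - (eps / 2) - eps / 2 = - eps by lra.
Qed.

(** Multiplying by [D] gains one order, which absorbs [eps].  The equation given
    by [ord_ge_conj] then has coefficients of order zero, and these are in [A]
    because [A] is completely normal. *)
Lemma log_int_integral : exists s : nat, forall x, log_int x ->
  exists p : {poly A}, [/\ p \is monic, size p = s.+1 & root (map_poly j p) (D * x)].
Proof.
have [s conj] := ord_ge_conj; exists s => x lx.
have [h hE] := fraction_lift jI.
have Dx0 : ord_ge D B 0 (D * x).
  apply: (@ord_ge_le _ _ _ (1 + - 2^-1)); first by lra.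
  apply: (ord_geM D0 Br); [exact: (ord_ge_D D0 Br (jAB jAD))|exact: lx].
have [m [mm sm mx fm]] := conj _ _ Dx0.
have mA i : exists a, m`_i = j a.
  have [im|im] := leqP i s; last first.
    by exists 0; rewrite rmorph0 nth_default // sm.
  have := fm (s - i)%N (leq_subr _ _); rewrite subKn // mulr0 => -[N hN].
  have key n : exists a, D ^+ N * m`_i ^+ n = j a.
    have [|a aE] := hN n (- N%:Z); first by rewrite mul0r sub0r mulrNz.
    by exists a; rewrite -aE opprK mulrC.
  have [a0 a0E] := key 0%N; have [a1 a1E] := key 1%N.
  have DN : D ^+ N != 0 by rewrite expf_neq0.
  have dN : d ^+ N != 0 by rewrite expf_neq0.
  have hm : h (tofrac a1 / tofrac (d ^+ N)) = m`_i.
    apply: (mulfI DN); rewrite -[m`_i]expr1 a1E rmorphM fmorphV !hE rmorphXn.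
    by rewrite mulrCA mulfV ?mulr1.
  have [|a aE] := Acn dN (x := tofrac a1 / tofrac (d ^+ N)).
    move=> n; have [a aE] := key n; exists a; apply: (fmorph_inj h).
    by rewrite rmorphM [h (_ ^+ n)]rmorphXn hm !hE rmorphXn.
  by exists a; rewrite -hm aE hE.
pose a i := projT1 (cid (mA i)); have aE i : m`_i = j (a i) := projT2 (cid (mA i)).
pose p := \poly_(i < s.+1) a i.
have as1 : a s = 1.
  by apply: jI; rewrite -aE rmorph1; have /monicP := mm; rewrite /lead_coef sm.
have sp : size p = s.+1 by rewrite size_poly_eq // as1 oner_neq0.
have pm : map_poly j p = m.
  apply/polyP => i; rewrite coef_map coef_poly aE; case: ltnP => // im.
  by rewrite -aE [RHS]nth_default ?sm //; exact: rmorph0.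
exists p; split=> //; last by rewrite pm.
by rewrite monicE /lead_coef sp coef_poly ltnSn as1.
Qed.

End LogIntegral.

(** * Power series rings are completely normal *)

Section SeriesBasics.
Variables (n : nat) (k : fieldType).
Local Notation A := (mseries n k).
Implicit Types f g h : A.

Lemma mscoefD f g m : mscoef (f + g) m = mscoef f m + mscoef g m.
Proof. by []. Qed.
Lemma mscoefN f m : mscoef (- f) m = - mscoef f m.
Proof. by []. Qed.
Lemma mscoefB f g m : mscoef (f - g) m = mscoef f m - mscoef g m.
Proof. by []. Qed.
Lemma mscoef0 m : mscoef (0 : A) m = 0.
Proof. by []. Qed.

Lemma mscoefM_neq0 f g m : mscoef (f * g) m != 0 ->
  exists a b, [/\ m = (a + b)%MM, mscoef f a != 0 & mscoef g b != 0].
Proof.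
rewrite mscoefM => h.
have [q /andP[/eqP mq q0]] : exists q : 'X_{1..n < (mdeg m).+1, (mdeg m).+1},
    (m == (q.1 + q.2)%MM) && (mscoef f q.1 * mscoef g q.2 != 0).
  apply: contrapT => nex; move/eqP: h; apply; apply: big1 => q mq.
  by apply/eqP; apply: contrapT => /negP q0; apply: nex; exists q; rewrite mq.
exists q.1, q.2; split=> //; apply: contraNneq q0 => ->; first by rewrite mul0r.
by rewrite mulr0.
Qed.

Lemma series_neq0 f : f != 0 -> exists m, mscoef f m != 0.
Proof.
move=> f0; apply: contrapT => nex; move/eqP: f0; apply; apply/mseriesP => m.
by apply/eqP; apply: contrapT => /negP fm; apply: nex; exists m.
Qed.

(** The smallest monomial for the graded order, which plays for series the part
    of the leading monomial of a polynomial. *)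
Definition trailing f (a : 'X_{1..n}) :=
  mscoef f a != 0 /\ forall m, mscoef f m != 0 -> (a <= m)%O.

Lemma trailing_exists f : f != 0 -> exists a, trailing f a.
Proof.
move=> /series_neq0[m fm]; apply: contrapT => nex.
elim/(@ltmwf n): m fm => m IH fm; apply: nex; exists m; split=> // m' fm'.
by rewrite leNgt; apply/negP => lt; exact: IH lt fm'.
Qed.

Lemma trailing_unique f a b : trailing f a -> trailing f b -> a = b.
Proof. by move=> [fa ha] [fb hb]; apply/le_anti; rewrite ha // hb. Qed.

Lemma mscoefM_trailing f g a b : trailing f a -> trailing g b ->
  mscoef (f * g) (a + b)%MM = mscoef f a * mscoef g b.
Proof.
move=> [fa ha] [gb hb]; pose w : 'I_n -> {posnum rat} := fun=> PosNum ltr01.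
have wE m : mnmweight w m = (mdeg m)%:R.
  by rewrite /mnmweight mdegE natr_sum; apply: eq_bigr => i _; rewrite mul1r.
apply: (@mscoefM_min _ _ w) => m fm; rewrite ?wE ?ler_nat.
- by apply: lemc_mdeg; exact: ha.
- by move=> _; exact: ha.
- by apply: lemc_mdeg; exact: hb.
- by move=> _; exact: hb.
Qed.

Lemma trailingM f g a b : trailing f a -> trailing g b -> trailing (f * g) (a + b)%MM.
Proof.
move=> fa gb; split.
  by rewrite mscoefM_trailing // mulf_neq0 //; [case: fa|case: gb].
move=> m /mscoefM_neq0[a' [b' [-> fa' gb']]].
by apply: lem_add; [case: fa => _; apply|case: gb => _; apply].
Qed.

Lemma trailingX f a i : trailing f a -> trailing (f ^+ i) (a *+ i)%MM.
Proof.
move=> fa; elim: i => [|i IH]; last by rewrite exprS mulmS; exact: trailingM.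
rewrite mulm0n; split=> [|m _]; last exact: le0x.
by rewrite /= eqxx oner_neq0.
Qed.

Definition ms_monomial (c : k) (a : 'X_{1..n}) : A :=
  MSeries (fun m => if m == a then c else 0).

Lemma trailing_monomial c a : c != 0 -> trailing (ms_monomial c a) a.
Proof.
move=> c0; split=> /=; first by rewrite eqxx.
by move=> m; case: (eqVneq m a) => [->//|]; rewrite eqxx.
Qed.

Lemma finite_max_monomial N (P : 'X_{1..n} -> Prop) m0 : P m0 ->
  (forall m, P m -> (mdeg m < N)%N) ->
  exists2 m, P m & forall m', P m' -> (m' <= m)%O.
Proof.
move=> Pm0 PN; pose b0 : 'X_{1..n < N} := Sub m0 (PN _ Pm0).
have Pb0 : [pred b : 'X_{1..n < N} | `[< P b >]] b0 by apply/asboolP.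
case: (@arg_maxP _ _ _ b0 [pred b : 'X_{1..n < N} | `[< P b >]] (fun b => bmnm b) Pb0) => b /asboolP Pb maxb.
by exists b => // m' Pm'; apply: (maxb (Sub m' (PN _ Pm'))); apply/asboolP.
Qed.

(** Long division by trailing monomials.  If [f / g] is almost integral, then
    the trailing monomial of [g] divides that of [f], since the trailing
    exponents satisfy an inequality that is linear in the power; subtracting a
    monomial multiple of [g] preserves the hypothesis and raises the trailing
    monomial.  As there are finitely many monomials of degree less than [N], a
    choice of [q] with largest trailing monomial would be improvable. *)
Lemma div_approx (f g d : A) : g != 0 -> d != 0 ->
  (forall i, exists a, d * f ^+ i = a * g ^+ i) ->
  forall N, exists q, forall m, (mdeg m < N)%N -> mscoef (f - q * g) m = 0.
Proof.
move=> g0 d0 fg N; apply: contrapT => nex.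
have fqg q i : exists a, d * (f - q * g) ^+ i = a * g ^+ i.
  rewrite exprBn mulr_sumr; elim/big_ind: _ => [|x y [a ->] [b ->]|l _].
  - by exists 0; rewrite mul0r.
  - by exists (a + b); rewrite mulrDl.
  have le : (l <= i)%N by rewrite -ltnS.
  have [a aE] := fg (i - l)%N; exists ((-1) ^+ l * a * q ^+ l *+ 'C(i, l)).
  rewrite mulrnAr mulrnAl; congr (_ *+ _); rewrite exprMn.
  transitivity ((-1) ^+ l * (d * f ^+ (i - l)) * q ^+ l * g ^+ l).
    by move: (f ^+ (i - l)) => ?; ring.
  have -> : g ^+ i = g ^+ (i - l) * g ^+ l by rewrite -exprD subnK.
  rewrite aE; move: (g ^+ (i - l)) => ?; ring.
pose P m := exists q, trailing (f - q * g) m.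
have tr q : exists2 m, trailing (f - q * g) m & (mdeg m < N)%N.
  have nz : exists2 m, (mdeg m < N)%N & mscoef (f - q * g) m != 0.
    apply: contrapT => nz; apply: nex; exists q => m mN; apply/eqP; apply: contrapT => /negP ne.
    by apply: nz; exists m.
  have [m0 m0N m00] := nz.
  have [|m tm] := @trailing_exists (f - q * g).
    by apply: contraNneq m00 => ->.
  by exists m => //; apply: leq_ltn_trans m0N; apply: lemc_mdeg; case: tm => _; apply.
have [m0 tm0 _] := tr 0.
have [|m [q [qm qmin]] maxm] := @finite_max_monomial N P m0 (ex_intro _ 0 tm0).
  move=> m [q tq]; have [m' tm' m'N] := tr q.
  by rewrite (trailing_unique tq tm').
have [b gb] := trailing_exists g0; have [e de] := trailing_exists d0.
have tm : trailing (f - q * g) m by [].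
(* large powers make the exponent [e] of [d] negligible *)
have bm : (b <= m)%MM.
  apply/mnm_lepP => i; rewrite leqNgt; apply/negP => lt.
  have [a aE] := fqg q (e i).+1.
  have t1 := trailingM de (trailingX (e i).+1 tm).
  have a0 : a != 0.
    apply/eqP => a0; case: t1; rewrite aE a0 mul0r mscoef0 eqxx //.
  have [c ac] := trailing_exists a0.
  have t2 := trailingM ac (trailingX (e i).+1 gb); rewrite -aE in t2.
  have /mnmP/(_ i) := trailing_unique t1 t2; rewrite !mnmDE !mulmnE.
  by move: lt; move: (m i) (b i) (e i) (c i) => x y z t; nia.
have g1 : mscoef g b != 0 by case: gb.
pose c := mscoef (f - q * g) m / mscoef g b.
have c0 : c != 0 by rewrite mulf_neq0 ?invr_eq0.
have th := trailingM (trailing_monomial (m - b) c0) gb.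
rewrite submK // in th.
have [m' tm' m'N] := tr (q + ms_monomial c (m - b)).
have : (m' <= m)%O by apply: maxm; exists (q + ms_monomial c (m - b)).
have e' : f - (q + ms_monomial c (m - b)) * g = (f - q * g) - ms_monomial c (m - b) * g.
  by rewrite mulrDl opprD addrA.
rewrite e' in tm'; case: tm' => nz _; rewrite le_eqVlt => /orP[/eqP e2|lt].
  have := mscoefM_trailing (trailing_monomial (m - b) c0) gb.
  have -> : mscoef (ms_monomial c (m - b)) (m - b)%MM = c by rewrite /= eqxx.
  rewrite submK // => e3.
  by move: nz; rewrite e2 mscoefB e3 /c divfK // subrr eqxx.
move: nz; rewrite mscoefB; case: (eqVneq (mscoef (f - q * g) m') 0) => [->|h]; last first.
  by move: lt; rewrite ltNge qmin.
rewrite sub0r oppr_eq0 => nz; case: th => _ /(_ _ nz).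
by rewrite leNgt lt.
Qed.

(** The approximate quotients stabilize: two of them differ by a series whose
    product with [g] has large degree. *)
Lemma mseries_completely_normal : completely_normal A.
Proof.
move=> x d d0 xd; have g0 := denom_ratioP (repr x).
move: xd; rewrite [x]fraction_repr; move: g0; set f := \n_(repr x).
set g := \d_(repr x) => g0 xd.
have fg i : exists a, d * f ^+ i = a * g ^+ i.
  have [a aE] := xd i; exists a; apply/eqP; rewrite -tofrac_eq !tofracM -aE !tofracXn.
  by rewrite expr_div_n -mulrA divfK // expf_neq0 // tofrac_eq0.
pose q N := projT1 (cid (div_approx g0 d0 fg N)).
have qE N m : (mdeg m < N)%N -> mscoef (f - q N * g) m = 0 :=
  projT2 (cid (div_approx g0 d0 fg N)) m.
have [b gb] := trailing_exists g0.
(* a quotient exact up to this degree has its final coefficient at [m] *)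
pose nn (m : 'X_{1..n}) := ((mdeg m).+1 + mdeg b)%N.
pose Q : A := MSeries (fun m => mscoef (q (nn m)) m).
have QN N m : (nn m <= N)%N -> mscoef Q m = mscoef (q N) m.
  move=> le; apply/eqP; rewrite -subr_eq0 /= -mscoefB; apply: contraT => nz.
  set h := _ - _ in nz.
  have [|c hc] := @trailing_exists h; first by apply: contraNneq nz => ->.
  have cm : (mdeg c <= mdeg m)%N by apply: lemc_mdeg; case: hc => _; apply.
  have [] := trailingM hc gb; have -> : h * g = (f - q N * g) - (f - q (nn m) * g).
    by rewrite /h; ring.
  have cb : (mdeg (c + b)%MM < nn m)%N by rewrite mdegD /nn; lia.
  by rewrite mscoefB !qE ?subrr ?eqxx //; exact: leq_trans cb le.
exists Q; apply/eqP; rewrite -[tofrac Q]divr1 -tofrac1 eqr_div ?tofrac_eq0 ?oner_neq0 //.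
rewrite tofrac1 mulr1 -tofracM tofrac_eq; apply/eqP/mseriesP => m.
have := qE (nn m) m; rewrite mscoefB => /(_ _)/eqP; rewrite subr_eq0 => /(_ _)/eqP->.
  rewrite !mscoefM; apply: eq_bigr => -[a c] /= /eqP mE; congr (_ * _).
  by apply/esym/QN; have := congr1 (@mdeg n) mE; rewrite /nn mdegD; lia.
by rewrite /nn; lia.
Qed.

End SeriesBasics.

(** * Derivations of a fraction field *)

Section FracDeriv.
Variables (A : idomainType) (chi : A -> A) (dchi : is_derivation chi).

Definition frac_deriv (x : {fraction A}) : {fraction A} :=
  let a := \n_(repr x) in let b := \d_(repr x) in
  tofrac (chi a * b - a * chi b) / tofrac (b ^+ 2).

(** The quotient rule does not depend on the representative. *)
Lemma frac_derivE a b : b != 0 ->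
  frac_deriv (tofrac a / tofrac b) = tofrac (chi a * b - a * chi b) / tofrac (b ^+ 2).
Proof.
move=> b0; rewrite /frac_deriv /=.
have /= := fraction_cross a b0; move: (denom_ratioP (repr (tofrac a / tofrac b))).
move: (\n_(repr _)) (\d_(repr _)) => a' b' b'0 /= e.
apply/eqP; rewrite eqr_div ?tofrac_eq0 ?expf_neq0 // -!tofracM tofrac_eq.
have e2 := congr1 chi e; rewrite !(drvM dchi) in e2.
move: e2; set ca := chi a; set cb := chi b; set ca' := chi a'; set cb' := chi b'.
move=> e2; rewrite -subr_eq0; apply/eqP.
transitivity (b * b' * ((ca' * b + a' * cb) - (ca * b' + a * cb'))
   + (a * b' - a' * b) * (cb * b' + cb' * b)); first by rewrite /ca /cb /ca' /cb'; ring.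
by rewrite e e2 !subrr mulr0 mul0r addr0.
Qed.

Lemma frac_deriv_tofrac a : frac_deriv (tofrac a) = tofrac (chi a).
Proof.
have := frac_derivE a (oner_neq0 A); rewrite tofrac1 divr1 => ->.
by rewrite (drv1 dchi) mulr0 subr0 mulr1 expr1n tofrac1 divr1.
Qed.

Lemma frac_deriv_is_derivation : is_derivation frac_deriv.
Proof.
split=> x y; rewrite [x]fraction_repr [y]fraction_repr;
  move: (denom_ratioP (repr x)) (denom_ratioP (repr y));
  move: (\n_(repr x)) (\d_(repr x)) (\n_(repr y)) (\d_(repr y)) => a b c d b0 d0.
- rewrite addf_div ?tofrac_eq0 // -!tofracM -tofracD !frac_derivE ?mulf_neq0 //.
  rewrite addf_div ?tofrac_eq0 ?expf_neq0 // -!tofracM -tofracD.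
  apply/eqP; rewrite eqr_div ?tofrac_eq0 ?mulf_neq0 ?expf_neq0 ?mulf_neq0 //.
  rewrite -!tofracM tofrac_eq; apply/eqP.
  rewrite !(drvD dchi) !(drvM dchi).
  by move: (chi a) (chi b) (chi c) (chi d) => ca cb cc cd; ring.
- rewrite mulf_div -!tofracM !frac_derivE ?mulf_neq0 //.
  rewrite !mulf_div -!tofracM addf_div ?tofrac_eq0 ?mulf_neq0 ?expf_neq0 //.
  rewrite -!tofracM -tofracD.
  apply/eqP; rewrite eqr_div ?tofrac_eq0 ?mulf_neq0 ?expf_neq0 ?mulf_neq0 //.
  rewrite -!tofracM tofrac_eq; apply/eqP.
  rewrite !(drvM dchi).
  by move: (chi a) (chi b) (chi c) (chi d) => ca cb cc cd; ring.
Qed.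

End FracDeriv.

(** * Weights compatible with the rational relations *)

Section Separation.
Variables (F : numFieldType) (n : nat) (alpha : 'I_n -> F).

(** Such a weight factors through the group generated by the [alpha j], so it
    is constant on monomials of the same [alpha]-weight. *)
Definition compatible (psi : 'I_n -> int) :=
  forall g : 'I_n -> int, \sum_j alpha j * (g j)%:~R = 0 -> \sum_j psi j * g j = 0.

Lemma clear_denominators (v : 'I_n -> rat) :
  exists (N : int) (psi : 'I_n -> int), N != 0 /\ forall i, (psi i)%:~R = N%:~R * v i.
Proof.
exists (\prod_i denq (v i)), (fun i => numq (v i) * \prod_(l | l != i) denq (v l)).
split; first by apply/prodf_neq0 => i _; rewrite denq_neq0.
move=> i; rewrite [X in X%:~R * v i](bigD1 i) //= !intrM mulrAC.
by rewrite [(denq _)%:~R * _]mulrC -numqE.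
Qed.

(** The rational relations between the [alpha j] form a subspace of [Q^n], given
    by a matrix [M] of largest rank.  A vector outside its row space is detected
    by a column of the cokernel of [M], and that column annihilates all the
    relations. *)
Lemma separating_weight (b : 'I_n -> int) : \sum_j alpha j * (b j)%:~R != 0 ->
  exists2 psi, compatible psi & \sum_j psi j * b j != 0.
Proof.
move=> b0; pose W (v : 'rV[rat]_n) := \sum_j alpha j * ratr (v 0 j) = 0.
have WD u v : W u -> W v -> W (u + v).
  rewrite /W => Wu Wv; under eq_bigr => j _ do rewrite mxE rmorphD mulrDr.
  by rewrite big_split /= Wu Wv addr0.
have WZ a u : W u -> W (a *: u).
  rewrite /W => Wu; under eq_bigr => j _ do rewrite mxE rmorphM mulrCA.
  by rewrite -mulr_sumr Wu mulr0.
pose P r := `[< exists M : 'M[rat]_n, (forall u : 'rV_n, (u <= M)%MS -> W u) /\ \rank M = r >].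
have exP : exists r, P r.
  exists 0%N; apply/asboolP; exists 0; split; last exact: mxrank0.
  by move=> u; rewrite submx0 => /eqP->; apply: big1 => j _; rewrite mxE rmorph0 mulr0.
have ubP r : P r -> (r <= n)%N by move=> /asboolP[M [_ <-]]; exact: rank_leq_row.
case: (ex_maxnP exP ubP) => r /asboolP[M [MW rM]] maxr.
have WM w : W w -> (w <= M)%MS.
  move=> Ww; apply: contraT => nw.
  have lt : (M < M + w)%MS.
    rewrite ltmxE addsmxSl /=; apply: contra nw; apply: submx_trans; exact: addsmxSr.
  have := rank_ltmx lt; rewrite rM ltnNge maxr //; apply/asboolP; exists (M + w)%MS; split=> //.
  move=> u /sub_addsmxP[[u1 u2] /= ->]; apply: WD; first by apply: MW; exact: submxMl.
  have -> : u2 *m w = u2 0 0 *: w by rewrite {1}[u2]mx11_scalar mul_scalar_mx.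
  exact: WZ.
pose br : 'rV[rat]_n := \row_j (b j)%:~R.
have nb : ~~ (br <= M)%MS.
  apply: contra b0 => /MW Wb; apply/eqP; rewrite -[RHS]Wb; apply: eq_bigr => j _.
  by rewrite mxE ratr_int.
rewrite submxE in nb.
have [l nl] : exists l, (br *m cokermx M) 0 l != 0.
  apply: contrapT => nex; move/eqP: nb; apply; apply/rowP => l; rewrite [RHS]mxE.
  by apply/eqP; apply: contrapT => /negP h; apply: nex; exists l.
have [N [psi [N0 psiE]]] := clear_denominators (fun i => cokermx M i l).
have key (g : 'I_n -> int) : (\sum_j psi j * g j)%:~R =
    N%:~R * ((\row_j (g j)%:~R : 'rV[rat]_n) *m cokermx M) 0 l.
  rewrite mxE mulr_sumr rmorph_sum; apply: eq_bigr => j _ /=.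
  by rewrite intrM psiE mxE; ring.
exists psi; last first.
  by rewrite -(intr_eq0 rat) key mulf_neq0 // intr_eq0.
move=> g g0; apply/eqP; rewrite -(intr_eq0 rat) key.
have /WM : W (\row_j (g j)%:~R).
  by rewrite /W -[RHS]g0; apply: eq_bigr => j _; rewrite mxE ratr_int.
by rewrite submxE => /eqP->; rewrite mxE mulr0.
Qed.

End Separation.

(** * Weighted homogeneous components *)

Section Homogeneous.
Variables (R : realType) (n : nat) (k : fieldType) (alpha : 'I_n -> {posnum R}).
Local Notation A := (mseries n k).
Local Notation wt := (mnmweight alpha).
Implicit Types f g : A.

Definition whomog (c : R) f := forall m, mscoef f m != 0 -> wt m = c.

Definition component (c : R) f : A := MSeries (fun m => if wt m == c then mscoef f m else 0).

Definition val_ge (c : R) f := forall m, mscoef f m != 0 -> c <= wt m.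

Lemma series_val_ge c f : (c%:E <= series_val alpha f)%E <-> val_ge c f.
Proof.
split=> [le m fm|h].
  rewrite -lee_fin; apply: le_trans le _; apply: ereal_inf_lbound.
  by exists m.
by apply: le_ereal_inf_tmp => _ [m fm <-]; rewrite lee_fin; exact: h.
Qed.

Lemma component_homog c f : whomog c (component c f).
Proof. by move=> m /=; case: (wt m =P c) => // _; rewrite eqxx. Qed.

Lemma homog_component c f : whomog c f -> component c f = f.
Proof.
move=> fc; apply/mseriesP => m /=; case: (wt m =P _) => // wm.
by apply/esym/eqP; apply: contrapT => /negP /fc.
Qed.

Lemma componentD c f g : component c (f + g) = component c f + component c g.
Proof. by apply/mseriesP => m /=; case: ifP => // _; rewrite addr0. Qed.

Lemma component0 c : component c (0 : A) = 0.
Proof. by apply/mseriesP => m /=; case: ifP. Qed.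

Lemma component_sum c I (r : seq I) (P : pred I) (F : I -> A) :
  component c (\sum_(i <- r | P i) F i) = \sum_(i <- r | P i) component c (F i).
Proof. exact: (big_morph _ (componentD c) (component0 c)). Qed.

Lemma component_val_ge c c' f : c < c' -> val_ge c' f -> component c f = 0.
Proof.
move=> lt fc; apply/mseriesP => m /=; case: eqP => // wm.
apply/eqP; apply: contrapT => /negP /fc; rewrite wm => le.
by have := lt_le_trans lt le; rewrite ltxx.
Qed.

Lemma componentM a c f g : whomog c g -> component (a + c) (f * g) = component a f * g.
Proof.
move=> gc; apply/mseriesP => m.
have -> : mscoef (component (a + c) (f * g)) m =
   if wt m == a + c then mscoef (f * g) m else 0 by [].
rewrite [mscoef (component a f * g) m]mscoefM [mscoef (f * g) m]mscoefM.
have e (q : 'X_{1..n < (mdeg m).+1, (mdeg m).+1}) : m == (q.1 + q.2)%MM ->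
   mscoef g q.2 != 0 -> (wt m == a + c) = (wt q.1 == a).
  by move=> /eqP mq gq; rewrite {1}mq mnmweightD (gc _ gq) (inj_eq (addIr c)).
case: ifP => wm.
  apply: eq_bigr => q mq /=; have [->|gq] := eqVneq (mscoef g q.2) 0.
    by rewrite !mulr0.
  by rewrite -(e q mq gq) wm.
apply/esym; apply: big1 => q mq.
rewrite /=; have [->|gq] := eqVneq (mscoef g q.2) 0; first by rewrite mulr0.
by rewrite -(e q mq gq) wm mul0r.
Qed.

Lemma whomogM a b f g : whomog a f -> whomog b g -> whomog (a + b) (f * g).
Proof.
by move=> fa gb m /mscoefM_neq0[p [q [-> fp gq]]]; rewrite mnmweightD (fa _ fp) (gb _ gq).
Qed.

Lemma whomogD a f g : whomog a f -> whomog a g -> whomog a (f + g).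
Proof.
move=> fa ga m; rewrite mscoefD; have [->|] := eqVneq (mscoef f m) 0.
  by rewrite add0r; exact: ga.
by move=> /fa.
Qed.

Lemma whomog0 a : whomog a 0.
Proof. by move=> m; rewrite mscoef0 eqxx. Qed.

Lemma whomog1 : whomog 0 1.
Proof.
move=> m /=; case: (eqVneq m 0%MM) => [->|]; last by rewrite eqxx.
by rewrite mnmweight0.
Qed.

Lemma whomogX a f i : whomog a f -> whomog (i%:R * a) (f ^+ i).
Proof.
move=> fa; elim: i => [|i IH]; first by rewrite mul0r; exact: whomog1.
by rewrite exprS mulrS mulrDl mul1r; exact: whomogM.
Qed.

(** Only finitely many monomials have bounded weight. *)
Lemma weight_truncation c f : exists (r : seq R), [/\ uniq r,
    forall a, a \in r -> (exists2 m, mscoef f m != 0 & wt m = a) &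
    val_ge c (f - \sum_(a <- r) component a f)].
Proof.
have [d dP] := mnmweight_bounded alpha c.
pose r0 := [seq wt (bmnm b) | b <- enum {: 'X_{1..n < d}} & mscoef f (bmnm b) != 0].
exists (undup r0); split; first exact: undup_uniq.
  move=> a; rewrite mem_undup => /mapP[b]; rewrite mem_filter => /andP[fb _] ->.
  by exists b.
move=> m; rewrite leNgt => nz; apply/negP => lt.
move: nz; rewrite mscoefB; have [fm|fm] := eqVneq (mscoef f m) 0.
  rewrite fm sub0r oppr_eq0; elim: (undup r0) => [|a r IH]; first by rewrite big_nil mscoef0 eqxx.
  by rewrite big_cons mscoefD /= fm if_same add0r.
have mr : wt m \in undup r0.
  rewrite mem_undup; apply/mapP; exists (Sub m (dP _ (ltW lt)) : 'X_{1..n < d}) => //.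
  by rewrite mem_filter fm mem_enum.
rewrite (perm_big _ (perm_to_rem mr)) big_cons mscoefD /= eqxx.
have : wt m \notin rem (wt m) (undup r0).
  by rewrite mem_rem_uniqF // undup_uniq.
elim: (rem _ _) => [|a r IH]; first by rewrite big_nil mscoef0 addr0 subrr eqxx.
rewrite in_cons negb_or big_cons mscoefD /= => /andP[/negPf ne].
by rewrite ne add0r => /IH.
Qed.

End Homogeneous.

(** * Euler derivations and homogeneous fractions *)

Lemma geometric_split (F : fieldType) (v w eps S E : F) :
  w = v * (1 - eps) -> E - 1 = (eps - 1) * S -> v = w * S + v * E.
Proof.
move=> -> /eqP; rewrite subr_eq => /eqP ->; ring.
Qed.

Lemma quotient_split (F : fieldType) (a b c : F) : b != 0 -> c != 0 ->
  a / c = a / b * (1 - (c - b) / c).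
Proof. by move=> b0 c0; field; rewrite b0 c0. Qed.

Section Euler.
Variables (R : realType) (n : nat) (k : fieldType) (alpha : 'I_n -> {posnum R}).
Local Notation A := (mseries n k).
Local Notation K := {fraction A}.
Local Notation wt := (mnmweight alpha).
Implicit Types f g : A.

Definition int_weight (psi : 'I_n -> int) (m : 'X_{1..n}) : int :=
  \sum_j psi j * (m j)%:Z.

Lemma int_weightD psi a b : int_weight psi (a + b)%MM = int_weight psi a + int_weight psi b.
Proof.
rewrite /int_weight -big_split /=; apply: eq_bigr => j _.
by rewrite mnmDE PoszD mulrDr.
Qed.

Definition euler psi f : A := MSeries (fun m => (int_weight psi m)%:~R * mscoef f m).

Lemma euler_is_derivation psi : is_derivation (euler psi).
Proof.
split=> f g; apply/mseriesP => m; first by rewrite /= mulrDr.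
have -> : mscoef (euler psi (f * g)) m = (int_weight psi m)%:~R * mscoef (f * g) m by [].
rewrite mscoefD !mscoefM mulr_sumr -big_split /=; apply: eq_bigr => q /eqP mq.
by rewrite {1}mq int_weightD intrD; ring.
Qed.

Lemma mscoef_intM (z : int) f m : mscoef (z%:~R * f) m = z%:~R * mscoef f m.
Proof.
rewrite !mulrzl; case: z => i; rewrite ?NegzE ?mulrNz -?pmulrn.
  by elim: i => [//|i IH]; rewrite !mulrS mscoefD IH.
by rewrite mscoefN; congr (- _); elim: i.+1 => [//|l IH]; rewrite !mulrS mscoefD IH.
Qed.

Definition compat := compatible (fun j => (alpha j)%:num).

Lemma compat_weight psi a b c d : compat psi -> wt a - wt b = wt c - wt d ->
  int_weight psi a - int_weight psi b = int_weight psi c - int_weight psi d.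
Proof.
move=> cpsi e; pose g j := (a j)%:Z - (b j)%:Z - (c j)%:Z + (d j)%:Z.
have := cpsi g; rewrite /g => h.
have {}h : \sum_j psi j * ((a j)%:Z - (b j)%:Z - (c j)%:Z + (d j)%:Z) = 0.
  apply: h; move/eqP: e; rewrite -subr_eq0 => /eqP e; rewrite -[RHS]e /mnmweight.
  rewrite -!sumrB; apply: eq_bigr => j _; rewrite intrD !intrB; ring.
apply/eqP; rewrite -subr_eq0; apply/eqP; rewrite -[RHS]h /int_weight.
by rewrite -!sumrB; apply: eq_bigr => j _; ring.
Qed.

Lemma euler_whomog psi c f m : compat psi -> whomog alpha c f -> wt m = c ->
  euler psi f = (int_weight psi m)%:~R * f.
Proof.
move=> cpsi fc mc; apply/mseriesP => m'; rewrite mscoef_intM /=.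
have [->|fm'] := eqVneq (mscoef f m') 0; first by rewrite !mulr0.
have := @compat_weight psi m' m m m cpsi; rewrite (fc _ fm') mc !subrr => /(_ erefl).
by move/eqP; rewrite subr_eq0 => /eqP->.
Qed.

Definition hfrac (lam : R) (x : K) := exists a b f g,
  [/\ whomog alpha a f, whomog alpha b g, g != 0, lam = a - b &
      x = tofrac f / tofrac g].

Lemma hfrac_eigen psi lam x m m' : compat psi -> hfrac lam x ->
  lam = wt m - wt m' ->
  frac_deriv (euler psi) x = (int_weight psi m - int_weight psi m')%:~R * x.
Proof.
move=> cpsi [a [b [f [g [fa gb g0 -> ->]]]]] e.
have [m1 gm1] := series_neq0 g0.
have [->|f0] := eqVneq f 0.
  by rewrite tofrac0 mul0r mulr0; apply: drv0; exact: (frac_deriv_is_derivation (euler_is_derivation psi)).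
have [m2 fm2] := series_neq0 f0.
rewrite (frac_derivE (euler_is_derivation psi)) //.
rewrite (euler_whomog cpsi fa (fa _ fm2)) (euler_whomog cpsi gb (gb _ gm1)).
have -> : int_weight psi m - int_weight psi m' = int_weight psi m2 - int_weight psi m1.
  by apply: compat_weight => //; rewrite -e (fa _ fm2) (gb _ gm1).
have tg0 : tofrac g != 0 by rewrite tofrac_eq0.
have -> : (int_weight psi m2)%:~R * f * g - f * ((int_weight psi m1)%:~R * g) =
   (int_weight psi m2 - int_weight psi m1)%:~R * f * g by rewrite intrB; ring.
rewrite !tofracM rmorph_int; set z := (X in X * _ * _).
by rewrite invfM mulrACA divff // mulr1 mulrA.
Qed.

Lemma hfrac_weight lam x : hfrac lam x -> x != 0 -> exists m m', lam = wt m - wt m'.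
Proof.
move=> [a [b [f [g [fa gb g0 -> ->]]]]] x0.
have f0 : f != 0 by apply: contraNneq x0 => ->; rewrite tofrac0 mul0r.
have [m fm] := series_neq0 f0; have [m' gm'] := series_neq0 g0.
by exists m, m'; rewrite (fa _ fm) (gb _ gm').
Qed.

(** The quotient of the two fractions has a nonzero degree, which is an integral
    combination of the [alpha j] and so is detected by a compatible weight. *)
Lemma hfrac_separate lam lam' x x' : hfrac lam x -> x != 0 ->
  hfrac lam' x' -> x' != 0 -> lam != lam' ->
  exists psi, compat psi /\ exists z z' : int, [/\ z != z',
   forall y, hfrac lam y -> frac_deriv (euler psi) y = z%:~R * y &
   forall y, hfrac lam' y -> frac_deriv (euler psi) y = z'%:~R * y].
Proof.
move=> hx x0 hx' x'0 ne.
have [m [m' e]] := hfrac_weight hx x0; have [l [l' e']] := hfrac_weight hx' x'0.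
pose b j := (m j)%:Z - (m' j)%:Z - (l j)%:Z + (l' j)%:Z.
have [|psi cpsi pb] := @separating_weight _ n (fun j => (alpha j)%:num) b.
  move: ne; rewrite -subr_eq0 e e'; apply: contraNneq => b0; rewrite -[X in _ == X]b0.
  rewrite /mnmweight -!sumrB; apply/eqP; apply: eq_bigr => j _; rewrite intrD !intrB; ring.
exists psi; split=> //.
exists (int_weight psi m - int_weight psi m'), (int_weight psi l - int_weight psi l'); split.
- rewrite -subr_eq0; move: pb; apply: contraNneq => h; rewrite -[X in _ == X]h.
  rewrite /int_weight -!sumrB; apply/eqP; apply: eq_bigr => j _; rewrite /b; ring.
- by move=> y hy; exact: (hfrac_eigen cpsi hy e).
- by move=> y hy; exact: (hfrac_eigen cpsi hy e').
Qed.

Lemma hfrac_any lam psi : compat psi -> exists z : int,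
  forall y, hfrac lam y -> frac_deriv (euler psi) y = z%:~R * y.
Proof.
move=> cpsi; have [[m [m' e]]|nex] := pselect (exists m m', lam = wt m - wt m').
  by exists (int_weight psi m - int_weight psi m') => y hy; exact: (hfrac_eigen cpsi hy e).
exists 0 => y hy; have [->|y0] := eqVneq y 0; last by case: nex; exact: hfrac_weight hy y0.
by rewrite mulr0; apply: drv0; exact: (frac_deriv_is_derivation (euler_is_derivation psi)).
Qed.

Lemma hfrac0 lam : hfrac lam 0.
Proof.
exists lam, 0, 0, 1; rewrite oner_neq0 subr0 tofrac0 mul0r.
by split=> //; [exact: whomog0|exact: whomog1].
Qed.

Lemma hfracD lam x y : hfrac lam x -> hfrac lam y -> hfrac lam (x + y).
Proof.
move=> [a [b [f [g [fa gb g0 le ->]]]]] [c [d [f' [g' [fc gd g'0 le' ->]]]]].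
exists (a + d), (b + d), (f * g' + f' * g), (g * g'); split.
- apply: whomogD; first exact: whomogM.
  have -> : a + d = c + b by rewrite -[a](subrK b) -le le'; ring.
  exact: whomogM.
- exact: whomogM.
- by rewrite mulf_neq0.
- by rewrite le; ring.
- by rewrite addf_div ?tofrac_eq0 // -!tofracM -tofracD.
Qed.

Lemma hfracM lam mu x y : hfrac lam x -> hfrac mu y -> hfrac (lam + mu) (x * y).
Proof.
move=> [a [b [f [g [fa gb g0 -> ->]]]]] [c [d [f' [g' [fc gd g'0 -> ->]]]]].
exists (a + c), (b + d), (f * f'), (g * g'); split; try exact: whomogM.
- by rewrite mulf_neq0.
- by ring.
- by rewrite mulf_div -!tofracM.
Qed.

Lemma hfrac_series c f : whomog alpha c f -> hfrac c (tofrac f).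
Proof.
move=> fc; exists c, 0, f, 1; rewrite oner_neq0 subr0 tofrac1 divr1.
by split=> //; exact: whomog1.
Qed.

Definition vge (c : R) (h : K) : Prop := (c%:E <= frac_val alpha h)%E.

Lemma vgeD c x y : vge c x -> vge c y -> vge c (x + y).
Proof. exact: frac_valD. Qed.
Lemma vgeN c x : vge c x -> vge c (- x).
Proof. by rewrite /vge frac_valN. Qed.
Lemma vgeB c x y : vge c x -> vge c y -> vge c (x - y).
Proof. by move=> hx hy; apply: vgeD => //; exact: vgeN. Qed.
Lemma vgeM a b x y : vge a x -> vge b y -> vge (a + b) (x * y).
Proof. by rewrite /vge frac_valM EFinD => hx hy; exact: leeD. Qed.
Lemma vge_le a b x : b <= a -> vge a x -> vge b x.
Proof. by move=> ba; apply: le_trans; rewrite lee_fin. Qed.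
Lemma vge0 c : vge c 0.
Proof. by rewrite /vge frac_val0 leey. Qed.
Lemma vge1 : vge 0 1.
Proof. by rewrite /vge frac_val1. Qed.
Lemma vge_sum c I (r : seq I) (P : pred I) F :
  (forall i, P i -> vge c (F i)) -> vge c (\sum_(i <- r | P i) F i).
Proof. by move=> h; elim/big_ind: _ => //; [exact: vge0|exact: vgeD]. Qed.
Lemma vgeX a x i : vge a x -> vge (i%:R * a) (x ^+ i).
Proof.
move=> hx; elim: i => [|i IH]; first by rewrite mul0r; exact: vge1.
by rewrite exprS mulrS mulrDl mul1r; exact: vgeM.
Qed.

Lemma vge_tofrac c f : vge c (tofrac f) <-> val_ge alpha c f.
Proof. by rewrite /vge frac_val_tofrac series_val_ge. Qed.

Lemma vge_div a b f g : val_ge alpha a f -> whomog alpha b g -> g != 0 ->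
  vge (a - b) (tofrac f / tofrac g).
Proof.
move=> fa gb g0; rewrite /vge frac_val_frac //.
have [m gm] := series_neq0 g0.
have -> : series_val alpha g = b%:E.
  by rewrite -(gb _ gm); apply: series_val_min => // m' gm'; rewrite (gb _ gm) (gb _ gm').
by rewrite EFinB; apply: leeB => //; apply/series_val_ge.
Qed.

Lemma hfrac_vge lam x : hfrac lam x -> vge lam x.
Proof.
move=> [a [b [f [g [fa gb g0 -> ->]]]]]; apply: vge_div => // m fm.
by rewrite (fa _ fm).
Qed.

(** The approximable elements form a ring, and this reduces the whole valuation
    ring to quotients with a homogeneous denominator. *)
Definition approx (mu : R) (v : K) := vge 0 v /\ exists l : seq (R * K),
  (forall p, p \in l -> hfrac p.1 p.2 /\ 0 <= p.1) /\ vge mu (v - \sum_(p <- l) p.2).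

Lemma approxD mu v w : approx mu v -> approx mu w -> approx mu (v + w).
Proof.
move=> [v0 [l [hl vl]]] [w0 [l' [hl' wl']]]; split; first exact: vgeD.
exists (l ++ l'); split; first by move=> p; rewrite mem_cat => /orP[/hl|/hl'].
by rewrite big_cat opprD addrACA; exact: vgeD.
Qed.

Lemma sum_hfrac_vge0 (l : seq (R * K)) :
  (forall p, p \in l -> hfrac p.1 p.2 /\ 0 <= p.1) -> vge 0 (\sum_(p <- l) p.2).
Proof.
move=> hl; rewrite big_seq; apply: vge_sum => p /hl[hp p0].
exact: vge_le p0 (hfrac_vge hp).
Qed.

Lemma approxM mu v w : approx mu v -> approx mu w -> approx mu (v * w).
Proof.
move=> [v0 [l [hl vl]]] [w0 [l' [hl' wl']]]; split.
  by rewrite -(addr0 0); exact: vgeM.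
exists [seq (p.1 + q.1, p.2 * q.2) | p <- l, q <- l']; split.
  move=> _ /allpairsP[[p q] /= [pl ql ->]] /=.
  have [hp p0] := hl _ pl; have [hq q0] := hl' _ ql.
  by split; [exact: hfracM|exact: addr_ge0].
set a := \sum_(p <- l) p.2 in vl; set b := \sum_(p <- l') p.2 in wl'.
have -> : \sum_(p <- [seq (p.1 + q.1, p.2 * q.2) | p <- l, q <- l']) p.2 = a * b.
  rewrite big_allpairs_dep /= mulr_suml; apply: eq_bigr => p _.
  by rewrite mulr_sumr.
have -> : v * w - a * b = (v - a) * w + a * (w - b) by ring.
apply: vgeD; first by rewrite -[mu]addr0; exact: vgeM.
by rewrite -[mu]add0r; apply: vgeM => //; exact: sum_hfrac_vge0.
Qed.

Lemma approx1 mu : approx mu 1.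
Proof.
split; first exact: vge1.
exists [:: (0, 1)]; split; last by rewrite big_seq1 subrr; exact: vge0.
move=> p; rewrite inE => /eqP->; split=> //=; rewrite -tofrac1.
by apply: hfrac_series; exact: whomog1.
Qed.

Lemma approx0 mu : approx mu 0.
Proof.
split; first exact: vge0.
by exists [::]; split=> //; rewrite big_nil subr0; exact: vge0.
Qed.

Lemma approxX mu v i : approx mu v -> approx mu (v ^+ i).
Proof.
by move=> hv; elim: i => [|i IH]; [exact: approx1|rewrite exprS; exact: approxM].
Qed.

Lemma approx_vge mu v w : 0 <= mu -> vge mu w -> approx mu v -> approx mu (v + w).
Proof.
move=> mu0 hw [v0 [l [hl vl]]]; split; first by apply: vgeD => //; exact: vge_le hw.
by exists l; split=> //; rewrite addrAC; exact: vgeD.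
Qed.

Lemma approx_div mu c f g : val_ge alpha c f -> whomog alpha c g -> g != 0 ->
  approx mu (tofrac f / tofrac g).
Proof.
move=> fc gc g0; split; first by rewrite -(subrr c); exact: vge_div.
have [r [_ rf fr]] := weight_truncation alpha (mu + c) f.
exists [seq (a - c, tofrac (component alpha a f) / tofrac g) | a <- r]; split.
  move=> _ /mapP[a ar ->] /=; split; last first.
    by rewrite subr_ge0; have [m fm <-] := rf _ ar; exact: fc.
  exists a, c, (component alpha a f), g; split=> //; exact: component_homog.
rewrite big_map /= -mulr_suml -mulrBl -rmorph_sum -tofracB -[mu](addrK c).
exact: vge_div.
Qed.

(** Write [f / g] with initial form [g1] of [g]; then [g = g1 * (1 - eps)] where
    [eps] has positive valuation, and the geometric series in [eps] can be
    truncated. *)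
Lemma approx_all mu v : vge 0 v -> approx mu v.
Proof.
wlog mu0 : mu / 0 <= mu.
  move=> h v0; have [mu0|lt] := leP 0 mu; first exact: h.
  have [_ [l [hl vl]]] := h 0 (lexx _) v0; split=> //; exists l; split=> //.
  exact: vge_le (ltW lt) vl.
move=> v0; have g0 := denom_ratioP (repr v); have vE := fraction_repr v.
move: g0 vE; move: (\n_(repr v)) (\d_(repr v)) => f g g0 vE.
have [m [gm gmin _]] := mseries_min alpha g0; pose c := wt m.
have gval : series_val alpha g = c%:E by exact: series_val_min.
have fc : val_ge alpha c f.
  apply/series_val_ge; move: v0; rewrite /vge vE frac_val_frac // gval.
  by rewrite sube_ge0.
pose g1 := component alpha c g.
have g1m : mscoef g1 m != 0 by rewrite /= eqxx.
have g10 : g1 != 0 by apply: contraNneq g1m => ->.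
have g1c : whomog alpha c g1 by exact: component_homog.
pose g2 := g1 - g.
have g2c : exists2 eta, 0 < eta & val_ge alpha (c + eta) g2.
  have [g20|g20] := eqVneq g2 0.
    by exists 1 => // l; rewrite g20 mscoef0 eqxx.
  have [l [gl lmin _]] := mseries_min alpha g20; exists (wt l - c); last first.
    by move=> l' gl'; rewrite addrC subrK; exact: lmin.
  move: gl; rewrite subr_gt0 mscoefB /=; case: (wt l =P c) => [_|/eqP ne].
    by rewrite subrr eqxx.
  rewrite sub0r oppr_eq0 => gl; rewrite lt_neqAle eq_sym ne; exact: gmin.
have [eta eta0 g2eta] := g2c.
pose eps := tofrac g2 / tofrac g1.
pose w := tofrac f / tofrac g1.
have aw : approx mu w by exact: (approx_div _ fc g1c g10).
have aeps : approx mu eps.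
  apply: (approx_div _ _ g1c g10) => l gl.
  by apply: le_trans (g2eta _ gl); rewrite lerDl ltW.
have veps : vge eta eps.
  rewrite -[eta](addrK c) [eta + c]addrC; exact: (vge_div g2eta g1c g10).
pose J := (Num.truncn (mu / eta)).+1.
have -> : v = w * (\sum_(i < J) eps ^+ i) + v * eps ^+ J.
  apply: geometric_split (subrX1 eps J).
  rewrite /w /eps /g2 tofracB {1}vE; apply: quotient_split; by rewrite tofrac_eq0.
apply: approx_vge => //.
  apply: (@vge_le (0 + J%:R * eta)); last by apply: vgeM => //; exact: vgeX.
  rewrite add0r -ler_pdivrMr // ltW //; exact: truncnS_gt.
apply: approxM => //; elim/big_ind: _ => //.
- exact: approx0.
- by move=> x y; exact: approxD.
- by move=> i _; exact: approxX.
Qed.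

(** Summands of the same degree are grouped, so that a derivation can tell the
    terms apart. *)
Lemma hfrac_decomposition mu v : vge 0 v -> exists (r : seq R) (x : R -> K),
  [/\ uniq r, forall lam, hfrac lam (x lam), forall lam, lam \in r -> 0 <= lam &
      vge mu (v - \sum_(lam <- r) x lam)].
Proof.
move=> /(approx_all mu)[_ [l [hl vl]]].
exists (undup [seq p.1 | p <- l]), (fun lam => \sum_(p <- l | p.1 == lam) p.2); split.
- exact: undup_uniq.
- move=> lam; rewrite big_seq_cond; elim/big_ind: _ => [|x y|p /andP[pl /eqP <-]].
  + exact: hfrac0.
  + exact: hfracD.
  + by have [] := hl _ pl.
- by move=> lam; rewrite mem_undup => /mapP[p /hl[_ p0] ->].
- suff -> : \sum_(lam <- undup [seq p.1 | p <- l]) \sum_(p <- l | p.1 == lam) p.2 =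
      \sum_(p <- l) p.2 by [].
  rewrite (exchange_big_dep predT) //= big_seq [RHS]big_seq; apply: eq_bigr => p pl.
  rewrite (big_rem p.1) /=; last by rewrite mem_undup; exact: map_f.
  rewrite eqxx big_seq_cond big1 ?addr0 // => lam /andP[].
  by move=> h /eqP e; move: h; rewrite -e mem_rem_uniqF // undup_uniq.
Qed.

End Euler.

(** * The completed valuation ring *)

Section CompletionDomain.
Variables (R : realType) (n : nat) (k : fieldType) (alpha : 'I_n.+1 -> {posnum R}).
Local Notation V := (valuation_ring k alpha).
Local Notation C := (completion k alpha).
Local Notation K := {fraction mseries n.+1 k}.
Local Notation vge := (@vge R n.+1 k alpha).
Local Notation piC := (\pi_({ideal_quot (@null_pred R n k alpha)})%qT).
Implicit Types (u v : cauchy_seq k alpha) (c : C).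

Lemma valuation_vge0 (v : V) : vge 0 v.
Proof. by case: v. Qed.

Lemma value_group_large mu : exists2 l, value_group alpha l & mu <= l.
Proof.
pose a := (alpha ord0)%:num; have a0 : 0 < a by rewrite /a.
pose N := (Num.truncn (mu / a)).+1.
exists (a *~ N); last first.
  by rewrite -pmulrn -mulr_natl -ler_pdivrMr //; apply: ltW; exact: truncnS_gt.
exists (fun j => if j == ord0 then N%:Z else 0).
by rewrite (bigD1 ord0) //= big1 ?addr0 // => j /negPf->; rewrite mulr0z.
Qed.

Lemma cauchy_vge u mu : exists N, forall i j : nat,
  (N <= i)%N -> (N <= j)%N -> vge mu (u i - u j : V).
Proof.
have [l lG le] := value_group_large mu; case: u => u /= /asboolP/(_ l lG)[N h].
by exists N => i j iN jN; apply: vge_le le _; exact: h.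
Qed.

(** The value group is unbounded, so arbitrary real bounds define the same null
    sequences. *)
Lemma null_vge u : reflect (forall mu, exists N, forall i : nat, (N <= i)%N -> vge mu (u i : V))
  (u \in @null_pred R n k alpha).
Proof.
apply: (iffP idP) => [/asboolP h mu|h].
  have [l lG le] := value_group_large mu; have [N hN] := h l lG.
  by exists N => i iN; apply: vge_le le _; exact: hN.
by apply/asboolP => l _; exact: h.
Qed.

Lemma piC_eq u v : (piC u = piC v :> C) <->
  forall mu, exists N, forall i : nat, (N <= i)%N -> vge mu (u i - v i : V).
Proof.
split=> [/eqP|h].
  by rewrite -Quotient.idealrBE => /null_vge h mu; have [N hN] := h mu; exists N.
by apply/eqP; rewrite -Quotient.idealrBE; apply/null_vge.
Qed.

Lemma piC_surj c : exists u, c = piC u.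
Proof. by exists (repr c); rewrite reprK. Qed.

Lemma piC0P u : (piC u = 0 :> C) <->
  forall mu, exists N, forall i : nat, (N <= i)%N -> vge mu (u i : V).
Proof.
rewrite -(rmorph0 piC) piC_eq; split=> h mu; have [N hN] := h mu;
  by exists N => i iN; have := hN i iN; rewrite /= subr0.
Qed.

(** A Cauchy sequence that is not null has an eventually bounded valuation, so
    any sequence whose product with it is null must be null. *)
Lemma completion_idomain : GRing.integral_domain_axiom C.
Proof.
move=> c d cd0; have [u uE] := piC_surj c; have [v vE] := piC_surj d.
apply/orP; have [|nu] := pselect (c = 0); first by move=> ->; left; rewrite eqxx.
right; apply/eqP; rewrite vE; apply/piC0P => mu.
have [l hl] : exists l, forall N, exists2 i : nat, (N <= i)%N & ~ vge l (u i : V).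
  apply: contrapT => nex; apply: nu; rewrite uE; apply/piC0P => l.
  apply: contrapT => nex2; apply: nex; exists l => N.
  apply: contrapT => nex3; apply: nex2; exists N => i iN.
  by apply: contrapT => h; apply: nex3; exists i.
have [N0 hN0] := cauchy_vge u l; have [i0 i0N nl] := hl N0.
have nlj (i : nat) : (N0 <= i)%N -> ~ vge l (u i : V).
  move=> iN li; apply: nl; have -> : (u i0 : V) = u i + (u i0 - u i) :> V.
    by rewrite addrC subrK.
  by apply: vgeD => //; exact: hN0.
have := cd0; rewrite uE vE -rmorphM => /piC0P/(_ (l + mu))[N hN].
exists (maxn N N0) => i; rewrite geq_max => /andP[iN iN0].
have := hN i iN; have := nlj i iN0; rewrite /vge /= frac_valM.
move: (frac_val alpha (u i)) (frac_val alpha (v i)) => [a| |] [b| |] //=;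
  rewrite ?lee_fin ?leey ?leNye //.
by move=> /negP; rewrite -ltNge; lra.
Qed.

Definition completion_unit : {pred C} := fun c => `[< exists d, d * c = 1 >].
Definition completion_inv (c : C) : C :=
  if pselect (exists d, d * c = 1) is left e then projT1 (cid e) else c.

Lemma completion_mulV : {in completion_unit, left_inverse 1 completion_inv *%R}.
Proof.
by move=> c /asboolP e; rewrite /completion_inv; case: pselect => // e'; case: cid.
Qed.
Lemma completion_unitP (c d : C) : d * c = 1 -> c \in completion_unit.
Proof. by move=> e; apply/asboolP; exists d. Qed.
Lemma completion_inv_out : {in [predC completion_unit], completion_inv =1 id}.
Proof.
by move=> c /negP nu; rewrite /completion_inv; case: pselect => // e; case: nu; exact/asboolP.
Qed.

HB.instance Definition _ := GRing.ComNzRing_hasMulInverse.Build C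
  completion_mulV completion_unitP completion_inv_out.
HB.instance Definition _ := GRing.ComUnitRing_isIntegral.Build C completion_idomain.

Definition vC (v : V) : C := piC (const_cauchy_seq v).

Lemma vCD (v w : V) : vC (v + w) = vC v + vC w.
Proof. by rewrite /vC -rmorphD; congr (\pi%qT _); exact: val_inj. Qed.
Lemma vCN (v : V) : vC (- v) = - vC v.
Proof. by rewrite /vC -rmorphN; congr (\pi%qT _); exact: val_inj. Qed.
Lemma vCB (v w : V) : vC (v - w) = vC v - vC w.
Proof. by rewrite vCD vCN. Qed.
Lemma vCM (v w : V) : vC (v * w) = vC v * vC w.
Proof. by rewrite /vC -rmorphM; congr (\pi%qT _); exact: val_inj. Qed.
Lemma vC0 : vC 0 = 0.
Proof. by rewrite -(subrr 0) vCB subrr. Qed.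
Lemma vC_sum I (r : seq I) (P : pred I) F :
  vC (\sum_(i <- r | P i) F i) = \sum_(i <- r | P i) vC (F i).
Proof. exact: (big_morph vC vCD vC0). Qed.

Lemma series_to_completionE f :
  series_to_completion alpha f = vC (series_to_valuation_ring alpha f).
Proof. by []. Qed.

(** The filtration of the completion by valuation; it is enough that one
    representative is eventually in the given ideal. *)
Definition Cge (mu : R) (c : C) := exists u, c = piC u /\
  exists N, forall i : nat, (N <= i)%N -> vge mu (u i : V).

Lemma CgeB mu c d : Cge mu c -> Cge mu d -> Cge mu (c - d).
Proof.
move=> [u [-> [N hN]]] [v [-> [M hM]]]; exists (u - v); rewrite rmorphB; split=> //.
exists (maxn N M) => i; rewrite geq_max => /andP[iN iM].
have -> : ((u - v) i : K) = (u i : K) - (v i : K) by [].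
by apply: vgeB; [exact: hN|exact: hM].
Qed.

Lemma Cge0 mu : Cge mu 0.
Proof.
exists 0; rewrite rmorph0; split=> //; exists 0%N => i _; exact: vge0.
Qed.

Lemma CgeN mu c : Cge mu c -> Cge mu (- c).
Proof. by move=> hc; rewrite -sub0r; apply: CgeB => //; exact: Cge0. Qed.

Lemma CgeD mu c d : Cge mu c -> Cge mu d -> Cge mu (c + d).
Proof. by move=> hc hd; rewrite -[d]opprK; apply: CgeB => //; exact: CgeN. Qed.

Lemma CgeM mu c d : Cge mu d -> Cge mu (c * d).
Proof.
have [u ->] := piC_surj c; move=> [v [-> [M hM]]]; exists (u * v); rewrite rmorphM; split=> //.
exists M => i iM; have -> : ((u * v) i : K) = (u i : K) * (v i : K) by [].
rewrite -[mu]add0r; apply: vgeM; last exact: hM.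
exact: valuation_vge0.
Qed.

Lemma Cge_le mu nu c : nu <= mu -> Cge mu c -> Cge nu c.
Proof.
move=> le [u [-> [N hN]]]; exists u; split=> //; exists N => i iN.
by apply: vge_le le _; exact: hN.
Qed.

Lemma Cge_sum mu I (r : seq I) (P : pred I) F :
  (forall i, P i -> Cge mu (F i)) -> Cge mu (\sum_(i <- r | P i) F i).
Proof. by move=> h; elim/big_ind: _ => //; [exact: Cge0|exact: CgeD]. Qed.

Lemma Cge_vC mu (v : V) : Cge mu (vC v) <-> vge mu v.
Proof.
split=> [[u [/piC_eq/(_ mu)[M hM] [N hN]]]|h]; last first.
  by exists (const_cauchy_seq v); split=> //; exists 0%N.
pose i := maxn M N; have := hM i (leq_maxl _ _); have := hN i (leq_maxr _ _) => h1 h2.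
have -> : (v : K) = (v - u i : V) + u i by rewrite /= subrK.
exact: vgeD.
Qed.

Lemma Cge_separated c : (forall mu, Cge mu c) -> c = 0.
Proof.
have [u0 ->] := piC_surj c => h; apply/piC0P => mu.
have [u [/piC_eq/(_ mu)[M hM] [N hN]]] := h mu.
exists (maxn M N) => i; rewrite geq_max => /andP[iM iN].
have -> : (u0 i : K) = (u0 i - u i : V) + u i by rewrite /= subrK.
by apply: vgeD; [exact: hM|exact: hN].
Qed.

Lemma valuation_dense c mu : exists v : V, Cge mu (c - vC v).
Proof.
have [u ->] := piC_surj c; have [N hN] := cauchy_vge u mu.
exists (u N); exists (u - const_cauchy_seq (u N)); rewrite rmorphB; split=> //.
exists N => i iN.
have -> : ((u - const_cauchy_seq (u N)) i : K) = (u i - u N : V) by [].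
exact: hN.
Qed.

Lemma vge_separated (x : K) : (forall mu, vge mu x) -> x = 0.
Proof.
move=> h; rewrite [x]fraction_repr; have := h; rewrite /vge.
rewrite {1}[x]fraction_repr; move: (denom_ratioP (repr x)).
move: (\n_(repr x)) (\d_(repr x)) => f g g0 {}h.
have [->|f0] := eqVneq f 0; first by rewrite tofrac0 mul0r.
have {}h mu : (mu%:E <= series_val alpha f - series_val alpha g)%E.
  by rewrite -frac_val_frac.
move: (series_val_fin alpha f0) (series_val_fin alpha g0) h.
case: (series_val alpha f) (series_val alpha g) => [a||] // [b||] // _ _ h.
have := h (a - b + 1); rewrite -EFinB lee_fin => {h}; rewrite gerDl.
by rewrite leNgt ltr01.
Qed.

Lemma vC_inj : injective vC.
Proof.
move=> v w e; apply/eqP; rewrite -subr_eq0; apply/eqP; apply: val_inj.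
apply: vge_separated => mu; apply/Cge_vC; rewrite vCB e subrr; exact: Cge0.
Qed.

Lemma series_to_completion_inj : injective (series_to_completion alpha : mseries n.+1 k -> C).
Proof.
move=> f g; rewrite !series_to_completionE => /vC_inj/(congr1 val) /= /eqP.
by rewrite tofrac_eq => /eqP.
Qed.

Lemma Cge_series mu (f : mseries n.+1 k) :
  Cge mu (series_to_completion alpha f) <-> val_ge alpha mu f.
Proof. by rewrite series_to_completionE Cge_vC -vge_tofrac. Qed.

Section Euler.
Variable psi : 'I_n.+1 -> int.
Let chiK := frac_deriv (@euler n.+1 k psi).
Let dK : is_derivation chiK := frac_deriv_is_derivation (euler_is_derivation k psi).

Lemma euler_val_ge mu (f : mseries n.+1 k) : val_ge alpha mu f -> val_ge alpha mu (euler psi f).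
Proof.
by move=> h m /= nz; apply: h; apply: contraNneq nz => ->; rewrite mulr0.
Qed.

(** For [x = f / g], both [chi f] and [x * chi g] have at least the valuation of
    [f], because [chi] does not enlarge supports. *)
Lemma euler_vge mu x : vge mu x -> vge mu (chiK x).
Proof.
have xE := fraction_repr x; move: xE (denom_ratioP (repr x)).
move: (\n_(repr x)) (\d_(repr x)) => f g xE g0 hx.
have [m gm] := series_val_attained alpha g0; set c := mnmweight alpha m => gc.
have tg0 : tofrac g != 0 by rewrite tofrac_eq0.
have hg : val_ge alpha c g by apply/series_val_ge; rewrite gc.
have hf : val_ge alpha (mu + c) f.
  apply/vge_tofrac; have -> : tofrac f = x * tofrac g by rewrite xE divfK.
  by apply: vgeM => //; exact/vge_tofrac.
have hi : vge (- c) (tofrac g)^-1.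
  by rewrite /vge -[_^-1]mul1r -tofrac1 frac_val_frac // series_val1 gc sub0e.
have -> : chiK x = (chiK (tofrac f) - x * chiK (tofrac g)) * (tofrac g)^-1.
  have fE : tofrac f = x * tofrac g by rewrite xE divfK.
  rewrite fE (drvM dK); apply: (mulIf tg0); by rewrite divfK // addrK.
rewrite -[mu](addrK c); apply: vgeM => //.
rewrite /chiK !(frac_deriv_tofrac (euler_is_derivation k psi)).
apply: vgeB; first by apply/vge_tofrac; exact: euler_val_ge.
by apply: vgeM => //; apply/vge_tofrac; exact: euler_val_ge.
Qed.

Fact eulerV_subproof (v : V) : chiK v \in valuation_ring_pred alpha.
Proof. exact: euler_vge (valuation_vge0 v). Qed.

Definition eulerV (v : V) : V := ValuationRing (eulerV_subproof v).

Lemma eulerV_is_derivation : is_derivation eulerV.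
Proof.
by split=> v w; apply: val_inj => /=; [exact: drvD dK _ _|exact: drvM dK _ _].
Qed.

Fact eulerS_subproof u : (fun i : nat => eulerV (u i)) \in @cauchy_pred R n k alpha.
Proof.
apply/asboolP => l _; have [N hN] := cauchy_vge u l; exists N => i j iN jN.
rewrite -(drvB eulerV_is_derivation); exact: euler_vge (hN _ _ iN jN).
Qed.

Definition eulerS u : cauchy_seq k alpha := CauchySeq (eulerS_subproof u).

Definition eulerC (c : C) : C := piC (eulerS (repr c)).

Lemma eulerC_pi u : eulerC (piC u) = piC (eulerS u).
Proof.
apply/piC_eq => mu; have /piC_eq/(_ mu)[N hN] : piC (repr (piC u : C)) = piC u :> C.
  by rewrite reprK.
exists N => i iN /=; rewrite -(drvB dK); exact: euler_vge (hN i iN).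
Qed.

Lemma eulerC_is_derivation : is_derivation eulerC.
Proof.
split=> c d; have [u ->] := piC_surj c; have [v ->] := piC_surj d.
  rewrite -rmorphD !eulerC_pi -rmorphD; congr (\pi%qT _); apply: val_inj.
  by apply/funext => i; exact: drvD eulerV_is_derivation _ _.
rewrite -rmorphM !eulerC_pi -!rmorphM -rmorphD; congr (\pi%qT _); apply: val_inj.
by apply/funext => i; exact: drvM eulerV_is_derivation _ _.
Qed.

Lemma eulerC_vC (v : V) : eulerC (vC v) = vC (eulerV v).
Proof. by rewrite /vC eulerC_pi; congr (\pi%qT _); exact: val_inj. Qed.

Lemma eulerC_series (f : mseries n.+1 k) :
  eulerC (series_to_completion alpha f) = series_to_completion alpha (euler psi f).
Proof.
rewrite !series_to_completionE eulerC_vC; congr vC; apply: val_inj => /=.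
exact: frac_deriv_tofrac (euler_is_derivation k psi) _.
Qed.

Lemma eulerC_Cge mu c : Cge mu c -> Cge mu (eulerC c).
Proof.
move=> [u [-> [N hN]]]; rewrite eulerC_pi; exists (eulerS u); split=> //.
by exists N => i iN; exact: euler_vge (hN i iN).
Qed.

End Euler.

End CompletionDomain.

(** * From the completion back to power series *)

Lemma horner_shift (S : comNzRingType) (p : {poly S}) (x h : S) :
  exists w, p.[x + h] - p.[x] = w * h.
Proof.
elim/poly_ind: p => [|p c [w e]]; first by exists 0; rewrite !horner0 subrr mul0r.
exists (w * (x + h) + p.[x]); rewrite !hornerMXaddC.
have -> : p.[x + h] = w * h + p.[x] by rewrite -e subrK.
ring.
Qed.

Lemma expr_div_homogenize (F : fieldType) (f g : F) (s l : nat) : g != 0 ->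
  (l <= s)%N -> (f / g) ^+ l * g ^+ s = f ^+ l * g ^+ (s - l).
Proof.
move=> g0 le; have -> : g ^+ s = g ^+ (s - l) * g ^+ l by rewrite -exprD subnK.
by rewrite expr_div_n -mulrA; congr (_ * _); rewrite mulrCA mulVf ?mulr1 // expf_neq0.
Qed.

Section Key.
Variables (R : realType) (n : nat) (k : fieldType) (alpha : 'I_n.+1 -> {posnum R}).
Hypothesis hk : [pchar k] =i pred0.
Local Notation A := (mseries n.+1 k).
Local Notation V := (valuation_ring k alpha).
Local Notation C := (completion k alpha).
Local Notation K := {fraction A}.
Local Notation Om := {fraction C}.
Local Notation vge := (@vge R n.+1 k alpha).
Local Notation hfrac := (@hfrac R n.+1 k alpha).
Local Notation sV := (series_to_valuation_ring alpha).
Local Notation sC := (@series_to_completion R n k alpha).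
Local Notation vC := (@vC R n k alpha).
Local Notation Cge := (@Cge R n k alpha).

Definition series_frac : {rmorphism A -> Om} := tofrac \o sC.

Lemma series_frac_inj : injective series_frac.
Proof. by move=> f g /= /eqP; rewrite tofrac_eq => /eqP/series_to_completion_inj. Qed.

Lemma pchar0_natr i : i.+1%:R != 0 :> k.
Proof. by rewrite ((pcharf0P k).1 hk). Qed.

Lemma pchar0_intr (z : int) : z != 0 -> z%:~R != 0 :> k.
Proof.
case: z => [[//|i] _|i _]; first exact: pchar0_natr.
by rewrite NegzE mulrNz oppr_eq0; exact: pchar0_natr.
Qed.

Lemma series_int_inv (z : int) : z != 0 ->
  exists2 a : A, a * z%:~R = 1 & whomog alpha 0 a.
Proof.
move=> z0; exists (ms_monomial (z%:~R)^-1 0); last first.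
  move=> m /=; case: (m =P 0%MM) => [-> _|_]; first by rewrite mnmweight0.
  by rewrite eqxx.
rewrite mulrC; apply/mseriesP => m; rewrite mscoef_intM /=.
by case: eqP => _; rewrite ?mulr0 // divff // pchar0_intr.
Qed.

Lemma series_frac_char i : i.+1%:R != 0 :> Om.
Proof.
have [a aE _] := @series_int_inv i.+1 isT.
apply/eqP => e0; have := oner_neq0 Om; rewrite -(rmorph1 series_frac) -aE rmorphM rmorph_int.
by rewrite -pmulrn e0 mulr0 eqxx.
Qed.

Lemma series_nat_inv i : exists a : A, a * i.+1%:R = 1.
Proof. by have [a aE _] := @series_int_inv i.+1 isT; exists a. Qed.

Lemma whomog_int (z : int) : whomog alpha 0 (z%:~R : A).
Proof.
move=> m; rewrite -[z%:~R]mulr1 mscoef_intM => h; apply: (@whomog1 _ _ k alpha).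
by apply: contraNneq h => ->; rewrite mulr0.
Qed.

Lemma hfracZ lam a x : whomog alpha 0 a -> hfrac lam x -> hfrac lam (tofrac a * x).
Proof.
by move=> a0 hx; rewrite -[lam]add0r; apply: hfracM => //; exact: hfrac_series.
Qed.

Lemma vCX v i : vC (v ^+ i) = vC v ^+ i.
Proof.
elim: i => [|i IH]; last by rewrite !exprS vCM IH.
by rewrite !expr0 -(rmorph1 sV) -series_to_completionE rmorph1.
Qed.

Lemma valuation_ring_val_sum I (r : seq I) (P : pred I) (F : I -> V) :
  ((\sum_(i <- r | P i) F i : V) : K) = \sum_(i <- r | P i) (F i : K).
Proof. by apply: (big_morph (fun v : V => v : K)). Qed.

Lemma valuation_ring_valX (v : V) i : ((v ^+ i : V) : K) = (v : K) ^+ i.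
Proof. by elim: i => [//|i IH]; rewrite !exprS -IH. Qed.

(** Power series are closed in the completion: the coefficient of a monomial is
    constant among all the approximations finer than its weight. *)
Lemma series_closed (c : C) : (forall mu, exists a, Cge mu (c - sC a)) -> exists a, c = sC a.
Proof.
move=> h; pose aa mu := projT1 (cid (h mu)).
have aaP mu : Cge mu (c - sC (aa mu)) := projT2 (cid (h mu)).
pose a : A := MSeries (fun m => mscoef (aa (mnmweight alpha m + 1)) m).
exists a; apply/eqP; rewrite -subr_eq0; apply/eqP/Cge_separated => mu.
have -> : c - sC a = (c - sC (aa mu)) + sC (aa mu - a) by rewrite rmorphB addrA subrK.
apply: CgeD => //; apply/Cge_series => m; rewrite leNgt => nz; apply/negP => lt.
pose nu := Num.min mu (mnmweight alpha m + 1).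
have h1 : Cge nu (c - sC (aa mu)) by apply: Cge_le (aaP mu); rewrite /nu ge_min lexx.
have h2 : Cge nu (c - sC (aa (mnmweight alpha m + 1))).
  by apply: Cge_le (aaP _); rewrite /nu ge_min lexx orbT.
have := CgeB h2 h1; rewrite opprB addrC addrA subrK -rmorphB.
move=> /Cge_series/(_ m) /= le; have := le nz.
by rewrite /nu ge_min => /orP[]; rewrite leNgt ?lt // ltrDl ltr01.
Qed.

Section Log.
Variables (delta u : A) (i0 : R).
Hypotheses (delta0 : delta != 0) (hdelta : whomog alpha i0 delta) (uu : u \is a GRing.unit).
Variable cs : seq Om.
Hypothesis ics : forall c, c \in cs -> integralOver series_frac c.
Hypothesis logd : forall psi, compat alpha psi ->
  log_deriv series_frac (delta * u) cs (frac_deriv (@eulerC R n k alpha psi)).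

Let d := delta * u.
Let d0 : d != 0.
Proof. by rewrite mulf_neq0 //; apply: contraTneq uu => ->; rewrite unitr0. Qed.

Local Notation LI := (log_int series_frac d cs).
Let Acn := @mseries_completely_normal n.+1 k.
Let LIB := log_intB series_frac_inj d0 (cs := cs).
Let LIZ := log_intZ series_frac_inj d0 (cs := cs).

Lemma LI_deriv psi x : compat alpha psi -> LI x ->
  LI (frac_deriv (@eulerC R n k alpha psi) x).
Proof.
move=> cpsi; apply: (log_int_deriv series_frac_inj Acn series_frac_char series_nat_inv d0 ics).
exact: logd.
Qed.

(** If [psi] separates the degrees of two components with eigenvalues [z] and
    [z'], then [(chi - z') / (z - z')] fixes the first one, kills the second one
    and multiplies every other component by a constant. *)
Lemma isolate_component mu (r : seq R) lam0 (x : R -> V) (h c : C) :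
  uniq (lam0 :: r) -> (forall lam, hfrac lam (x lam)) ->
  c = vC (x lam0) + \sum_(lam <- r) vC (x lam) + h -> Cge mu h -> LI (tofrac c) ->
  exists y h', [/\ y = vC (x lam0) + h', Cge mu h' & LI (tofrac y)].
Proof.
elim: r x h c => [|lam' r IH] x h c.
  by rewrite big_nil addr0 => _ _ cE hh lc; exists c, h.
rewrite /= in_cons negb_or => /andP[/andP[ne nr] /andP[nr' ur]] hx cE hh lc.
have ur0 : uniq (lam0 :: r) by rewrite /= nr.
have [x'0|x'0] := eqVneq (x lam') 0.
  by apply: (IH x h c) => //; rewrite cE big_cons x'0 vC0 add0r.
have [x00|x00] := eqVneq (x lam0) 0.
  exists 0, 0; rewrite x00 vC0 addr0 tofrac0; split=> //; first exact: Cge0.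
  by rewrite -(subrr (tofrac c)); exact: LIB.
have nzV (v : V) : v != 0 -> (v : K) != 0.
  by apply: contra_neq => e; apply: val_inj.
have [psi [cpsi [z [z' [zz' zE z'E]]]]] :=
  hfrac_separate (hx lam0) (nzV _ x00) (hx lam') (nzV _ x'0) ne.
have [|a aE ha] := @series_int_inv (z - z'); first by rewrite subr_eq0.
pose z'A : A := z'%:~R.
pose T (e : C) : C := sC a * (eulerC psi e - sC z'A * e).
pose TV (v : V) : V := sV a * (eulerV psi v - sV z'A * v).
have TVE v : T (vC v) = vC (TV v).
  by rewrite /T /TV vCM vCB vCM eulerC_vC -!series_to_completionE.
have dC := @eulerC_is_derivation R n k alpha psi.
have TD e f : T (e + f) = T e + T f.
  by rewrite /T (drvD dC) [sC z'A * _]mulrDr opprD addrACA mulrDr.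
have T0 : T 0 = 0 by rewrite /T (drv0 dC) mulr0 subrr mulr0.
have TVv v : (TV v : K) =
    tofrac a * (frac_deriv (euler psi) (v : K) - z'%:~R * (v : K)).
  by rewrite /TV /= rmorph_int.
have TVeig lam y0 : (forall y, hfrac lam y -> frac_deriv (euler psi) y = y0%:~R * y) ->
    forall v : V, hfrac lam v -> (TV v : K) = tofrac (a * (y0 - z')%:~R) * (v : K).
  move=> h0 v hv; rewrite TVv h0 // -mulrBl -intrB tofracM rmorph_int mulrA //.
have T1 : TV (x lam0) = x lam0.
  by apply: val_inj; apply: (etrans (TVeig _ _ zE _ _)) => //; rewrite aE tofrac1 mul1r.
have T2 : TV (x lam') = 0.
  apply: val_inj; apply: (etrans (TVeig _ _ z'E _ _)) => //.
  by rewrite subrr mulr0 tofrac0 mul0r.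
have Th lam : hfrac lam (TV (x lam)).
  have [y0 y0E] := hfrac_any k lam cpsi; rewrite (TVeig _ _ y0E) //.
  apply: hfracZ => //; rewrite -(addr0 0); apply: whomogM => //; exact: whomog_int.
rewrite -T1; apply: (IH (fun lam => TV (x lam)) (T h) (T c)) => //.
- rewrite cE !TD big_cons TD !TVE T2 vC0 add0r; congr (_ + _ + _).
  rewrite (big_morph T TD T0); apply: eq_bigr => lam _; exact: TVE.
- apply: CgeM; apply: CgeB; [exact: eulerC_Cge|exact: CgeM].
- have -> : tofrac (T c) = series_frac a *
     (frac_deriv (@eulerC R n k alpha psi) (tofrac c) - series_frac z'A * tofrac c).
    by rewrite (frac_deriv_tofrac dC) /= -tofracM -tofracB -tofracM.
  by apply: LIZ; apply: LIB; [exact: LI_deriv|exact: LIZ].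
Qed.

(** Let [e = delta * x0] and let [e + h] be a root of the monic [p], of a degree
    [s] that is independent of the approximation.  As [h] has large valuation, so
    has [p(e)].  The part of [p(e)] of degree [s * deg e] therefore vanishes, and
    it is a monic polynomial in [e] whose coefficients are components of those of
    [p].  Denominators are cleared by a power of the homogeneous [g]. *)
Lemma component_in_series : exists s : nat, forall mu lam0 (x0 : V) (h' y : C),
  s%:R * (lam0 + i0) < mu -> hfrac lam0 x0 -> y = vC x0 + h' -> Cge mu h' ->
  LI (tofrac y) -> exists a, sC delta * vC x0 = sC a.
Proof.
have [s hs] := log_int_integral series_frac_inj Acn d0 ics.
exists s => mu lam0 x0 h' y mus hx yE hh' Ly.
have [p [mp sp py]] := hs _ (LIZ u^-1 Ly).
have {}py : root (map_poly sC p) (sC delta * y).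
  have e : series_frac d * (series_frac u^-1 * tofrac y) = tofrac (sC delta * y).
    by rewrite mulrA -rmorphM /d mulrK // tofracM.
  by move: py; rewrite e [map_poly _ _]map_poly_comp /root horner_map tofrac_eq0.
have [e eD] : exists e : V, e = sV delta * x0 by exists (sV delta * x0).
have he : hfrac (i0 + lam0) e.
  rewrite eD; have -> : ((sV delta * x0 : V) : K) = tofrac delta * (x0 : K) by [].
  by apply: hfracM => //; exact: hfrac_series.
have pe : Cge mu (map_poly sC p).[vC e].
  have [w wE] := horner_shift (map_poly sC p) (vC e) (sC delta * h').
  have eE : vC e + sC delta * h' = sC delta * y.
    by rewrite yE mulrDr eD vCM.
  move: wE; rewrite eE (rootP py) sub0r => /eqP; rewrite eqr_oppLR => /eqP ->.
  by apply: CgeN; do 2!apply: CgeM.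
have {}pe : vge mu (\sum_(l < s.+1) tofrac p`_l * (e : K) ^+ l).
  have -> : \sum_(l < s.+1) tofrac p`_l * (e : K) ^+ l =
      ((\sum_(l < s.+1) sV p`_l * e ^+ l : V) : K).
    by rewrite valuation_ring_val_sum; apply: eq_bigr => l _; rewrite -valuation_ring_valX.
  apply/Cge_vC; rewrite vC_sum.
  have -> : \sum_(l < s.+1) vC (sV p`_l * e ^+ l) = (map_poly sC p).[vC e]; last by [].
  rewrite (@horner_coef_wide _ s.+1); last by rewrite (leq_trans (size_poly _ _)) ?sp.
  by apply: eq_bigr => l _; rewrite vCM vCX coef_map.
have [a [b [f [g [fa gb g0 eps eE]]]]] := he.
pose F := \sum_(l < s.+1) p`_l * (f ^+ l * g ^+ (s - l)).
have tg0 : tofrac g != 0 by rewrite tofrac_eq0.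
have FE : tofrac F = (\sum_(l < s.+1) tofrac p`_l * (e : K) ^+ l) * tofrac g ^+ s.
  rewrite /F rmorph_sum mulr_suml; apply: eq_bigr => l _ /=.
  have le : (l <= s)%N by rewrite -ltnS.
  by rewrite -[RHS]mulrA eE expr_div_homogenize // !tofracM !tofracXn.
have hF : val_ge alpha (mu + s%:R * b) F.
  apply/vge_tofrac; rewrite FE; apply: vgeM => //.
  by rewrite -tofracXn; apply/vge_tofrac => m gm; rewrite (whomogX gb gm).
pose q l := component alpha ((s - l)%:R * (a - b)) p`_l.
have Fcomp : \sum_(l < s.+1) q l * (f ^+ l * g ^+ (s - l)) = 0.
  have lt : s%:R * a < mu + s%:R * b.
    rewrite -ltrBlDr -mulrBr -eps addrC; exact: mus.
  rewrite -[RHS](component_val_ge lt hF) /F component_sum; apply: eq_bigr => l _.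
  have le : (l <= s)%N by rewrite -ltnS.
  have hl : whomog alpha (l%:R * a + (s - l)%:R * b) (f ^+ l * g ^+ (s - l)).
    by apply: whomogM; exact: whomogX.
  rewrite /q -(componentM _ _ hl); congr component.
  by rewrite natrB //; ring.
have qs : q s = 1.
  rewrite /q subnn mul0r; have /monicP := mp; rewrite /lead_coef sp /= => ->.
  by apply: homog_component; exact: whomog1.
have [|e0 e0E] := completely_normal_normal Acn (x := (e : K)).
  exists (\poly_(l < s.+1) q l).
    by rewrite monicE lead_coef_poly // qs ?oner_neq0.
  rewrite /root (@horner_coef_wide _ s.+1); last first.
    by rewrite (leq_trans (size_poly _ _)) // size_poly.
  apply/eqP; apply: (mulIf (expf_neq0 s tg0)); rewrite mul0r.
  rewrite -[RHS](tofrac0 A) -Fcomp rmorph_sum mulr_suml; apply: eq_bigr => l _ /=.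
  have le : (l <= s)%N by rewrite -ltnS.
  rewrite -[LHS]mulrA eE expr_div_homogenize // coef_map coef_poly ltn_ord.
  by rewrite !tofracM !tofracXn.
exists e0; rewrite !series_to_completionE -vCM -eD; congr vC.
exact: val_inj.
Qed.

(** Each [delta * c_lam] is a series, so [delta * c] is a limit of series, and [c]
    is an integral fraction of series. *)
Lemma log_int_series (c : C) : tofrac c \in cs -> LI (tofrac c) -> exists a, c = sC a.
Proof.
move=> ccs Lc; have [s hs] := component_in_series.
have [a aE] : exists a, sC delta * c = sC a.
  apply: series_closed => mu0.
  (* large enough to recover all the components of degree less than [mu0] *)
  pose mu := Num.max mu0 (s%:R * (mu0 + i0) + 1).
  have [v cv] := valuation_dense c mu.
  have [r [x [ur hx r0 vr]]] := hfrac_decomposition mu (valuation_vge0 v).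
  pose xV (lam : R) : V := if pselect (vge 0 (x lam)) is left e then ValuationRing e else 0.
  have hxV lam : hfrac lam (xV lam).
    by rewrite /xV; case: pselect => ? //=; exact: hfrac0.
  have xVE lam : lam \in r -> (xV lam : K) = x lam.
    move=> lr; rewrite /xV; case: pselect => //= -[].
    exact: vge_le (r0 _ lr) (hfrac_vge (hx lam)).
  pose h := c - \sum_(lam <- r) vC (xV lam).
  have hh : Cge mu h.
    have -> : h = (c - vC v) + vC (v - \sum_(lam <- r) xV lam).
      by rewrite vCB vC_sum addrA subrK.
    apply: CgeD => //; apply/Cge_vC.
    have -> : ((v - \sum_(lam <- r) xV lam : V) : K) = (v : K) - \sum_(lam <- r) x lam.
      transitivity ((v : K) - ((\sum_(lam <- r) xV lam : V) : K)); first by [].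
      rewrite valuation_ring_val_sum; congr (_ - _).
      by rewrite big_seq [RHS]big_seq; apply: eq_bigr => lam lr; exact: xVE.
    exact: vr.
  have hcomp lam : lam \in r -> exists b, Cge mu0 (sC delta * vC (xV lam) - sC b).
    move=> lr; have [le|lt] := leP mu0 lam.
      exists 0; rewrite rmorph0 subr0; apply: CgeM; apply/Cge_vC.
      exact: vge_le le (hfrac_vge (hxV lam)).
    have ulr : uniq (lam :: rem lam r) by rewrite /= mem_rem_uniqF // rem_uniq.
    have cE : c = vC (xV lam) + \sum_(l <- rem lam r) vC (xV l) + h.
      have <- : \sum_(l <- r) vC (xV l) = vC (xV lam) + \sum_(l <- rem lam r) vC (xV l).
        by rewrite (big_rem lam lr).
      by rewrite /h addrC subrK.
    have [y [h' [yE hh' Ly]]] := isolate_component ulr hxV cE hh Lc.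
    have [|b bE] := hs mu lam _ _ _ _ (hxV lam) yE hh' Ly.
      rewrite /mu lt_max; apply/orP; right.
      apply: (@le_lt_trans _ _ (s%:R * (mu0 + i0))); last by rewrite ltrDl ltr01.
      by rewrite ler_wpM2l // lerD2r ltW.
    by exists b; rewrite bE subrr; exact: Cge0.
  pose bb lam := if pselect (exists b, Cge mu0 (sC delta * vC (xV lam) - sC b)) is left e
                 then projT1 (cid e) else 0.
  exists (\sum_(lam <- r) bb lam).
  have -> : sC delta * c - sC (\sum_(lam <- r) bb lam) =
     \sum_(lam <- r) (sC delta * vC (xV lam) - sC (bb lam)) + sC delta * h.
    rewrite sumrB -mulr_sumr /h mulrBr.
    have -> : sC (\sum_(lam <- r) bb lam) = \sum_(lam <- r) sC (bb lam) by rewrite rmorph_sum.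
    by rewrite [RHS]addrC addrA subrK.
  apply: CgeD; last by apply: CgeM; apply: Cge_le hh; rewrite /mu le_max lexx.
  rewrite big_seq; apply: Cge_sum => lam /hcomp hb; rewrite /bb.
  by case: pselect => // e; case: cid.
have [g gE] := fraction_lift series_frac_inj.
have sd0 : sC delta != 0 by rewrite -(rmorph0 sC) (inj_eq (@series_to_completion_inj _ _ _ _)).
have [xx xxE] : exists xx : K, xx = tofrac a / tofrac delta by exists (tofrac a / tofrac delta).
have gx : g xx = tofrac c.
  by rewrite xxE rmorphM fmorphV !gE /= -aE tofracM mulrAC divff ?mul1r // tofrac_eq0.
have ix : integralOver (g \o tofrac) (g xx).
  have [p mp pc] := ics ccs; apply: (ex_intro2 _ _ p mp); rewrite gx.
  rewrite (@eq_map_poly _ _ (g \o tofrac) series_frac gE); exact: pc.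
have [b bE] := completely_normal_normal Acn (integral_inj (fmorph_inj g) ix).
exists b; apply: (mulfI sd0); rewrite aE -rmorphM; congr (sC _).
by apply/eqP; rewrite -tofrac_eq tofracM -bE xxE mulrC divfK ?tofrac_eq0.
Qed.

End Log.
End Key.

(** * Monic factors over the completion *)

Lemma monic_factor_integral (A S : comNzRingType) (f : {rmorphism A -> S})
    (P : {poly A}) (Q T : {poly S}) : P \is monic -> Q \is monic ->
  Q * T = map_poly f P -> forall l, integralOver f Q`_l.
Proof.
move=> mP mQ QT l.
have [le|lt] := leqP (size Q) l; first by rewrite nth_default //; exact: integral0.
have [e sQ] : exists e, size Q = e.+1 by exists (size Q).-1; rewrite prednK // (leq_ltn_trans _ lt).
have [E [h [rs [hI Qrs]]]] := splitting_ring mQ sQ.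
have srs : size rs = e.
  have := size_prod_XsubC rs id; rewrite /= -Qrs size_map_poly_id0 ?sQ; first by case.
  by rewrite (monicP mQ) rmorph1 oner_neq0.
apply: (integral_inj hI).
rewrite -coef_map Qrs; have -> : l = (size rs - (size rs - l))%N by lia.
apply: (@coef_prod_XsubC_closed _ (fun _ y => integralOver (h \o f) y)).
- exact: integral1.
- by move=> _; exact: integral0.
- by move=> _ x y; exact: integral_sub.
- by move=> _ x y; exact: integral_mul.
- move=> z zrs; apply: (ex_intro2 _ _ P mP).
  rewrite map_poly_comp -QT rmorphM /= Qrs /root hornerM.
  by rewrite (perm_big _ (perm_to_rem zrs)) big_cons hornerM hornerXsubC subrr !mul0r.
- exact: leq_subr.
Qed.

Section PolySubring.
Variables (C : idomainType) (S : C -> Prop) (Sr : is_subring S).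

Definition coefs_in (F : {poly C}) := forall i, S F`_i.

Lemma coefs_inB F G : coefs_in F -> coefs_in G -> coefs_in (F - G).
Proof. by move=> hF hG i; rewrite coefB; apply: (subringB Sr). Qed.
Lemma coefs_inM F G : coefs_in F -> coefs_in G -> coefs_in (F * G).
Proof.
by move=> hF hG i; rewrite coefM; apply: (subring_sum Sr) => l _; apply: (subringM Sr).
Qed.
Lemma coefs_in_deriv F : coefs_in F -> coefs_in F^`().
Proof. by move=> hF i; rewrite coef_deriv; apply: (subringMn Sr). Qed.

Lemma coefs_in_edivp Q F : Q \is monic -> coefs_in Q -> coefs_in F ->
  exists G H, [/\ F = G * Q + H, (size H < size Q)%N & coefs_in H].
Proof.
move=> mQ hQ; have [s] := ubnP (size F); elim: s F => // s IH F sF hF.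
have [lt|le] := ltnP (size F) (size Q).
  by exists 0, F; rewrite mul0r add0r.
have [F0|F0] := eqVneq F 0.
  by move: le; rewrite F0 size_poly0 leqn0 size_poly_eq0 (negPf (monic_neq0 mQ)).
pose M := lead_coef F *: 'X^(size F - size Q).
have hM : coefs_in M.
  move=> i; rewrite coefZ coefXn; apply: (subringM Sr); first exact: hF.
  exact: (subring_nat Sr).
have hFM : coefs_in (F - M * Q) by apply: coefs_inB => //; exact: coefs_inM.
have sQ : (0 < size Q)%N by rewrite size_poly_gt0 monic_neq0.
have sF0 : (0 < size F)%N by rewrite size_poly_gt0.
have [|G [H [e sH hH]]] := IH (F - M * Q) _ hFM.
  apply: (@leq_trans (size F)); last by rewrite -ltnS.
  rewrite -[X in (_ < X)%N](prednK sF0) ltnS; apply/leq_sizeP => i li.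
  rewrite coefB /M -scalerAl coefZ coefXnM.
  case: ltnP => [|_]; first by lia.
  move: li; rewrite leq_eqVlt => /orP[/eqP <-|lt].
    have -> : ((size F).-1 - (size F - size Q) = (size Q).-1)%N by lia.
    by rewrite -/(lead_coef Q) (monicP mQ) mulr1 subrr.
  have ltF : (size F <= i)%N by rewrite -(prednK sF0).
  rewrite [F`_i]nth_default // nth_default ?mulr0 ?subrr //.
  by rewrite leq_psubRL // subnK.
exists (G + M), H; split=> //.
by rewrite mulrDl addrAC -e subrK.
Qed.

End PolySubring.

Lemma map_poly_derivM (C : comNzRingType) (chi : C -> C) (F G : {poly C}) :
  is_derivation chi ->
  map_poly chi (F * G) = map_poly chi F * G + F * map_poly chi G.
Proof.
move=> dchi; apply/polyP => i.
rewrite coef_map_id0 ?drv0 // coefD !coefM drv_sum // -big_split /=.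
by apply: eq_bigr => l _; rewrite (drvM dchi) !coef_map_id0 ?drv0.
Qed.

(** Modulo [Q], the Bezout relation reads [d = W * Q' * T], so [W * Q'] inverts
    [T] up to [d]; since [chi P = chi Q * T] modulo [Q], the polynomial
    [d *: chi Q] is the remainder of [W * Q' * chi P] by [Q]. *)
Lemma factor_deriv_coefs (C : idomainType) (S : C -> Prop) (chi : C -> C)
    (P Q T U W : {poly C}) (d : C) :
  is_subring S -> is_derivation chi -> Q \is monic -> P = Q * T ->
  d%:P = U * P + W * P^`() -> coefs_in S Q -> coefs_in S W -> 
  coefs_in S (map_poly chi P) -> coefs_in S (d *: map_poly chi Q).
Proof.
move=> Sr dchi mQ PE dE hQ hW hP.
pose F := W * Q^`() * map_poly chi P.
have hF : coefs_in S F by apply: coefs_inM => //; apply: coefs_inM => //; exact: coefs_in_deriv.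
have [G [H [e sH hH]]] := coefs_in_edivp Sr mQ hQ hF.
suff -> : d *: map_poly chi Q = H by [].
have sQ : (size (map_poly chi Q) < size Q)%N.
  have sQ0 : (0 < size Q)%N by rewrite size_poly_gt0 monic_neq0.
  rewrite -(prednK sQ0) ltnS; apply/leq_sizeP => i li.
  rewrite coef_map_id0 ?drv0 //; move: li; rewrite leq_eqVlt => /orP[/eqP <-|lt].
    by rewrite -/(lead_coef Q) (monicP mQ) drv1.
  by rewrite nth_default ?drv0 // -(prednK sQ0).
have key : d *: map_poly chi Q - H =
    Q * (U * T * map_poly chi Q + W * T^`() * map_poly chi Q
         - W * Q^`() * map_poly chi T + G).
  have {e} -> : H = F - G * Q by rewrite e addrC addKr.
  rewrite -mul_polyC dE /F PE map_poly_derivM // derivM.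
  move: (map_poly chi Q) (map_poly chi T) Q^`() T^`() => cQ cT Q' T'.
  ring.
apply/eqP; rewrite -subr_eq0; apply/eqP; move: key.
set X := (X in Q * X); have [->|X0] := eqVneq X 0; first by rewrite mulr0.
move=> /(congr1 (fun F : {poly C} => size F)).
rewrite /= size_monicM // => e2.
have : (size (d *: map_poly chi Q - H)%R < size Q)%N.
  apply: leq_ltn_trans (size_polyD _ _) _; rewrite size_polyN gtn_max sH andbT.
  exact: leq_ltn_trans (size_scale_leq _ _) sQ.
rewrite e2; have := X0; rewrite -size_poly_gt0 => /prednK <-.
by rewrite addnS ltnNge leq_addr.
Qed.

(** The leading coefficients of two factors of a monic polynomial are inverse to
    each other, so exchanging them makes both factors monic. *)
Lemma irreducible_transfer (A C : idomainType) (phi : {rmorphism A -> C})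
    (P P1 P2 : {poly A}) : injective phi ->
  (forall Q T : {poly C}, Q \is monic -> T \is monic -> Q * T = map_poly phi P ->
     exists Q0, Q = map_poly phi Q0) ->
  P1 \is monic -> P2 \is monic -> P = P1 * P2 ->
  irreducible_elt P1 -> irreducible_elt (map_poly phi P1).
Proof.
move=> phiI hP m1 m2 PE [nu1 irr1].
have mm1 : map_poly phi P1 \is monic by exact: monic_map.
have mm2 : map_poly phi P2 \is monic by exact: monic_map.
split.
  move=> [q qP]; apply: nu1; exists 1; rewrite mul1r.
  have q0 : q != 0 by apply: contraTneq isT => q0; move/eqP: qP; rewrite q0 mul0r eq_sym oner_eq0.
  have sP1 : size (map_poly phi P1) = size P1.
    by rewrite size_map_poly_id0 // (monicP m1) rmorph1 oner_neq0.
  have := congr1 (fun F : {poly C} => size F) qP; rewrite /= size_Mmonic // size_poly1 sP1.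
  have : (0 < size q)%N by rewrite size_poly_gt0.
  have : (0 < size P1)%N by rewrite size_poly_gt0 monic_neq0.
  move=> s1 s2 s3; have /size1_polyC FE : (size P1 <= 1)%N.
    by move: s1 s2 s3; move: (size P1) (size q) => x y; lia.
  by move: m1; rewrite FE monicE lead_coefC => /eqP->.
move=> b c bc; pose lb := lead_coef b; pose lc := lead_coef c.
have lbc : lb * lc = 1 by rewrite -lead_coefM -bc (monicP mm1).
pose Q := lc%:P * b; pose T := lb%:P * c.
have mQ : Q \is monic by rewrite monicE lead_coefM lead_coefC mulrC lbc.
have mT : T \is monic by rewrite monicE lead_coefM lead_coefC lbc.
have QT : Q * T = map_poly phi P1.
  by rewrite /Q /T mulrACA -polyCM mulrC [lc * lb]mulrC lbc mulr1 bc.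
have [Q0 Q0E] : exists Q0, Q = map_poly phi Q0.
  apply: (hP Q (T * map_poly phi P2)) => //; first by rewrite monicMl.
  by rewrite mulrA QT PE rmorphM.
have [T0 T0E] : exists T0, T = map_poly phi T0.
  apply: (hP T (Q * map_poly phi P2)) => //; first by rewrite monicMl.
  by rewrite mulrA [T * Q]mulrC QT PE rmorphM.
have : P1 = Q0 * T0.
  by apply: (map_inj_poly phiI); rewrite ?rmorph0 // rmorphM /= -Q0E -T0E.
move=> /irr1[[t tE]|[t tE]]; [left|right].
  exists (map_poly phi t * lc%:P); rewrite -mulrA -/Q Q0E -rmorphM tE; exact: rmorph1.
exists (map_poly phi t * lb%:P); rewrite -mulrA -/T T0E -rmorphM tE; exact: rmorph1.
Qed.

Section Assembly.
Variables (R : realType) (n : nat) (k : fieldType) (alpha : 'I_n.+1 -> {posnum R}).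
Hypothesis hk : [pchar k] =i pred0.
Local Notation A := (mseries n.+1 k).
Local Notation C := (completion k alpha).
Local Notation Om := {fraction C}.
Local Notation sC := (@series_to_completion R n k alpha).
Variables (P : {poly A}) (mP : P \is monic).
Variables (delta u : A) (i0 : R).
Hypotheses (delta0 : delta != 0) (hdelta : whomog alpha i0 delta) (uu : u \is a GRing.unit).
Hypothesis hdisc : discriminant P = delta * u.

(** The resultant is in the ideal generated by [P] and its derivative; in
    characteristic zero the bound on the degree makes the derivative non-constant,
    as [resultant_in_ideal] requires. *)
Lemma discriminant_bezout : (2 < size P)%N ->
  exists U W : {poly A}, (delta * u)%:P = U * P + W * P^`().
Proof.
move=> sP; have sP' : (1 < size P^`())%N.
  have [d dE] : exists d, size P = d.+3 by case: (size P) sP => [|[|[|d]]] // _; exists d.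
  apply: (@leq_trans d.+2) => //; rewrite ltnNge; apply/negP => /leq_sizeP/(_ _ (leqnn _)).
  rewrite coef_deriv; have /monicP := mP; rewrite /lead_coef dE /= => ->.
  move=> e0; have [a aE _] := @series_int_inv _ _ _ alpha hk d.+2 isT.
  have := oner_neq0 A; rewrite -aE -pmulrn e0 mulr0 eqxx //.
have [[U W] /= _ e] := resultant_in_ideal (ltnW sP) sP'.
pose sg : A := (-1) ^+ 'C((size P).-1, 2).
exists (sg%:P * U), (sg%:P * W).
by rewrite -hdisc /discriminant polyCM e -/sg mulrDr !mulrA.
Qed.

Lemma factor_coefs_in_series (Q T : {poly C}) : Q \is monic -> T \is monic ->
  Q * T = map_poly sC P -> forall l, exists a, Q`_l = sC a.
Proof.
move=> mQ mT QT l.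
have PT : map_poly sC P = T * Q by rewrite mulrC.
have monic_size1 (F : {poly C}) : F \is monic -> (size F <= 1)%N -> F = 1.
  by move=> mF /size1_polyC FE; move: mF; rewrite FE monicE lead_coefC => /eqP->.
have [sQ|sQ] := leqP (size Q) 1.
  by rewrite (monic_size1 _ mQ sQ); exists (1 : {poly A})`_l; rewrite -coef_map rmorph1.
have [sT|sT] := leqP (size T) 1.
  by exists P`_l; rewrite -coef_map -QT (monic_size1 _ mT sT) mulr1.
have sP : (2 < size P)%N.
  have : size (map_poly sC P) = size P.
    by rewrite size_map_poly_id0 // (monicP mP) rmorph1 oner_neq0.
  move=> <-; rewrite -QT size_monicM ?monic_neq0 //.
  by move: sQ sT; move: (size Q) (size T) => x y; lia.
have [U [W dE]] := discriminant_bezout sP.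
pose d := delta * u.
have [lQ|lQ] := leqP (size Q) l; first by exists 0; rewrite rmorph0 nth_default.
pose cs : seq Om := [seq FracField.tofrac x | x <- (Q : seq C) ++ (T : seq C)].
have inQ i : Q`_i = 0 \/ tofrac Q`_i \in cs.
  have [le|lt] := leqP (size Q) i; first by left; rewrite nth_default.
  by right; apply: map_f; rewrite mem_cat mem_nth.
have inT i : T`_i = 0 \/ tofrac T`_i \in cs.
  have [le|lt] := leqP (size T) i; first by left; rewrite nth_default.
  by right; apply: map_f; rewrite mem_cat mem_nth ?orbT.
have csE c : c \in cs -> (exists i, c = tofrac Q`_i) \/ (exists i, c = tofrac T`_i).
  move=> /mapP[x]; rewrite mem_cat => /orP[] /(nthP 0)[i _ <-] ->; [left|right]; by exists i.
pose j := @series_frac R n k alpha.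
have ics c : c \in cs -> integralOver j c.
  move=> /csE[[i ->]|[i ->]]; apply: integral_rmorph.
    exact: (monic_factor_integral mP mQ QT).
  by apply: (monic_factor_integral mP mT (esym PT)).
pose S (x : C) := ring_gen j cs (tofrac x).
have Br := ring_gen_subring j cs.
have Sr : is_subring S.
  split; first by rewrite /S tofrac1; exact: subring1 Br.
    by move=> x y Sx Sy; rewrite /S tofracB; exact: RingGenB.
  by move=> x y Sx Sy; rewrite /S tofracM; exact: RingGenM.
have SA a : S (sC a) by exact: RingGenBase.
have SAP (F : {poly A}) : coefs_in S (map_poly sC F) by move=> i; rewrite coef_map; exact: SA.
have SQ : coefs_in S Q.
  by move=> i; case: (inQ i) => [->|h]; [exact: (subring0 Sr)|exact: RingGenIn].
have ST : coefs_in S T.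
  by move=> i; case: (inT i) => [->|h]; [exact: (subring0 Sr)|exact: RingGenIn].
have dE' : (sC d)%:P = map_poly sC U * map_poly sC P + map_poly sC W * (map_poly sC P)^`().
  by rewrite deriv_map -!rmorphM -rmorphD -dE /= map_polyC.
have logd psi : compat alpha psi ->
    log_deriv j d cs (frac_deriv (@eulerC R n k alpha psi)).
  move=> cpsi; have dC := @eulerC_is_derivation R n k alpha psi; split.
  - exact: frac_deriv_is_derivation.
  - move=> a; exists (euler psi a).
    by rewrite /j /= (frac_deriv_tofrac dC) eulerC_series.
  - have [m dm] := series_neq0 delta0.
    exists ((int_weight psi m)%:~R + euler psi u * u^-1).
    rewrite /j /= (frac_deriv_tofrac dC) eulerC_series -tofracM -rmorphM; congr (tofrac (sC _)).
    rewrite (drvM (euler_is_derivation k psi)) (euler_whomog cpsi hdelta (hdelta dm)).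
    rewrite mulrDr /d; congr (_ + _); first by rewrite [RHS]mulrC mulrA.
    by rewrite -[delta * u * _]mulrA; congr (_ * _); rewrite mulrCA divrr ?mulr1.
  - have hchiP : coefs_in S (map_poly (@eulerC R n k alpha psi) (map_poly sC P)).
      by move=> i; rewrite coef_map_id0 ?drv0 // coef_map /= eulerC_series.
    have red x : S (sC d * eulerC psi x) ->
        ring_gen j cs (frac_deriv (@eulerC R n k alpha psi) (tofrac x) * j d).
      by rewrite (frac_deriv_tofrac dC) /S tofracM mulrC.
    move=> c /csE[[i ->]|[i ->]]; apply: red.
      have := factor_deriv_coefs Sr dC mQ (esym QT) dE' SQ (SAP W) hchiP i.
      by rewrite coefZ coef_map_id0 ?drv0.
    have := factor_deriv_coefs Sr dC mT PT dE' ST (SAP W) hchiP i.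
    by rewrite coefZ coef_map_id0 ?drv0.
have lin : tofrac Q`_l \in cs by apply: map_f; rewrite mem_cat mem_nth.
apply: (log_int_series hk delta0 hdelta uu ics logd lin).
apply: (log_int_base (@series_frac_inj R n k alpha)); last exact: RingGenIn.
by rewrite mulf_neq0 //; apply: contraTneq uu => ->; rewrite unitr0.
Qed.

Lemma factor_poly_in_series (Q T : {poly C}) : Q \is monic -> T \is monic ->
  Q * T = map_poly sC P -> exists Q0, Q = map_poly sC Q0.
Proof.
move=> mQ mT QT; have h := factor_coefs_in_series mQ mT QT.
pose a l := projT1 (cid (h l)); have aE l : Q`_l = sC (a l) := projT2 (cid (h l)).
exists (\poly_(l < size Q) a l); apply/polyP => l; rewrite coef_map coef_poly.
case: ltnP => [_|le]; first exact: aE.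
by rewrite nth_default //; exact/esym/rmorph0.
Qed.

End Assembly.

Theorem theorem7p5 (R : realType) (k : fieldType) (hk : [pchar k] =i pred0)
    (n : nat) (alpha : 'I_n.+2 -> {posnum R})
    (P : {poly mseries n.+2 k}) (hP : P \is monic)
    (delta : {mpoly k[n.+2]}) (hdelta0 : delta != 0)
    (i : R) (hdelta : weighted_homog alpha i delta)
    (u : mseries n.+2 k) (hu : u \is a GRing.unit)
    (hdisc : discriminant P = mpoly_series delta * u)
    (s : nat) (P_ : 'I_s -> {poly mseries n.+2 k})
    (hmonic : forall j, P_ j \is monic)
    (hirr : forall j, irreducible_elt (P_ j))
    (hprod : P = \prod_(j < s) P_ j) :
  forall j, irreducible_elt (map_poly (series_to_completion alpha) (P_ j)).
Proof.
move=> j.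
have d0 : mpoly_series delta != 0.
  apply: contra_neq hdelta0 => /mseriesP d0; apply/mpolyP => m.
  by rewrite mcoeff0; exact: d0.
have dh : whomog alpha i (mpoly_series delta).
  by move=> m dm; apply: hdelta; rewrite mcoeff_msupp.
have mothers : \prod_(l | l != j) P_ l \is monic by apply: monic_prod => l _.
apply: (irreducible_transfer (@series_to_completion_inj _ _ _ alpha) _ (hmonic j) mothers _ (hirr j)).
  exact: (factor_poly_in_series hk hP d0 dh hu hdisc).
by rewrite hprod (bigD1 j).
Qed.
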